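(* Let $E$ be a countable set and let $Z$ be an inhomogeneous semi-Markov process with intensities $(q_{ij})_{i\neq j}$ and state space $E$, and let $U$ be the duration process of $Z$. Then $(Z,U)$ is an inhomogeneous strong Markov process on $E\times\mathbb{R}_+$.
   Context: Setting. Let $(Y_n,S_n)_{n\ge0}$ be random variables with $Y_n\in E$, $Y_{n+1}\neq Y_n$ for all $n\ge 0$, $S_0=0$ and $S_n\in(0,\infty]$ for $n\ge1$. Put $T_n=\sum_{k=0}^nS_k$ and $Z_t=Y_n$ for $T_n\le t<T_{n+1}$ (if $T_{n+1}=\infty$, then $Z_t=Y_n$ for all $t\ge T_n$). Thus $Z$ is a marked point process with event times $(T_n)_{n\ge1}$, marks $(Y_n)$ and initial mark $Y_0$. The duration process is $U_t=t-\sup\{0\le s\le t: Z_s\neq Z_t\}$, with $\sup\emptyset=0$. Let $(\mathcal{F}_t)$ be the filtration induced by $Z$. Intensities. For $i\neq j$ in $E$, $q_{ij}:\mathbb{R}_+^2\to\mathbb{R}_+$ is measurable, and $q_i(t,u)=\sum_{j\neq i}q_{ij}(t,u)$. It is assumed that $\sup_{(t,u)\in K}\sup_{i\in E}q_i(t,u)<\infty$ for every compact $K\subseteq\mathbb{R}_+^2$, and that each $q_i$ is Lebesgue integrable on compact subsets of $\mathbb{R}_+^2$. (The bound ensures that no explosion occurs.) $Z$ is an inhomogeneous semi-Markov process with intensities $(q_{ij})$ if the marked point process $Z$ has intensity process $\lambda_t(i)=1_{(Z_{t-}\neq i)}\,q_{Z_{t-}i}(t,U_{t-})$, $i\in E$;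 that is, for each $i\in E$ the process counting the jumps of $Z$ into state $i$ has compensator $\int_0^t\lambda_s(i)\,\mathrm{d}s$ with respect to $(\mathcal{F}_t)$. Strong Markov: there are transition probabilities $P_{s,t}((i,u),\cdot)$ on $E\times\mathbb{R}_+$, $0\le s\le t$, such that for every stopping time $T$ and $t\ge0$, $P((Z_{T+t},U_{T+t})\in C\mid\mathcal{F}_T)=P_{T,T+t}((Z_T,U_T),C)$ almost surely on $(T<\infty)$, for measurable $C\subseteq E\times\mathbb{R}_+$. *)

(* Defs.v *)
From HB Require Import structures.
From mathcomp Require Import all_boot all_order all_algebra.
From mathcomp Require Import all_classical all_reals all_analysis.
From mathcomp Require Import measurable_realfun.
Import Order.TTheory GRing.Theory Num.Theory.
Import numFieldNormedType.Exports.

Set Implicit Arguments.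
Unset Strict Implicit.
Unset Printing Implicit Defensive.

Local Open Scope classical_set_scope.
Local Open Scope ring_scope.

(* A sub-sigma-algebra is a [set (set W)], a process a function of a time
   t : R (only t >= 0 matters) and an outcome w : W, and a random time a
   function W -> \bar R.  Filtrations are neither completed nor made
   right-continuous. *)

Section Processes.
Context {R : realType} {d : measure_display} {W : measurableType d}.
Implicit Types (P : probability W R) (G : set (set W)) (F : R -> set (set W))
  (tau : W -> \bar R) (M L N : R -> W -> \bar R).

Definition measurable_wrt {d'} {T : measurableType d'} G (X : W -> T) : Prop :=
  forall B : set T, measurable B -> G (X @^-1` B).

Definition natural_filtration {d'} {T : measurableType d'} (X : R -> W -> T)
    (t : R) : set (set W) :=
  <<s [set A | exists s (B : set T),
         [/\ 0 <= s <= t, measurable B & A = X s @^-1` B] ] >>.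

Definition adapted {d'} {T : measurableType d'} F (X : R -> W -> T) : Prop :=
  forall t, 0 <= t -> measurable_wrt (F t) (X t).

Definition stopping_time F tau : Prop :=
  (forall w, (0 <= tau w)%E) /\
  (forall t, 0 <= t -> F t [set w | (tau w <= t%:E)%E]).

Definition stopped_sigma_algebra F tau : set (set W) :=
  [set A | measurable A /\
     forall t, 0 <= t -> F t (A `&` [set w | (tau w <= t%:E)%E])].

(* V is a version of E[X | G]. *)
Definition is_cond_expectation P G (X V : W -> \bar R) : Prop :=
  [/\ measurable_wrt G V, P.-integrable setT V &
      forall A, G A -> (\int[P]_(w in A) V w = \int[P]_(w in A) X w)%E].

Definition martingale P F M : Prop :=
  [/\ adapted F M,
      forall t, 0 <= t -> P.-integrable setT (M t) &
      forall s t, 0 <= s -> s <= t -> is_cond_expectation P (F s) (M t) (M s)].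

Definition stopped_process M tau : R -> W -> \bar R :=
  fun t w => M (fine (Order.min t%:E (tau w))) w.

Definition local_martingale P F M : Prop :=
  exists tau : nat -> W -> \bar R,
    [/\ forall n, stopping_time F (tau n),
        forall n w, (tau n w <= tau n.+1 w)%E,
        {ae P, forall w, tau n w @[n --> \oo] --> +oo%E} &
        forall n, martingale P F (stopped_process M (tau n))].

Definition half_line : set (R * W) := [set x | 0 <= x.1].

Definition predictable_rectangle F : set (set (R * W)) :=
  [set D | (exists2 A, F 0 A & D = [set 0] `*` A) \/
           (exists s t A, [/\ 0 <= s, s < t, F s A & D = `]s, t] `*` A])].

Definition predictable F M : Prop :=
  forall B : set (\bar R), measurable B ->
    <<s half_line, predictable_rectangle F >>
      (half_line `&` [set x | B (M x.1 x.2)]).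

Definition is_compensator P F N L : Prop :=
  [/\ predictable F L,
      forall w, L 0 w = 0%E,
      forall w s t, 0 <= s -> s <= t -> (L s w <= L t w)%E,
      forall w t, 0 <= t -> L s w @[s --> t^'+] --> L t w &
      local_martingale P F (fun t w => (N t w - L t w)%E)].

(* State space D, a measurable subset of T.  The transition probabilities are
   Markov kernels on T that map D into D, i.e. Markov kernels on D extended
   arbitrarily to T. *)
Definition strong_markov {d'} {T : measurableType d'} P F (D : set T)
    (X : R -> W -> T) : Prop :=
  [/\ adapted F X,
      forall t w, 0 <= t -> D (X t w) &
      exists p : R -> R -> R.-pker T ~> T,
        (forall s t x, 0 <= s -> s <= t -> D x -> p s t x D = 1%E) /\
        (forall tau, stopping_time F tau ->
         forall t, 0 <= t ->
         forall C, measurable C -> C `<=` D ->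
         exists V : W -> \bar R,
           is_cond_expectation P (stopped_sigma_algebra F tau)
             (fun w => (\1_[set w' | (tau w' < +oo)%E /\
                              C (X (fine (tau w') + t) w')] w)%:E) V /\
           {ae P, forall w, (tau w < +oo)%E ->
              V w = p (fine (tau w)) (fine (tau w) + t)
                      (X (fine (tau w)) w) C})].

End Processes.

Section MarkedPointProcess.
Context {R : realType} {d : measure_display} {W : measurableType d}.
Context {dE : measure_display} {E : measurableType dE}.
Variables (Y : nat -> W -> E) (S : nat -> W -> \bar R).

Definition is_mpp : Prop :=
  [/\ forall n, measurable_fun setT (Y n),
      forall n, measurable_fun setT (S n),
      forall n w, Y n.+1 w <> Y n w,
      forall w, S 0%N w = 0%E &
      forall n w, (0 < S n.+1 w)%E].

Definition event_time (n : nat) (w : W) : \bar R :=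
  (\sum_(k < n.+1) S k w)%E.

(* When t lies beyond all event times (explosion), the value is set to
   Y 0 w. *)
Definition mpp_process (t : R) (w : W) : E :=
  xget (Y 0%N w) [set y | exists2 n,
    (event_time n w <= t%:E < event_time n.+1 w)%E & y = Y n w].

(* sup set0 = 0 holds by definition of sup. *)
Definition duration (t : R) (w : W) : R :=
  t - sup [set s | 0 <= s <= t /\ mpp_process s w <> mpp_process t w].

(* Left limit in the discrete space E; the default value is only used at an
   explosion time. *)
Definition mpp_left (t : R) (w : W) : E :=
  xget (mpp_process t w)
    [set y | \forall s \near t^'-, mpp_process s w = y].

Definition duration_left (t : R) (w : W) : R :=
  lim (duration s w @[s --> t^'-]).

(* Number of events with mark i in [0, t]; it may be +oo. *)
Definition counting_process (i : E) (t : R) (w : W) : \bar R :=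
  counting [set n : nat |
    [/\ (0 < n)%N, (event_time n w <= t%:E)%E & Y n w = i]].

Definition intensity (q : E -> E -> R * R -> R) (i : E) (t : R) (w : W) : R :=
  if mpp_left t w == i then 0 else q (mpp_left t w) i (t, duration_left t w).

Definition integrated_intensity (q : E -> E -> R * R -> R) (i : E) (t : R)
    (w : W) : \bar R :=
  (\int[lebesgue_measure]_(s in `[0%R, t]) (intensity q i s w)%:E)%E.

Definition is_semi_markov (P : probability W R) (q : E -> E -> R * R -> R) :
    Prop :=
  is_mpp /\
  forall i, is_compensator P (natural_filtration mpp_process)
    (counting_process i) (integrated_intensity q i).

End MarkedPointProcess.

Section Rates.
Context {R : realType} {dE : measure_display} {E : measurableType dE}.
Variable q : E -> E -> R * R -> R.

Definition quadrant : set (R * R) := [set x | 0 <= x.1 /\ 0 <= x.2].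

Definition exit_rate (i : E) (x : R * R) : \bar R :=
  (\esum_(j in [set j | j <> i]) (q i j x)%:E)%E.

Definition admissible_rates : Prop :=
  [/\ forall i j, i <> j -> measurable_fun quadrant (q i j),
      forall i j x, i <> j -> quadrant x -> 0 <= q i j x,
      forall K : set (R * R), compact K -> K `<=` quadrant ->
        (ereal_sup [set ereal_sup [set exit_rate i x | i in setT]
                      | x in K] < +oo)%E &
      forall i (K : set (R * R)), compact K -> K `<=` quadrant ->
        (lebesgue_measure \x lebesgue_measure)%E.-integrable K (exit_rate i)].

End Rates.

(* Main.v *)
(* Fix a horizon N.  The rates are bounded by some B on [0, N], so the transition
   probabilities can be built by uniformization: at the times of a clock of rate
   B the chain either jumps according to q or stays where it is.  The resulting
   value g(v; s, i, u), the mean of a payoff at time v for a start at time s in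
   state i with duration u, decreases along a path without jumps at
   the rate \sum_j q_ij (g(v; ., j, 0) - g).
   Telescoping this identity over the jumps of Z on ]tau, tau + t] expresses
   f(X_(tau+t)) - g(tau + t; tau, X_tau) as a sum over the jumps minus its
   compensator.  On an event of F_tau both integrands are predictable, so the
   two expectations agree by the compensator formula, and taking f = 1_C gives
   the strong Markov property.  The compensator formula is first obtained for
   ]s, t] x A, A in F_s, by monotone convergence along a localizing sequence
   (which needs no a priori bound on the jump counts), then extended to all
   nonnegative predictable integrands; applied to the constant 1 it excludes
   explosion. *)
Require Import Defs.
From HB Require Import structures.
From mathcomp Require Import all_boot all_order all_algebra.
From mathcomp Require Import all_classical all_reals all_analysis.
From mathcomp Require Import measurable_realfun ring lra.
From mathcomp Require finmap.
Import Order.TTheory GRing.Theory Num.Theory.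
Import numFieldNormedType.Exports.

Set Implicit Arguments.
Unset Strict Implicit.
Unset Printing Implicit Defensive.

Local Open Scope classical_set_scope.
Local Open Scope ring_scope.
Local Open Scope ereal_scope.

(** All quantities are nonnegative and take values in [\bar R], so Tonelli applies throughout; every
    identity is kept free of subtraction, with negative terms moved to the other side, and terms are
    cancelled only once they are known to be finite. Uniformization is chosen for its mass: with
    total rate exactly B, the paths with m clock ticks contribute (B(v-s))^m/m!, which sums to
    exp(B(v-s)), so the normalized kernel is a probability without any argument on explosion of the
    constructed chain. B depends on the horizon although tau is unbounded. The kernel from s to t is
    built with horizon truncn(max s t) + 1, and an event of F_tau is split by the value of
    truncn(tau + t); kernels of different horizons are never compared. The filtration is raw, and
    explosion is excluded only almost surely. The path lemmas therefore hold for every outcome: the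
    default [Y 0] beyond all event times keeps paths right-continuous, and rational times yield
    measurability for F_t, F_tau and the predictable sigma-algebra. *)

Section Preliminaries.
Context {R : realType}.
Local Notation mu := (@lebesgue_measure R).

(** Variable endpoints become an indicator in the integrand, which reduces the claim to Tonelli's
    measurability of partial integrals. *)
Lemma measurable_integral_itv d (T : measurableType d) (a b : T -> R)
    (h : T * R -> \bar R) :
  measurable_fun setT a -> measurable_fun setT b -> measurable_fun setT h ->
  (forall z, 0 <= h z) ->
  measurable_fun setT (fun x => \int[mu]_(r in `]a x, b x]) h (x, r)).
Proof.
move=> ma mb mh h0.
pose g (z : T * R) := if (a z.1 < z.2)%R && (z.2 <= b z.1)%R then h z else 0.
rewrite [X in measurable_fun _ X](_ : _ = fubini_F mu g); last first.
  apply/funext => x; rewrite integral_mkcond; apply: eq_integral => r _.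
  by rewrite patchE mem_setE in_itv.
apply: measurable_fun_fubini_tonelli_F => [|z]; last by rewrite /g; case: ifP.
apply: measurable_fun_ifT => //; apply: measurable_and.
  by apply: measurable_fun_ltr => //; apply: measurableT_comp.
by apply: measurable_fun_ler => //; apply: measurableT_comp.
Qed.

Lemma ge0_integral_itv_split (a b c : R) (h : R -> \bar R) :
  (a <= b)%R -> (b <= c)%R -> measurable_fun `]a, c]%classic h ->
  (forall r, (a < r)%R -> (r <= c)%R -> 0 <= h r) ->
  \int[mu]_(r in `]a, c]) h r =
  \int[mu]_(r in `]a, b]) h r + \int[mu]_(r in `]b, c]) h r.
Proof.
move=> ab bc mh h0.
have E : `]a, c]%classic = `]a, b]%classic `|` `]b, c]%classic.
  rewrite -itv_bndbnd_setU //; by rewrite bnd_simp.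
rewrite E ge0_integral_setU //=.
- by rewrite -E.
- move=> x [] /=; rewrite in_itv/= => /andP[x1 x2]; apply: h0 => //.
    exact: le_trans bc.
  exact: le_lt_trans x1.
- rewrite disj_set2E; apply/eqP; apply/seteqP; split => x //= [].
  rewrite !in_itv/= => /andP[_ x1] /andP[x2 _].
  by move: (lt_le_trans x2 x1); rewrite ltxx.
Qed.

Lemma is_derive_pow_primitive (c v x : R) m :
  is_derive x 1%R (fun r : R => - ((c * (v - r)) ^+ m.+1 / (m.+1)`!%:R))%R
    (c * (c * (v - x)) ^+ m / m`!%:R)%R.
Proof.
have -> : (fun r : R => - ((c * (v - r)) ^+ m.+1 / (m.+1)`!%:R))%R =
   (- ((m.+1)`!%:R^-1 *: ((c *: (cst v - (@id R))) ^+ m.+1)))%R.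
  apply/funext => r; rewrite /= !fctE /=.
  by rewrite /GRing.scale/= mulrC.
apply: is_derive_eq.
rewrite /GRing.scale/= !fctE /=.
rewrite factS natrM invfM.
have : (m.+1%:R : R) != 0%R by rewrite pnatr_eq0.
have : (m`!%:R : R) != 0%R by rewrite pnatr_eq0 -lt0n fact_gt0.
rewrite /GRing.scale /= => h1 h2; rewrite sub0r mulrN mulr1.
by field; rewrite h1 nat1r h2.
Qed.
(** Inductive step for the tick masses: rate c times the weight of m ticks after r, integrated over
    the time r of the first tick, is the weight of m + 1 ticks. *)
Lemma integral_pow_itv (c s v : R) m : (s <= v)%R ->
  \int[mu]_(r in `]s, v]) (c * (c * (v - r)) ^+ m / m`!%:R)%:E =
  ((c * (v - s)) ^+ m.+1 / (m.+1)`!%:R)%:E.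
Proof.
rewrite le_eqVlt => /predU1P[->|sv].
  by rewrite set_itvoc0 integral_set0 subrr mulr0 expr0n mul0r.
have cf : continuous (fun r : R => c * (c * (v - r)) ^+ m / m`!%:R : R)%R.
  move=> r; apply: cvgMl; apply: cvgMr.
  apply: (@continuous_comp _ _ _ (fun r => c * (v - r))%R (fun x => x ^+ m)%R).
    by apply: cvgMr; apply: cvgB; [exact: cvg_cst|exact: cvg_id].
  exact: exprn_continuous.
rewrite integral_itv_obnd_cbnd; last first.
  apply: measurable_funTS; apply/measurable_EFinP.
  exact: continuous_measurable_fun.
have dF := is_derive_pow_primitive c v ^~ m.
have cF x : continuous_at x (fun r : R => - ((c * (v - r)) ^+ m.+1 / (m.+1)`!%:R))%R.
  by apply: differentiable_continuous; apply/derivable1_diffP; apply: ex_derive.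
rewrite (@continuous_FTC2 _ _ (fun r => - ((c * (v - r)) ^+ m.+1 / (m.+1)`!%:R))%R) //.
- by rewrite subrr mulr0 expr0n mul0r oppr0 add0e -EFinN opprK.
- by apply: continuous_subspaceT.
- split.
  + by move=> x _; exact: ex_derive.
  + by apply: cvg_at_right_filter; exact: cF.
  + by apply: cvg_at_left_filter; exact: cF.
- by move=> x _; rewrite derive1E derive_val.
Qed.
End Preliminaries.

(** * Uniformization *)

Section Uniformization.
Context {R : realType} {dE : measure_display} {E : measurableType dE}.
Local Notation mu := (@lebesgue_measure R).
Variables (qh : E -> nat -> R * R -> R) (e : nat -> E) (B : R).
Hypothesis qh_ge0 : forall i k x, (0 <= qh i k x)%R.
Hypothesis mqh : forall i k, measurable_fun setT (qh i k).
Hypothesis qhB : forall i x, \sum_(k <oo) (qh i k x)%:E <= B%:E.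

Definition exit i x : R := fine (\sum_(k <oo) (qh i k x)%:E).
(** Rate of the fictitious ticks, which fill the total rate up to [B] in every state. *)
Definition stay i x : R := B - exit i x.

Lemma exitE i x : (exit i x)%:E = \sum_(k <oo) (qh i k x)%:E.
Proof.
rewrite fineK // fin_real//; apply/andP; split.
  by apply: (lt_le_trans (ltNyr 0)); apply: nneseries_ge0 => k _ _; rewrite lee_fin.
exact: le_lt_trans (qhB _ _) (ltry _).
Qed.

Lemma exit_ge0 i x : (0 <= exit i x)%R.
Proof. by apply: fine_ge0; apply: nneseries_ge0 => k _ _; rewrite lee_fin. Qed.

Lemma stay_ge0 i x : (0 <= stay i x)%R.
Proof. by rewrite subr_ge0 -lee_fin exitE. Qed.

Lemma B_ge0 : E -> (0 <= B)%R.
Proof.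
move=> i; rewrite -(subrK (exit i (0, 0)%R) B).
exact: addr_ge0 (stay_ge0 _ _) (exit_ge0 _ _).
Qed.

Lemma measurable_exit i : measurable_fun setT (exit i).
Proof.
apply: measurableT_comp => //; apply: ge0_emeasurable_sum => [k x _ _|k _].
  by rewrite lee_fin.
exact/measurable_EFinP.
Qed.

Lemma measurable_stay i : measurable_fun setT (stay i).
Proof. by apply: measurable_funB => //; exact: measurable_exit. Qed.

(* Rates of the chain uniformized at the constant clock [B]: a proper jump
   resets the duration to 0, a fictitious jump changes nothing.  Arguments of
   [F i] are (terminal time, current time, duration). *)
Definition uni_gen (F : E -> R * R * R -> \bar R) i (v r w : R) : \bar R :=
  \sum_(k <oo) (qh i k (r, w))%:E * F (e k) (v, r, 0%R) +
  (stay i (r, w))%:E * F i (v, r, w).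

(** Contribution of the paths with exactly [m] ticks, decomposed at the first tick. The factor
    exp(-B(v-s)), common to all tick densities, is left out here and restored in [uni_val], so that
    the recursion contains no exponential. *)
Fixpoint uni_jumps (f : E -> R -> \bar R) (m : nat) (i : E) (x : R * R * R) :
    \bar R :=
  if m is m'.+1 then
    \int[mu]_(r in `]x.1.2, x.1.1])
       uni_gen (uni_jumps f m') i x.1.1 r (x.2 + (r - x.1.2))%R
  else f i (x.2 + (x.1.1 - x.1.2))%R.

Definition uni_sum f i x : \bar R := \sum_(m <oo) uni_jumps f m i x.

Lemma uni_gen_ge0 F i v r w : (forall j x, 0 <= F j x) -> 0 <= uni_gen F i v r w.
Proof.
move=> F0; apply: adde_ge0.
  by apply: nneseries_ge0 => k _ _; apply: mule_ge0 => //; rewrite lee_fin.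
by apply: mule_ge0 => //; rewrite lee_fin stay_ge0.
Qed.

Lemma uni_jumps_ge0 f m i x : (forall j u, 0 <= f j u) -> 0 <= uni_jumps f m i x.
Proof.
move=> f0; elim: m i x => [|m IH] i x //=.
by apply: integral_ge0 => r _; apply: uni_gen_ge0.
Qed.

Lemma uni_sum_ge0 f i x : (forall j u, 0 <= f j u) -> 0 <= uni_sum f i x.
Proof. by move=> f0; apply: nneseries_ge0 => m _ _; exact: uni_jumps_ge0. Qed.

Lemma measurable_uni_gen F i d (T : measurableType d) (v r w : T -> R) :
  (forall j x, 0 <= F j x) -> (forall j, measurable_fun setT (F j)) ->
  measurable_fun setT v -> measurable_fun setT r -> measurable_fun setT w ->
  measurable_fun setT (fun t => uni_gen F i (v t) (r t) (w t)).
Proof.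
move=> F0 mF mv mr mw; apply: emeasurable_funD.
  apply: ge0_emeasurable_sum => [k x _ _|k _].
    by apply: mule_ge0 => //; rewrite lee_fin.
  apply: emeasurable_funM.
    apply/measurable_EFinP; apply: (measurableT_comp (mqh i k)).
    exact: measurable_fun_pair.
  apply: (measurableT_comp (mF (e k))); apply: measurable_fun_pair => //.
  exact: measurable_fun_pair.
apply: emeasurable_funM.
  apply/measurable_EFinP; apply: (measurableT_comp (measurable_stay i)).
  exact: measurable_fun_pair.
apply: (measurableT_comp (mF i)); apply: measurable_fun_pair => //.
exact: measurable_fun_pair.
Qed.

Lemma measurable_uni_jumps f m i : (forall j u, 0 <= f j u) ->
  (forall j, measurable_fun setT (f j)) -> measurable_fun setT (uni_jumps f m i).
Proof.
move=> f0 mf; elim: m i => [|m IH] i /=.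
  apply: (measurableT_comp (mf i)); apply: measurable_funD => //.
  by apply: measurable_funB; apply: measurableT_comp.
have m11 : measurable_fun setT (fun x : R * R * R => x.1.1).
  exact: measurableT_comp.
have m12 : measurable_fun setT (fun x : R * R * R => x.1.2).
  exact: measurableT_comp.
apply: (measurable_integral_itv (h := fun z : (R * R * R) * R =>
   uni_gen (uni_jumps f m) i z.1.1.1 z.2 (z.1.2 + (z.2 - z.1.1.2))%R)) => //.
  apply: measurable_uni_gen => //; first by move=> j x; exact: uni_jumps_ge0.
    exact: (measurableT_comp m11).
  apply: measurable_funD; first exact: measurableT_comp.
  by apply: measurable_funB => //; exact: (measurableT_comp m12).
by move=> z; apply: uni_gen_ge0 => j x; exact: uni_jumps_ge0.
Qed.

Lemma measurable_uni_sum f i : (forall j u, 0 <= f j u) ->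
  (forall j, measurable_fun setT (f j)) -> measurable_fun setT (uni_sum f i).
Proof.
move=> f0 mf; apply: ge0_emeasurable_sum => [k x _ _|k _].
  exact: uni_jumps_ge0.
exact: measurable_uni_jumps.
Qed.

Lemma uni_gen_nneseries (F : nat -> E -> R * R * R -> \bar R) i v r w :
  (forall l j x, 0 <= F l j x) ->
  uni_gen (fun j x => \sum_(l <oo) F l j x) i v r w =
  \sum_(l <oo) uni_gen (F l) i v r w.
Proof.
move=> F0; rewrite nneseriesD; last 2 first.
- move=> l _ _; apply: nneseries_ge0 => k _ _.
  by apply: mule_ge0 => //; rewrite lee_fin.
- by move=> l _ _; apply: mule_ge0 => //; rewrite lee_fin stay_ge0.
rewrite nneseries_interchange; last first.
  by move=> l k; apply: mule_ge0 => //; rewrite lee_fin.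
congr (_ + _); last by rewrite nneseriesZl.
by apply: eq_eseriesr => k _; rewrite nneseriesZl.
Qed.

Lemma uni_jumps_nneseries (f : nat -> E -> R -> \bar R) m i x :
  (forall l j u, 0 <= f l j u) -> (forall l j, measurable_fun setT (f l j)) ->
  uni_jumps (fun j u => \sum_(l <oo) f l j u) m i x =
  \sum_(l <oo) uni_jumps (f l) m i x.
Proof.
move=> f0 mf; elim: m i x => [//|m IH] i x /=.
transitivity (\int[mu]_(r in `]x.1.2, x.1.1])
   \sum_(l <oo) uni_gen (uni_jumps (f l) m) i x.1.1 r (x.2 + (r - x.1.2))%R).
  apply: eq_integral => r _; rewrite -uni_gen_nneseries; last first.
    by move=> *; exact: uni_jumps_ge0.
  by congr uni_gen; apply/funext => j; apply/funext => y; rewrite IH.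
rewrite integral_nneseries //.
  move=> l; apply: measurable_funTS; apply: measurable_uni_gen => //.
  - by move=> *; exact: uni_jumps_ge0.
  - by move=> *; exact: measurable_uni_jumps.
  - by apply: measurable_funD => //; apply: measurable_funB.
by move=> l r _; apply: uni_gen_ge0 => j y; exact: uni_jumps_ge0.
Qed.

(** Countable additivity in the payoff, which becomes the sigma-additivity of the transition
    kernel. *)
Lemma uni_sum_nneseries (f : nat -> E -> R -> \bar R) i x :
  (forall l j u, 0 <= f l j u) -> (forall l j, measurable_fun setT (f l j)) ->
  uni_sum (fun j u => \sum_(l <oo) f l j u) i x = \sum_(l <oo) uni_sum (f l) i x.
Proof.
move=> f0 mf; rewrite /uni_sum nneseries_interchange; last first.
  by move=> l m; exact: uni_jumps_ge0.
by apply: eq_eseriesr => m _; exact: uni_jumps_nneseries.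
Qed.

(** Decomposition at the first tick: the term m = 0 is the payoff without ticks, and shifting the
    index by one in the remaining series recovers the whole sum under the generator. *)
Lemma uni_sumE f i v s u : (forall j w, 0 <= f j w) ->
  (forall j, measurable_fun setT (f j)) ->
  uni_sum f i (v, s, u) = f i (u + (v - s))%R +
  \int[mu]_(r in `]s, v]) uni_gen (uni_sum f) i v r (u + (r - s))%R.
Proof.
move=> f0 mf; rewrite {1}/uni_sum nneseries_recl//; last first.
  by move=> m _; exact: uni_jumps_ge0.
congr (_ + _).
transitivity (\int[mu]_(r in `]s, v])
   \sum_(m <oo) uni_gen (uni_jumps f m) i v r (u + (r - s))%R); last first.
  by apply: eq_integral => r _; rewrite uni_gen_nneseries // => *; exact: uni_jumps_ge0.
rewrite integral_nneseries //; last 2 first.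
- move=> l; apply: measurable_funTS; apply: measurable_uni_gen => //.
  + by move=> *; exact: uni_jumps_ge0.
  + by move=> *; exact: measurable_uni_jumps.
  + by apply: measurable_funD => //; apply: measurable_funB.
- by move=> l r _; apply: uni_gen_ge0 => j y; exact: uni_jumps_ge0.
rewrite -(nneseries_addn 1); last by move=> m; exact: uni_jumps_ge0.
by apply: eq_eseriesr => m _; rewrite addn1.
Qed.

Lemma measurable_uni_gen_sum f i v s u : (forall j w, 0 <= f j w) ->
  (forall j, measurable_fun setT (f j)) ->
  measurable_fun setT (fun r => uni_gen (uni_sum f) i v r (u + (r - s))%R).
Proof.
move=> f0 mf; apply: measurable_uni_gen => //.
- by move=> *; exact: uni_sum_ge0.
- by move=> *; exact: measurable_uni_sum.
- by apply: measurable_funD => //; apply: measurable_funB.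
Qed.

(** Duration grows at unit speed, so ageing from [a] to [b] leaves both the tick-free payoff and the
    integrand on ]b, v] unchanged; only the integral over ]a, b] is lost. *)
Lemma uni_sum_flow f i v a b u : (forall j w, 0 <= f j w) ->
  (forall j, measurable_fun setT (f j)) -> (a <= b)%R -> (b <= v)%R ->
  uni_sum f i (v, a, u) = uni_sum f i (v, b, (u + (b - a))%R) +
  \int[mu]_(r in `]a, b]) uni_gen (uni_sum f) i v r (u + (r - a))%R.
Proof.
move=> f0 mf ab bv; rewrite !uni_sumE //.
have -> : (u + (b - a) + (v - b) = u + (v - a))%R by ring.
rewrite (ge0_integral_itv_split ab bv); last 2 first.
- by apply: measurable_funTS; exact: measurable_uni_gen_sum.
- by move=> r _ _; apply: uni_gen_ge0 => *; exact: uni_sum_ge0.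
have -> : \int[mu]_(r in `]b, v]) uni_gen (uni_sum f) i v r (u + (b - a) + (r - b))%R =
          \int[mu]_(r in `]b, v]) uni_gen (uni_sum f) i v r (u + (r - a))%R.
  by apply: eq_integral => r _; congr uni_gen; ring.
suff aux (x y z : \bar R) : x + (y + z) = x + z + y by exact: aux.
by rewrite addeA addeAC.
Qed.

(** [D] is a set of durations left neither by ageing nor by a reset to 0, so a payoff equal to 1 on
    [D] behaves like the constant 1. Since [exit] and [stay] add up to [B], each tick has the
    constant rate [B], and the powers follow by integration. The whole line as [D] gives the total
    mass of the kernel; the nonnegative durations show that it preserves the state space. *)
Lemma uni_jumps_mass f (D : set R) m i v s u :
  (forall j w, 0 <= f j w) -> (forall j w, D w -> f j w = 1) ->
  D 0%R -> (forall w w', D w -> (w <= w')%R -> D w') -> D u -> (s <= v)%R ->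
  uni_jumps f m i (v, s, u) = ((B * (v - s)) ^+ m / m`!%:R)%:E.
Proof.
move=> f0 f1 D0 Dle; elim: m i s u => [|m IH] i s u Du sv /=.
  by rewrite expr0 fact0 divr1 f1//; apply: Dle Du _; rewrite lerDl subr_ge0.
rewrite -integral_pow_itv//; apply: eq_integral => r; rewrite inE/= in_itv/=.
move=> /andP[sr rv]; rewrite /uni_gen IH//; last first.
  by apply: Dle Du _; rewrite lerDl subr_ge0 ltW.
under eq_eseriesr do rewrite IH// muleC.
rewrite nneseriesZl; last by move=> k _; rewrite lee_fin.
rewrite -exitE -!EFinM -EFinD; congr EFin; rewrite /stay; ring.
Qed.

Lemma uni_sum_mass f (D : set R) i v s u :
  (forall j w, 0 <= f j w) -> (forall j w, D w -> f j w = 1) ->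
  D 0%R -> (forall w w', D w -> (w <= w')%R -> D w') -> D u -> (s <= v)%R ->
  uni_sum f i (v, s, u) = (expR (B * (v - s)))%:E.
Proof.
move=> f0 f1 D0 Dle Du sv; rewrite /uni_sum.
under eq_eseriesr do rewrite (uni_jumps_mass _ _ f0 f1)//.
rewrite /expR -EFin_lim; last exact: is_cvg_series_exp_coeff.
by apply: congr_lim; apply/funext => n /=; rewrite /series/= sumEFin.
Qed.

End Uniformization.

(** * Exponential weights and integration by parts *)

Section ExponentialWeight.
Context {R : realType}.
Local Notation mu := (@lebesgue_measure R).

Lemma integral_expR_itv (c a b : R) : (a <= b)%R ->
  \int[mu]_(r in `]a, b]) (c * expR (c * r))%:E =
  (expR (c * b) - expR (c * a))%:E.
Proof.
rewrite le_eqVlt => /predU1P[->|ab].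
  by rewrite set_itvoc0 integral_set0 subrr.
have dF (x : R) : is_derive x 1%R (fun r : R => expR (c * r)) (c * expR (c * x))%R.
  have -> : (fun r : R => expR (c * r)) = expR \o (c *: (@id R)) by [].
  apply: is_derive_eq (is_derive1_comp _ _) _.
  by rewrite /GRing.scale/= mulr1 mulrC.
have cE : continuous (fun r : R => expR (c * r)).
  move=> x; apply: differentiable_continuous; apply/derivable1_diffP.
  exact: ex_derive.
have cf : continuous (fun r : R => c * expR (c * r) : R)%R.
  by move=> x; apply: cvgMr; exact: cE.
rewrite integral_itv_obnd_cbnd; last first.
  apply: measurable_funTS; apply/measurable_EFinP.
  exact: continuous_measurable_fun.
rewrite (@continuous_FTC2 _ _ (fun r => expR (c * r))%R) //.
- exact: continuous_subspaceT.
- split.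
  + by move=> x _; exact: ex_derive.
  + by apply: cvg_at_right_filter; exact: cE.
  + by apply: cvg_at_left_filter; exact: cE.
- by move=> x _; rewrite derive1E derive_val.
Qed.

Lemma measurable_cexpR (c : R) d (T : measurableType d) (f : T -> R) :
  measurable_fun setT f -> measurable_fun setT (fun x => (c * expR (c * f x))%:E).
Proof.
move=> mf; apply/measurable_EFinP; apply: measurable_funM => //.
by apply: measurableT_comp => //; apply: measurable_funM.
Qed.

(** Integration by parts of exp(c r) against h(r) = g + \int_r^b k, whose derivative is -k. As [k]
    is merely measurable and its integral may be infinite, the double integral is exchanged by
    Tonelli on the triangle a < r < x <= b, and nothing is subtracted. *)
Lemma expR_variation_of_constants (c a b : R) (g : \bar R) (k : R -> \bar R) :
  (0 <= c)%R -> (a <= b)%R -> 0 <= g -> measurable_fun setT k ->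
  (forall r, 0 <= k r) ->
  (expR (c * a))%:E * (g + \int[mu]_(x in `]a, b]) k x) +
  \int[mu]_(r in `]a, b]) ((c * expR (c * r))%:E * (g + \int[mu]_(x in `]r, b]) k x)) =
  (expR (c * b))%:E * g + \int[mu]_(r in `]a, b]) ((expR (c * r))%:E * k r).
Proof.
move=> c0 ab g0 mk k0.
have ce0 r : 0 <= (c * expR (c * r))%:E by rewrite lee_fin mulr_ge0 ?expR_ge0.
have ik0 r : 0 <= \int[mu]_(x in `]r, b]) k x by apply: integral_ge0.
have mik : measurable_fun setT (fun r => \int[mu]_(x in `]r, b]) k x).
  apply: (@measurable_integral_itv R _ R id (cst b) (k \o snd)) => //=.
  exact: measurableT_comp.
have -> : \int[mu]_(r in `]a, b])
      ((c * expR (c * r))%:E * (g + \int[mu]_(x in `]r, b]) k x)) =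
    \int[mu]_(r in `]a, b]) ((c * expR (c * r))%:E * g +
      (c * expR (c * r))%:E * \int[mu]_(x in `]r, b]) k x).
  by apply: eq_integral => r _; rewrite ge0_muleDr.
rewrite ge0_integralD//; last 4 first.
- by move=> x _; rewrite mule_ge0.
- apply: measurable_funTS; apply: emeasurable_funM => //.
  exact: measurable_cexpR.
- by move=> x _; rewrite mule_ge0.
- apply: measurable_funTS; apply: emeasurable_funM => //.
  exact: measurable_cexpR.
rewrite ge0_integralZr//; last first.
  by apply: measurable_funTS; exact: measurable_cexpR.
rewrite integral_expR_itv//.
have -> : \int[mu]_(r in `]a, b]) ((c * expR (c * r))%:E * \int[mu]_(x in `]r, b]) k x)
   = \int[mu]_(x in `]a, b]) ((expR (c * x) - expR (c * a))%:E * k x).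
  pose F (z : R * R) := if [&& a < z.1, z.1 < z.2 & z.2 <= b]%R then
     (c * expR (c * z.1))%:E * k z.2 else 0.
  transitivity (\int[mu]_r \int[mu]_x F (r, x)).
    rewrite integral_mkcond; apply: eq_integral => r _.
    rewrite patchE mem_setE in_itv/= -ge0_integralZl//; last exact: measurable_funTS.
    case: ifPn => [/andP[ar rb]|nar].
      rewrite integral_mkcond; apply: eq_integral => x _.
      by rewrite patchE mem_setE in_itv/= /F/= ar.
    rewrite integral0_eq// => x _; rewrite /F/=; case: ifP => // /and3P[ar rx xb].
    by move: nar; rewrite ar /= (ltW (lt_le_trans rx xb)).
  rewrite (@fubini_tonelli _ _ _ _ R mu mu F); last 2 first.
  - apply: measurable_fun_ifT => //.
      apply: measurable_and; first exact: measurable_fun_ltr.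
      apply: measurable_and; first exact: measurable_fun_ltr.
      exact: measurable_fun_ler.
    apply: emeasurable_funM; last exact: measurableT_comp.
    exact: measurable_cexpR.
  - by move=> z; rewrite /F; case: ifP => // _; rewrite mule_ge0.
  rewrite [RHS]integral_mkcond; apply: eq_integral => x _.
  rewrite patchE mem_setE in_itv/=; case: ifPn => [/andP[ax xb]|nax].
    rewrite -integral_expR_itv; last exact: ltW.
    rewrite (integral_itv_bndoo _ false); last first.
      by apply: measurable_funTS; exact: measurable_cexpR.
    rewrite -ge0_integralZr//; last first.
      by apply: measurable_funTS; exact: measurable_cexpR.
    rewrite [RHS]integral_mkcond; apply: eq_integral => r _.
    by rewrite patchE mem_setE in_itv/= /F/= xb andbT.
  rewrite integral0_eq// => r _; rewrite /F/=; case: ifP => // /and3P[ar rx xb].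
  by move: nax; rewrite xb (lt_trans ar rx).
have ea : (0 <= expR (c * a))%R by exact: expR_ge0.
have eba : (0 <= expR (c * b) - expR (c * a))%R.
  by rewrite subr_ge0 ler_expR ler_wpM2l.
rewrite ge0_muleDr//.
rewrite -ge0_integralZl//; last exact: measurable_funTS.
have mea : measurable_fun setT (fun x : R => (expR (c * a))%:E * k x).
  by apply: emeasurable_funM.
rewrite addeACA -ge0_muleDl ?lee_fin// -EFinD subrKC; congr (_ + _).
rewrite -ge0_integralD//; last 4 first.
- by move=> x _; rewrite mule_ge0.
- exact: measurable_funTS.
- move=> x; rewrite /= in_itv/= => /andP[ax _]; rewrite mule_ge0//.
  by rewrite lee_fin subr_ge0 ler_expR ler_wpM2l// ltW.
- apply: measurable_funTS; apply: emeasurable_funM => //.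
  apply/measurable_EFinP; apply: measurable_funB => //.
  by apply: measurableT_comp => //; apply: measurable_funM.
apply: eq_integral => x; rewrite inE/= in_itv/= => /andP[ax _].
rewrite -ge0_muleDl ?lee_fin//; first by rewrite -EFinD subrKC.
by rewrite subr_ge0 ler_expR ler_wpM2l// ltW.
Qed.

End ExponentialWeight.

(** A countable discrete state can be frozen: measurability needs to be checked only for each fixed
    value of it. *)
Lemma measurable_fun_countable_case d1 d2 d3 (T1 : measurableType d1)
    (T2 : measurableType d2) (I : measurableType d3) (z : T1 -> I)
    (h : I -> T1 -> T2) :
  countable [set: I] -> (forall i : I, measurable [set i]) ->
  measurable_fun setT z -> (forall i, measurable_fun setT (h i)) ->
  measurable_fun setT (fun w => h (z w) w).
Proof.
move=> cI mI mz mh _ Y mY; rewrite setTI.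
rewrite [X in measurable X](_ : _ = \bigcup_(i in setT) (z @^-1` [set i] `&` h i @^-1` Y)).
  apply: countable_bigcupT_measurable => // i; apply: measurableI.
    by rewrite -[X in measurable X]setTI; exact: mz.
  by rewrite -[X in measurable X]setTI; exact: mh.
by apply/seteqP; split => [w wY|w [i _ [/= -> //]]]; exists (z w).
Qed.

(** * Normalized value function and transition kernels *)

Section UniformizedSemigroup.
Context {R : realType} {dE : measure_display} {E : measurableType dE}.
Local Notation mu := (@lebesgue_measure R).
Variables (qh : E -> nat -> R * R -> R) (e : nat -> E) (B : R).
Hypothesis qh_ge0 : forall i k x, (0 <= qh i k x)%R.
Hypothesis mqh : forall i k, measurable_fun setT (qh i k).
Hypothesis qhB : forall i x, \sum_(k <oo) (qh i k x)%:E <= B%:E.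

Lemma le_uni_gen (F F' : E -> R * R * R -> \bar R) i v r w :
  (forall j x, 0 <= F j x) -> (forall j x, F j x <= F' j x) ->
  uni_gen qh e B F i v r w <= uni_gen qh e B F' i v r w.
Proof.
move=> F0 FF'; apply: leeD.
  apply: lee_nneseries => [k _ _|k _].
    by apply: mule_ge0 => //; rewrite lee_fin.
  by apply: lee_wpmul2l => //; rewrite lee_fin.
by apply: lee_wpmul2l => //; rewrite lee_fin; apply: stay_ge0.
Qed.

Lemma le_uni_jumps f f' m i x :
  (forall j u, 0 <= f j u) -> (forall j u, f j u <= f' j u) ->
  (forall j, measurable_fun setT (f j)) ->
  (forall j, measurable_fun setT (f' j)) ->
  uni_jumps qh e B f m i x <= uni_jumps qh e B f' m i x.
Proof.
move=> f0 ff' mf mf'; have f'0 j u : 0 <= f' j u by exact: le_trans (ff' j u).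
elim: m i x => [|m IH] i x //=; apply: ge0_le_integral => //.
- by move=> r _; apply: uni_gen_ge0 => // *; exact: uni_jumps_ge0.
- apply: measurable_funTS; apply: measurable_uni_gen => //.
  + by move=> *; exact: uni_jumps_ge0.
  + by move=> *; exact: measurable_uni_jumps.
  + by apply: measurable_funD => //; apply: measurable_funB.
- apply: measurable_funTS; apply: measurable_uni_gen => //.
  + by move=> *; exact: uni_jumps_ge0.
  + by move=> *; exact: measurable_uni_jumps.
  + by apply: measurable_funD => //; apply: measurable_funB.
- by move=> r _; apply: le_uni_gen => // *; exact: uni_jumps_ge0.
Qed.

Lemma uni_jumps0 m i x : uni_jumps qh e B (fun _ _ => 0) m i x = 0.
Proof.
elim: m i x => [//|m IH] i x /=; apply: integral0_eq => r _.
by rewrite /uni_gen IH mule0 adde0 eseries0// => k _ _; rewrite IH mule0.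
Qed.

Lemma uni_sum_le_expR f i v s u :
  (forall j w, 0 <= f j w) -> (forall j w, f j w <= 1) ->
  (forall j, measurable_fun setT (f j)) -> (s <= v)%R ->
  uni_sum qh e B f i (v, s, u) <= (expR (B * (v - s)))%:E.
Proof.
move=> f0 f1 mf sv.
rewrite -(@uni_sum_mass _ _ _ qh e B qh_ge0 qhB (fun _ _ => 1) setT i v s u)//.
by apply: lee_nneseries => [m _ _|m _]; [exact: uni_jumps_ge0|exact: le_uni_jumps].
Qed.

(** Restores the factor exp(-B(v-s)) omitted in [uni_jumps]; this is the value g of the uniformized
    chain. *)
Definition uni_val (f : E -> R -> \bar R) (i : E) (x : R * R * R) : \bar R :=
  (expR (B * (x.1.2 - x.1.1)))%:E * uni_sum qh e B f i x.

Lemma uni_val_ge0 f i x : (forall j w, 0 <= f j w) -> 0 <= uni_val f i x.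
Proof.
by move=> f0; apply: mule_ge0; [rewrite lee_fin expR_ge0|exact: uni_sum_ge0].
Qed.

Lemma uni_val_le1 f i v s u :
  (forall j w, 0 <= f j w) -> (forall j w, f j w <= 1) ->
  (forall j, measurable_fun setT (f j)) -> (s <= v)%R ->
  uni_val f i (v, s, u) <= 1.
Proof.
move=> f0 f1 mf sv; rewrite /uni_val/=.
apply: (@le_trans _ _ ((expR (B * (s - v)))%:E * (expR (B * (v - s)))%:E)).
  by apply: lee_wpmul2l; [rewrite lee_fin expR_ge0|exact: uni_sum_le_expR].
by rewrite -EFinM -expRD -mulrDr addrA subrK subrr mulr0 expR0.
Qed.

Lemma measurable_uni_val f i : (forall j w, 0 <= f j w) ->
  (forall j, measurable_fun setT (f j)) -> measurable_fun setT (uni_val f i).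
Proof.
move=> f0 mf; apply: emeasurable_funM; last exact: measurable_uni_sum.
apply/measurable_EFinP; apply: measurableT_comp => //.
by apply: measurable_funM => //; apply: measurable_funB; exact: measurableT_comp.
Qed.

Lemma uni_val_terminal f i v u : (forall j w, 0 <= f j w) ->
  (forall j, measurable_fun setT (f j)) -> uni_val f i (v, v, u) = f i u.
Proof.
move=> f0 mf; rewrite /uni_val/= subrr mulr0 expR0 mul1e uni_sumE// subrr addr0.
by rewrite set_itvoc0 integral_set0 adde0.
Qed.

(** Integrated backward equation, in which the clock rate [B] no longer appears. Weighting
    [uni_sum_flow] by the exponential adds B g = exit g + stay g on the left, while the fictitious
    ticks in [uni_gen] give stay g on the right; this common term is finite, because [stay] is at
    most [B] and g at most 1, and it cancels. *)
Lemma uni_val_flow f i v a b u :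
  (forall j w, 0 <= f j w) -> (forall j w, f j w <= 1) ->
  (forall j, measurable_fun setT (f j)) -> (a <= b)%R -> (b <= v)%R ->
  uni_val f i (v, a, u) +
    \int[mu]_(r in `]a, b]) ((exit qh i (r, u + (r - a))%R)%:E *
                            uni_val f i (v, r, u + (r - a))%R) =
  uni_val f i (v, b, u + (b - a))%R +
    \int[mu]_(r in `]a, b]) \sum_(k <oo) ((qh i k (r, u + (r - a))%R)%:E *
                            uni_val f (e k) (v, r, 0%R)).
Proof.
move=> f0 f1 mf ab bv.
pose kk r := uni_gen qh e B (uni_sum qh e B f) i v r (u + (r - a))%R.
pose g := uni_sum qh e B f i (v, b, u + (b - a))%R.
have kk0 r : 0 <= kk r by apply: uni_gen_ge0 => // *; exact: uni_sum_ge0.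
have mkk : measurable_fun setT kk by apply: measurable_uni_gen_sum.
have g0 : 0 <= g by exact: uni_sum_ge0.
have flow r : (a <= r)%R -> (r <= b)%R ->
    uni_sum qh e B f i (v, r, u + (r - a))%R = g + \int[mu]_(x in `]r, b]) kk x.
  move=> ar rb.
  have := @uni_sum_flow _ _ _ qh e B qh_ge0 mqh qhB f i v r b (u + (r - a))%R f0 mf rb bv.
  move=> ->.
  have -> : (u + (r - a) + (b - r) = u + (b - a))%R by ring.
  suff -> : \int[mu]_(x in `]r, b]) uni_gen qh e B (uni_sum qh e B f) i v x
      (u + (r - a) + (x - r))%R = \int[mu]_(x in `]r, b]) kk x by [].
  apply: eq_integral => x _; rewrite /kk.
  by have -> : (u + (r - a) + (x - r) = u + (x - a))%R by ring.
have B0 := B_ge0 qh_ge0 qhB i.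
have := expR_variation_of_constants B0 ab g0 mkk kk0.
have me : measurable_fun setT (fun r : R => (expR (B * r))%:E).
  apply/measurable_EFinP; apply: (measurableT_comp (@measurable_expR R)).
  exact: mulrl_measurable.
have mu1 : measurable_fun setT (fun r : R => uni_val f i (v, r, u + (r - a))%R).
  apply: (measurableT_comp (measurable_uni_val i f0 mf)).
  apply: measurable_fun_pair; first exact: measurable_fun_pair.
  by apply: measurable_funD => //; apply: measurable_funB.
have mu2 j : measurable_fun setT (fun r : R => uni_val f j (v, r, 0%R)).
  apply: (measurableT_comp (measurable_uni_val j f0 mf)).
  by apply: measurable_fun_pair => //; exact: measurable_fun_pair.
have ev0 r : (0 <= expR (B * r))%R by exact: expR_ge0.
have uvE r : (expR (B * (r - v)))%:E = (expR (B * - v))%:E * (expR (B * r))%:E.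
  by rewrite -EFinM -expRD -mulrDr addrC.
(* Multiplication by exp(-B v) turns exp(B r) into the weight exp(B (r - v)) of [uni_val]. *)
move/(congr1 (fun x => (expR (B * - v))%:E * x)).
have ik0 r : 0 <= \int[mu]_(x in `]r, b]) kk x by apply: integral_ge0.
rewrite ge0_muleDr; last 2 first.
- by apply: mule_ge0; [rewrite lee_fin|apply: adde_ge0].
- apply: integral_ge0 => r _; apply: mule_ge0; last exact: adde_ge0.
  by rewrite lee_fin mulr_ge0.
rewrite (@ge0_muleDr _ _ ((expR (B * b))%:E * g)); last 2 first.
- by rewrite mule_ge0 ?lee_fin.
- by apply: integral_ge0 => r _; rewrite mule_ge0 ?lee_fin.
rewrite !muleA -!uvE.
have -> : (expR (B * (b - v)))%:E * g = uni_val f i (v, b, (u + (b - a))%R) by [].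
have -> : (expR (B * (a - v)))%:E * (g + \int[mu]_(x in `]a, b]) kk x) =
    uni_val f i (v, a, u).
  by rewrite -flow// subrr addr0.
have s0 r : 0 <= (stay qh B i (r, u + (r - a))%R)%:E *
    uni_val f i (v, r, u + (r - a))%R.
  by rewrite mule_ge0 ?lee_fin ?stay_ge0// uni_val_ge0.
have ex0 r : 0 <= (exit qh i (r, u + (r - a))%R)%:E *
    uni_val f i (v, r, u + (r - a))%R.
  by rewrite mule_ge0 ?lee_fin ?exit_ge0// uni_val_ge0.
have q0 r : 0 <= \sum_(k <oo) ((qh i k (r, u + (r - a))%R)%:E *
                            uni_val f (e k) (v, r, 0%R)).
  by apply: nneseries_ge0 => k _ _; rewrite mule_ge0 ?lee_fin// uni_val_ge0.
have mpath : measurable_fun setT (fun r : R => (r, u + (r - a))%R).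
  apply: measurable_fun_pair => //.
  by apply: measurable_funD => //; apply: measurable_funB.
have ms : measurable_fun setT (fun r : R => (stay qh B i (r, u + (r - a))%R)%:E *
    uni_val f i (v, r, u + (r - a))%R).
  apply: emeasurable_funM => //; apply/measurable_EFinP.
  exact: measurableT_comp (measurable_stay _ _ _ _) mpath.
have mex : measurable_fun setT (fun r : R => (exit qh i (r, u + (r - a))%R)%:E *
    uni_val f i (v, r, u + (r - a))%R).
  apply: emeasurable_funM => //; apply/measurable_EFinP.
  exact: measurableT_comp (measurable_exit _ _ _) mpath.
have mq : measurable_fun setT (fun r : R => \sum_(k <oo) ((qh i k (r, u + (r - a))%R)%:E *
                            uni_val f (e k) (v, r, 0%R))).
  apply: ge0_emeasurable_sum => [k r _ _|k _].
    by rewrite mule_ge0 ?lee_fin// uni_val_ge0.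
  apply: emeasurable_funM => //; apply/measurable_EFinP.
  exact: measurableT_comp (mqh i k) mpath.
rewrite -ge0_integralZl//; last 2 first.
- apply: measurable_funTS; apply: emeasurable_funM; first exact: measurable_cexpR.
  apply: emeasurable_funD => //.
  apply: (@measurable_integral_itv R _ R id (cst b) (kk \o snd)) => //=.
  exact: measurableT_comp.
- move=> r _; apply: mule_ge0; last exact: adde_ge0.
  by rewrite lee_fin mulr_ge0.
rewrite -ge0_integralZl//; last 2 first.
- by apply: measurable_funTS; apply: emeasurable_funM => //; exact: me.
- by move=> r _; rewrite mule_ge0 ?lee_fin.
have -> : \int[mu]_(r in `]a, b])
    ((expR (B * - v))%:E * ((B * expR (B * r))%:E * (g + \int[mu]_(x in `]r, b]) kk x))) =
  \int[mu]_(r in `]a, b]) ((exit qh i (r, u + (r - a))%R)%:E *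
      uni_val f i (v, r, u + (r - a))%R) +
  \int[mu]_(r in `]a, b]) ((stay qh B i (r, u + (r - a))%R)%:E *
      uni_val f i (v, r, u + (r - a))%R).
  rewrite -ge0_integralD//; [|exact: measurable_funTS|exact: measurable_funTS].
  apply: eq_integral => r; rewrite inE/= in_itv/= => /andP[/ltW ar rb].
  rewrite -flow// -ge0_muleDl ?lee_fin ?stay_ge0 ?exit_ge0// -EFinD /stay subrKC.
  rewrite /uni_val; move: (uni_sum _ _ _ _ _ _) => G; rewrite (uvE r).
  by rewrite !muleA; congr (_ * _); rewrite -!EFinM; congr EFin; ring.
have -> : \int[mu]_(r in `]a, b]) ((expR (B * - v))%:E * ((expR (B * r))%:E * kk r)) =
  \int[mu]_(r in `]a, b]) \sum_(k <oo) ((qh i k (r, u + (r - a))%R)%:E *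
                            uni_val f (e k) (v, r, 0%R)) +
  \int[mu]_(r in `]a, b]) ((stay qh B i (r, u + (r - a))%R)%:E *
      uni_val f i (v, r, u + (r - a))%R).
  rewrite -ge0_integralD//; [|exact: measurable_funTS|exact: measurable_funTS].
  apply: eq_integral => r _; rewrite muleA -uvE /kk /uni_gen ge0_muleDr; last 2 first.
  - by apply: nneseries_ge0 => k _ _; rewrite mule_ge0 ?lee_fin// uni_sum_ge0.
  - by rewrite mule_ge0 ?lee_fin ?stay_ge0// uni_sum_ge0.
  congr (_ + _); last by rewrite /uni_val/= muleCA.
  rewrite -nneseriesZl; last by move=> k _; rewrite mule_ge0 ?lee_fin// uni_sum_ge0.
  by apply: eq_eseriesr => k _; rewrite muleCA.
set S := \int[mu]_(r in `]a, b]) ((stay qh B i (r, u + (r - a))%R)%:E *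
  uni_val f i (v, r, u + (r - a))%R).
have Sfin : S \is a fin_num.
  rewrite ge0_fin_numE; last by apply: integral_ge0.
  apply: (@le_lt_trans _ _ (\int[mu]_(r in `]a, b]) (cst B%:E r))); last first.
    by rewrite integral_cst//= lebesgue_measure_itv/=; case: ifP => _;
      rewrite -?EFinB -?EFinM ?mule0 ltry.
  apply: ge0_le_integral => //.
    exact: measurable_funTS.
  move=> r; rewrite /= in_itv/= => /andP[_ rb]; rewrite -[leRHS]mule1.
  apply: lee_pmul; first by rewrite lee_fin stay_ge0.
  - exact: uni_val_ge0.
  - by rewrite lee_fin /stay lerBlDr lerDl exit_ge0.
  by apply: uni_val_le1 => //; exact: le_trans bv.
suff aux (x y z w t : \bar R) : t \is a fin_num ->
    x + (y + t) = z + (w + t) -> x + y = z + w by exact: aux.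
by move=> tfin /(congr1 (fun x => x - t)); rewrite !addeA !addeK.
Qed.
Hypothesis E_countable : countable [set: E].
Hypothesis E_discrete : forall A : set E, measurable A.

(** The indicator of [C] written as a Dirac mass, so that additivity in [C] is inherited from
    measures. *)
Definition ind_val (C : set (E * R)) (j : E) (u : R) : \bar R := \d_(j, u) C.

Lemma ind_val_ge0 C j u : 0 <= ind_val C j u. Proof. exact: measure_ge0. Qed.

Lemma ind_val_le1 C j u : ind_val C j u <= 1.
Proof. by rewrite /ind_val diracE lee_fin lern1 leq_b1. Qed.

Lemma measurable_ind_val C j : measurable C -> measurable_fun setT (ind_val C j).
Proof.
move=> mC; rewrite /ind_val; under eq_fun do rewrite diracE.
apply/measurable_EFinP.
exact: (measurableT_comp (measurable_indic mC) (pair1_measurable j)).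
Qed.

(** [Num.max s t] makes this a probability for every pair of times, as a family of Markov kernels
    indexed by all s and t demands; for s <= t it is just [t]. *)
Definition uni_trans (s t : R) (x : E * R) (C : set (E * R)) : \bar R :=
  if `[< measurable C >] then uni_val (ind_val C) x.1 (Num.max s t, s, x.2) else 0.

Section Transition.
Variables s t : R.

Let trans0 x : uni_trans s t x set0 = 0.
Proof.
rewrite /uni_trans asboolT// /uni_val /uni_sum.
rewrite (_ : ind_val set0 = fun _ _ => 0); last first.
  by apply/funext => j; apply/funext => u; rewrite /ind_val measure0.
by rewrite eseries0 ?mule0// => m _ _; exact: uni_jumps0.
Qed.

Let trans_ge0 x C : 0 <= uni_trans s t x C.
Proof.
rewrite /uni_trans; case: ifP => // _; apply: uni_val_ge0 => j u.
exact: ind_val_ge0.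
Qed.

Let trans_sigma_additive x : semi_sigma_additive (uni_trans s t x).
Proof.
move=> F mF tF mUF; rewrite /uni_trans asboolT//.
rewrite (_ : uni_val _ _ _ = \sum_(l <oo) uni_trans s t x (F l)).
  by apply: is_cvg_nneseries => l _ _; exact: trans_ge0.
rewrite /uni_val (_ : ind_val (\bigcup_n F n) = fun j u => \sum_(l <oo) ind_val (F l) j u); last first.
  by apply/funext => j; apply/funext => u; rewrite /ind_val measure_semi_bigcup.
rewrite uni_sum_nneseries//; last by move=> *; exact: measurable_ind_val.
rewrite -nneseriesZl; last first.
  by move=> l _; apply: uni_sum_ge0 => // *; exact: ind_val_ge0.
by apply: eq_eseriesr => l _; rewrite /uni_trans asboolT.
Qed.

HB.instance Definition _ x := isMeasure.Build _ _ _ (uni_trans s t x)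
  (trans0 x) (trans_ge0 x) (@trans_sigma_additive x).

Definition uni_ker : E * R -> {measure set (E * R) -> \bar R} := uni_trans s t.

Let measurable_uni_ker C : measurable C -> measurable_fun setT (uni_ker ^~ C).
Proof.
move=> mC; rewrite /uni_ker/= /uni_trans asboolT//.
pose h (i : E) (x : E * R) := uni_val (ind_val C) i (Num.max s t, s, x.2).
apply: (@measurable_fun_countable_case _ _ _ (E * R)%type (\bar R) E fst h) => //.
move=> i; apply: (measurableT_comp (f := uni_val (ind_val C) i)).
  apply: measurable_uni_val; first by move=> *; exact: ind_val_ge0.
  by move=> *; exact: measurable_ind_val.
by apply: measurable_fun_pair => //; exact: measurable_fun_pair.
Qed.

HB.instance Definition _ := isKernel.Build _ _ _ _ R uni_ker measurable_uni_ker.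

Lemma uni_trans_mass x C (D : set R) : measurable C ->
  (forall j w, D w -> C (j, w)) -> D 0%R ->
  (forall w w', D w -> (w <= w')%R -> D w') -> D x.2 -> uni_trans s t x C = 1.
Proof.
move=> mC DC D0 Dle Dx; rewrite /uni_trans asboolT// /uni_val.
rewrite (@uni_sum_mass _ _ _ qh e B qh_ge0 qhB (ind_val C) D)//.
- by rewrite /= -EFinM -expRD -mulrDr addrA subrK subrr mulr0 expR0.
- by move=> j w Dw; rewrite /ind_val diracE mem_set//; exact: DC.
- by rewrite le_max lexx.
Qed.

Let uni_ker_prob x : uni_ker x setT = 1.
Proof. exact: (@uni_trans_mass _ _ setT). Qed.

HB.instance Definition _ := Kernel_isProbability.Build _ _ _ _ R uni_ker uni_ker_prob.

(** Existential form, from which a kernel can be chosen for each pair of times with rates that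
    depend on the pair. *)
Lemma uni_ker_exists : exists k : R.-pker (E * R)%type ~> (E * R)%type,
  forall x C, k x C = uni_trans s t x C.
Proof. by exists uni_ker. Qed.

End Transition.
End UniformizedSemigroup.

(** * Paths of a marked point process *)

Section Paths.
Context {R : realType} {d : measure_display} {W : measurableType d}.
Context {dE : measure_display} {E : measurableType dE}.
Variables (Y : nat -> W -> E) (S : nat -> W -> \bar R).
Hypothesis mpp : is_mpp Y S.
Local Notation T := (event_time S).
Local Notation Z := (mpp_process Y S).
Local Notation U := (duration Y S).

Lemma event_time0 w : T 0 w = 0.
Proof. by case: mpp => _ _ _ S0 _; rewrite /event_time big_ord1 S0. Qed.

Lemma event_timeS n w : T n.+1 w = T n w + S n.+1 w.
Proof. by rewrite /event_time big_ord_recr. Qed.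

Lemma event_time_ge0 n w : 0 <= T n w.
Proof.
case: mpp => _ _ _ S0 Spos; apply: sume_ge0 => -[[|k] /= _] _.
  by rewrite S0.
exact/ltW/Spos.
Qed.

Lemma event_time_leS n w : T n w <= T n.+1 w.
Proof.
case: mpp => _ _ _ S0 Spos; rewrite event_timeS leeDl//; exact/ltW/Spos.
Qed.

Lemma event_time_le m n w : (m <= n)%N -> T m w <= T n w.
Proof.
move=> mn; rewrite -(subnK mn) addnC; elim: (n - m)%N => [|k IH].
  by rewrite addn0.
by rewrite addnS; apply: le_trans IH (event_time_leS _ _).
Qed.

Lemma event_time_ltS n w : T n w < +oo -> T n w < T n.+1 w.
Proof.
case: mpp => _ _ _ S0 Spos Tfin; rewrite event_timeS lteDl//.
by rewrite ge0_fin_numE// event_time_ge0.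
Qed.

Lemma event_time_gt0 n w : 0 < T n.+1 w.
Proof.
apply: (@lt_le_trans _ _ (T 1 w)); last exact: event_time_le.
by rewrite -(event_time0 w); apply: event_time_ltS; rewrite event_time0 ltry.
Qed.

Lemma measurable_event_time n : measurable_fun setT (T n).
Proof. by case: mpp => _ mS _ _ _; apply: emeasurable_sum => k. Qed.

Lemma event_interval_inj m n (t : R) w :
  T m w <= t%:E < T m.+1 w -> T n w <= t%:E < T n.+1 w -> m = n.
Proof.
move=> /andP[m1 m2] /andP[n1 n2]; apply/eqP; rewrite eqn_leq.
apply/andP; split; rewrite leqNgt; apply/negP => mn.
  by move: (lt_le_trans n2 (le_trans (event_time_le w mn) m1)); rewrite ltxx.
by move: (lt_le_trans m2 (le_trans (event_time_le w mn) n1)); rewrite ltxx.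
Qed.

Lemma mpp_processE n t w : T n w <= t%:E < T n.+1 w -> Z t w = Y n w.
Proof.
move=> nt; apply: xget_unique; first by exists n.
by move=> y [m mt ->]; rewrite (event_interval_inj mt nt).
Qed.

Lemma event_interval_or t w : (0 <= t)%R ->
  (exists n, T n w <= t%:E < T n.+1 w) \/ (forall n, T n w <= t%:E).
Proof.
move=> t0; have [?|nex] := pselect (exists n, T n w <= t%:E < T n.+1 w).
  by left.
right; elim=> [|n IH]; first by rewrite event_time0 lee_fin.
by rewrite leNgt; apply/negP => tn; apply: nex; exists n; rewrite IH.
Qed.

Lemma mpp_process_beyond t w : (forall n, T n w <= t%:E) -> Z t w = Y 0%N w.
Proof.
move=> Tt; apply: xgetPN => y [n /andP[_]].
by rewrite ltNge Tt.
Qed.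

(** Explosion is no exception: beyond all event times the process rests at the default [Y 0]. *)
Lemma mpp_process_rcont t w : (0 <= t)%R ->
  exists2 e, (t < e)%R & forall s, (t <= s < e)%R -> Z s w = Z t w.
Proof.
move=> t0; have [[n nt]|nt] := event_interval_or w t0; last first.
  exists (t + 1)%R; first by rewrite ltrDl.
  move=> s /andP[ts _]; rewrite !mpp_process_beyond// => n.
  by apply: le_trans (nt n) _; rewrite lee_fin.
have [e te eT] : exists2 e, (t < e)%R & e%:E <= T n.+1 w.
  move: nt; case: (T n.+1 w) => [r| |] /andP[nt1 nt2]; last by [].
    by exists r => //; rewrite -lte_fin.
  by exists (t + 1)%R; [rewrite ltrDl|rewrite leey].
exists e => // s /andP[ts se]; rewrite (mpp_processE nt).
apply: mpp_processE; case/andP: nt => nt1 nt2; apply/andP; split.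
  by apply: le_trans nt1 _; rewrite lee_fin.
by apply: lt_le_trans eT; rewrite lte_fin.
Qed.

Lemma measurable_mpp_process t :
  (forall A : set E, measurable A) -> measurable_fun setT (Z t).
Proof.
case: mpp => mY _ _ _ _ E_discrete _ B _; rewrite setTI.
have mYB n : measurable (Y n @^-1` B) by rewrite -[X in measurable X]setTI; exact: mY.
pose D n := [set w | T n w <= t%:E < T n.+1 w].
have mD n : measurable (D n).
  rewrite (_ : D n = [set w | T n w <= t%:E] `&` [set w | t%:E < T n.+1 w]); last first.
    by apply/seteqP; split => w /= /andP.
  apply: measurableI.
    by rewrite -[X in measurable X]setTI; apply: emeasurable_fun_infty_c => //;
      exact: measurable_event_time.
  by rewrite -[X in measurable X]setTI; apply: emeasurable_fun_o_infty => //;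
      exact: measurable_event_time.
rewrite [X in measurable X](_ : _ = (\bigcup_n (D n `&` Y n @^-1` B)) `|`
   ((~` \bigcup_n D n) `&` Y 0%N @^-1` B)).
  apply: measurableU; first by apply: bigcupT_measurable => n; exact: measurableI.
  by apply: measurableI => //; apply: measurableC; exact: bigcupT_measurable.
have nD w : (~` \bigcup_n D n) w -> Z t w = Y 0%N w.
  by move=> nDw; apply: xgetPN => y [n nt _]; apply: nDw; exists n.
apply/seteqP; split => w /=.
  have [[n _ Dn]|nDw] := pselect ((\bigcup_n D n) w).
    by rewrite (mpp_processE Dn) => YB; left; exists n.
  by rewrite nD// => YB; right.
move=> [[n _ [/= Dn YB]]|[nDw YB]]; first by rewrite (mpp_processE Dn).
by rewrite nD.
Qed.

(** The last time strictly before [t] spent outside [i], or 0. Strictness makes it depend on the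
    strict past only, hence predictable. The condition [last_visit i t w < t] says that the process
    is in [i] on a nonempty interval ending at [t], that is, that its left limit at [t] is [i]. *)
Definition last_visit (i : E) (t : R) (w : W) : R :=
  sup [set s | (0 <= s < t)%R /\ Z s w <> i].

Lemma durationE t w : U t w = (t - last_visit (Z t w) t w)%R.
Proof.
congr (_ - sup _)%R; apply/seteqP; split => s /= [/andP[s0 st] Zs]; split => //.
  rewrite s0 lt_neqAle st andbT; apply/negP => /eqP se.
  by rewrite se in Zs.
by rewrite s0 ltW.
Qed.

Lemma last_visit_ge0 i t w : (0 <= last_visit i t w)%R.
Proof.
rewrite /last_visit; set A := (X in sup X).
have [->|/set0P[s As]] := eqVneq A set0; first by rewrite sup0.
have [/andP[s0 _] _] := As.
apply: le_trans s0 _; apply: ub_le_sup => //.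
by exists t => r [/andP[_ /ltW]].
Qed.

Lemma last_visit_le i t w : (0 <= t)%R -> (last_visit i t w <= t)%R.
Proof.
move=> t0; rewrite /last_visit; set A := (X in sup X).
have [->|/set0P As] := eqVneq A set0; first by rewrite sup0.
by apply: ge_sup => // r [/andP[_ /ltW]].
Qed.

Lemma duration_ge0 t w : (0 <= t)%R -> (0 <= U t w)%R.
Proof. by move=> t0; rewrite durationE subr_ge0 last_visit_le. Qed.

(** By right-continuity, a visit outside [i] lasts until some rational time. This brings the
    supremum down to countably many fixed times and is the source of the measurability of
    durations. *)
Lemma last_visit_gt i t w (c : R) : (0 <= c)%R ->
  (c < last_visit i t w)%R <->
  exists2 x : rat, (c < ratr x < t)%R & Z (ratr x) w <> i.
Proof.
move=> c0; split.
  rewrite /last_visit; set A := (X in sup X) => cs.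
  have As : A !=set0.
    by apply/set0P/eqP => A0; move: cs; rewrite A0 sup0 ltNge c0.
  have [s [/andP[s0 st] Zs] cs'] := sup_gt As cs.
  have [e se Ze] := mpp_process_rcont w s0.
  have [x] := @rat_in_itvoo R s (Num.min e t) ltac:(by rewrite lt_min se st).
  rewrite in_itv/= lt_min => /andP[sx /andP[xe xt]].
  exists x; first by rewrite (lt_trans cs' sx) xt.
  by rewrite Ze// (ltW sx).
move=> [x /andP[cx xt] Zx]; apply: (lt_le_trans cx); apply: ub_le_sup.
  by exists t => r [/andP[_ /ltW]].
by split => //; rewrite xt andbT; exact: le_trans c0 (ltW cx).
Qed.

(** Consecutive marks differ, so the process is outside [Y n] just before the n-th event. The right
    end [T n.+1] is included because only times before [t] count; there the lemma describes the left
    limit at an event. *)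
Lemma last_visit_eq n t w : T n w <= t%:E <= T n.+1 w ->
  last_visit (Y n w) t w = fine (T n w).
Proof.
case: mpp => _ _ YS _ _ /andP[nt tn].
have Tfin : T n w \is a fin_num.
  by rewrite ge0_fin_numE ?event_time_ge0//; apply: le_lt_trans nt (ltry _).
have T0 := event_time_ge0 n w.
apply/eqP; rewrite eq_le; apply/andP; split.
  rewrite leNgt; apply/negP => /last_visit_gt[|x /andP[Tx xt]].
    exact: fine_ge0.
  apply; apply: mpp_processE; apply/andP; split.
    by rewrite -(fineK Tfin) lee_fin ltW.
  by apply: lt_le_trans tn; rewrite lte_fin.
case: n nt tn Tfin T0 => [|n] nt tn Tfin T0.
  by rewrite event_time0 last_visit_ge0.
rewrite leNgt; apply/negP => lt.
pose c := Num.max (last_visit (Y n.+1 w) t w) (fine (T n w)).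
have Tnfin : T n w \is a fin_num.
  rewrite ge0_fin_numE ?event_time_ge0//; apply: le_lt_trans (event_time_leS _ _) _.
  by apply: le_lt_trans nt (ltry _).
have cT : (c < fine (T n.+1 w))%R.
  rewrite gt_max lt /=; apply: fine_lt => //; apply: event_time_ltS.
  by rewrite -ge0_fin_numE// event_time_ge0.
have [x] := rat_in_itvoo cT.
rewrite in_itv/= gt_max => /andP[/andP[xl xT] xT'].
suff : (ratr x <= last_visit (Y n.+1 w) t w)%R by rewrite leNgt xl.
have xt : (ratr x < t)%R.
  by apply: lt_le_trans xT' _; rewrite -lee_fin fineK.
apply: ub_le_sup; first by exists t => r [/andP[_ /ltW]].
split; first by rewrite xt andbT; apply: (le_trans _ (ltW xT)); rewrite fine_ge0 ?event_time_ge0.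
rewrite (@mpp_processE n); first by move=> /esym; exact: YS.
apply/andP; split; first by rewrite -(fineK Tnfin) lee_fin ltW.
by rewrite -(fineK Tfin) lte_fin.
Qed.

End Paths.

(** * Predictable and stopped sigma-algebras *)

Section Filtrations.
Context {R : realType} {d : measure_display} {W : measurableType d}.
Variable F : R -> set (set W).
Hypothesis F_sigma : forall t, sigma_algebra setT (F t).
Hypothesis F_mono : forall s t, (0 <= s)%R -> (s <= t)%R -> F s `<=` F t.
Hypothesis F_measurable : forall t, F t `<=` measurable.

Let FT t : F t setT.
Proof. by case: (F_sigma t) => F0 FC _; rewrite -(setD0 setT); exact: FC. Qed.

Lemma filtrationC t A : F t A -> F t (~` A).
Proof. by case: (F_sigma t) => _ FC _ FA; rewrite -setTD; exact: FC. Qed.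

Lemma filtration_bigcup t (A : nat -> set W) :
  (forall n, F t (A n)) -> F t (\bigcup_n A n).
Proof. by case: (F_sigma t) => _ _; exact. Qed.

Lemma filtration_bigcup_rat t (A : rat -> set W) :
  (forall n, F t (A n)) -> F t (\bigcup_n A n).
Proof.
move=> FA; have E := measurable_g_measurableTypeE (F_sigma t).
rewrite -E; apply: (@bigcupT_measurable_rat _ (g_sigma_algebraType (F t))) => q.
by rewrite E.
Qed.

Lemma filtration_bigcap_rat t (A : rat -> set W) :
  (forall n, F t (A n)) -> F t (\bigcap_n A n).
Proof.
move=> FA; rewrite -[X in F t X]setCK setC_bigcap; apply: filtrationC.
by apply: filtration_bigcup_rat => q; exact: filtrationC.
Qed.

Lemma filtrationI t A B : F t A -> F t B -> F t (A `&` B).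
Proof.
move=> FA FB; have E := measurable_g_measurableTypeE (F_sigma t).
rewrite -E; apply: (@measurableI _ (g_sigma_algebraType (F t))); by rewrite E.
Qed.

Lemma filtrationU t A B : F t A -> F t B -> F t (A `|` B).
Proof.
move=> FA FB; have E := measurable_g_measurableTypeE (F_sigma t).
rewrite -E; apply: (@measurableU _ (g_sigma_algebraType (F t))); by rewrite E.
Qed.

(** Rays are closed under intersection, so measures on the predictable space need to be compared
    only on them, with [setT] as cover. No ray reaches a time <= 0, so such times are not separated;
    this is why the time coordinate is always cut off at 0 below. *)
Definition predictable_rays : set (set (R * W)) :=
  [set D | D = setT \/ exists s A, [/\ (0 <= s)%R, F s A & D = `]s, +oo[ `*` A]].

Definition predictable_space := g_sigma_algebraType predictable_rays.
HB.instance Definition _ := Measurable.on predictable_space.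

Lemma predictable_rays_setI : setI_closed predictable_rays.
Proof.
move=> A B [->|[s [A' [s0 FA ->]]]]; first by rewrite setTI.
move=> [->|[s' [B' [s'0 FB ->]]]]; first by rewrite setIT; right; exists s, A'.
right; exists (Num.max s s'), (A' `&` B'); split.
- by rewrite le_max s0.
- by apply: filtrationI; [apply: F_mono FA; rewrite ?le_max ?lexx//
    |apply: F_mono FB; rewrite ?le_max ?lexx ?orbT].
- apply/seteqP; split => [[r w]|[r w]] /=; rewrite !in_itv/= !andbT gt_max.
    by move=> [[-> Aw] [-> Bw]].
  by move=> [/andP[-> ->] []].
Qed.

Lemma measurable_to_predictable d' (V : measurableType d') (f : V -> predictable_space) :
  (forall s A, (0 <= s)%R -> F s A ->
    measurable (f @^-1` (`]s, +oo[ `*` A))) ->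
  measurable_fun setT f.
Proof.
move=> fm; apply: (@measurability _ _ _ predictable_space setT f predictable_rays) => //.
move=> _ [D [->|[s [A [s0 FA ->]]]] <-]; first by rewrite setTI preimage_setT.
by rewrite setTI; exact: fm.
Qed.

Lemma measurable_predictable_ray s A : (0 <= s)%R -> F s A ->
  @measurable _ predictable_space (`]s, +oo[ `*` A).
Proof. by move=> s0 FA; apply: sub_sigma_algebra; right; exists s, A. Qed.

Lemma measurable_prod_to_predictable :
  measurable_fun setT (idfun : R * W -> predictable_space).
Proof.
apply: measurable_to_predictable => s A s0 FA; apply: measurableX => //.
exact: F_measurable FA.
Qed.

Lemma measurable_predictable_time :
  measurable_fun setT (fun x : predictable_space => Num.max 0%R x.1).
Proof.
apply: (measurability (@RGenOInfty.G R)); first exact: RGenOInfty.measurableE.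
move=> _ [_ [c ->] <-].
rewrite setTI; have [c0|c0] := leP 0%R c.
  rewrite (_ : _ @^-1` _ = `]c, +oo[ `*` setT); first exact: measurable_predictable_ray.
  apply/seteqP; split => [[r w]|[r w]] /=; rewrite !in_itv/= !andbT lt_max ltNge c0/=; first by [].
  by case.
rewrite (_ : _ @^-1` _ = setT)//; apply/seteqP; split => // -[r w] _ /=.
by rewrite in_itv/= andbT lt_max c0.
Qed.

Variable tau : W -> \bar R.
Hypothesis tau_stop : stopping_time F tau.

Lemma stopping_le t : (0 <= t)%R -> F t [set w | tau w <= t%:E].
Proof. by case: tau_stop => _; exact. Qed.

Lemma stopping_gt s t : (0 <= s)%R -> (s <= t)%R -> F t [set w | s%:E < tau w].
Proof.
move=> s0 st; apply: (F_mono s0 st).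
rewrite (_ : mkset _ = ~` [set w | tau w <= s%:E]).
  by apply: filtrationC; exact: stopping_le.
by apply/seteqP; split => w /=; rewrite ltNge => /negP.
Qed.

Lemma stopping_lt s t : (s <= t)%R -> F t [set w | tau w < s%:E].
Proof.
move=> st.
rewrite (_ : mkset _ = \bigcup_(q : rat)
   (if (0 <= (ratr q : R))%R && (ratr q < s)%R then [set w | tau w <= (ratr q)%:E] else set0)).
  apply: filtration_bigcup_rat => q; case: ifPn => [/andP[q0 qs]|_].
    apply: (F_mono q0); last exact: stopping_le.
    exact: le_trans (ltW qs) st.
  by case: (F_sigma t).
apply/seteqP; split => [w /= ws|w [q _]]; last first.
  case: ifPn => // /andP[q0 qs] /= tq; apply: le_lt_trans tq _.
  by rewrite lte_fin.
have t0 : 0 <= tau w by case: tau_stop.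
move: ws t0; case E : (tau w) => [r| |] //; rewrite lte_fin lee_fin => rs r0.
have [q] := rat_in_itvoo rs; rewrite in_itv/= => /andP[rq qs].
exists q => //; rewrite qs andbT (le_trans r0 (ltW rq))/=.
by rewrite E lee_fin ltW.
Qed.

Lemma stopping_measurable : measurable_fun setT tau.
Proof.
apply: (measurability (@ErealGenOInfty.G R)); first exact: ErealGenOInfty.measurableE.
move=> _ [_ [c ->] <-].
rewrite setTI; have [c0|c0] := leP 0%R c.
  rewrite (_ : _ @^-1` _ = [set w | c%:E < tau w]).
    by apply: F_measurable; exact: stopping_gt.
  by apply/seteqP; split => w /=; rewrite in_itv/= andbT.
rewrite (_ : _ @^-1` _ = setT)//; apply/seteqP; split => // w _ /=.
rewrite in_itv/= andbT; apply: lt_le_trans (tau_stop.1 w).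
by rewrite lte_fin.
Qed.

Local Notation Ftau := (stopped_sigma_algebra F tau).

Lemma stopped_sigma_algebraP : sigma_algebra setT Ftau.
Proof.
split.
- split; first exact: measurable0.
  by move=> t t0; rewrite set0I; case: (F_sigma t).
- move=> A [mA FA]; split; first by apply: measurableD.
  move=> t t0; rewrite setTD.
  rewrite (_ : _ `&` _ = ~` (A `&` [set w | tau w <= t%:E]) `&` [set w | tau w <= t%:E]).
    apply: filtrationI; last exact: stopping_le.
    by apply: filtrationC; exact: FA.
  by rewrite setCI setIUl setICl setU0.
- move=> A FA; split; first by apply: bigcupT_measurable => n; case: (FA n).
  move=> t t0; rewrite setI_bigcupl; apply: filtration_bigcup => n.
  by case: (FA n) => _; exact.
Qed.

Definition stopped_space := g_sigma_algebraType Ftau.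
HB.instance Definition _ := Measurable.on stopped_space.

Lemma measurable_stoppedE (A : set W) :
  @measurable _ stopped_space A = Ftau A.
Proof.
exact: (congr1 (fun M : set (set W) => M A)
  (measurable_g_measurableTypeE stopped_sigma_algebraP)).
Qed.

Lemma measurable_stopped_tau : measurable_fun setT (tau : stopped_space -> \bar R).
Proof.
apply: (measurability (@ErealGenOInfty.G R)); first exact: ErealGenOInfty.measurableE.
move=> _ [_ [c ->] <-].
rewrite setTI measurable_stoppedE; split.
  by rewrite -[X in measurable X]setTI; apply: stopping_measurable => //;
     exact: emeasurable_itv.
move=> t t0; have [c0|c0] := leP 0%R c; last first.
  rewrite (_ : _ @^-1` _ = setT) ?setTI; first exact: stopping_le.
  apply/seteqP; split => // w _ /=.
  rewrite in_itv/= andbT; apply: lt_le_trans (tau_stop.1 w).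
  by rewrite lte_fin.
have [ct|tc] := leP c t.
  apply: filtrationI; last exact: stopping_le.
  rewrite (_ : _ @^-1` _ = [set w | c%:E < tau w]); first exact: stopping_gt.
  by apply/seteqP; split => w /=; rewrite in_itv/= andbT.
rewrite (_ : _ `&` _ = set0); first by case: (F_sigma t).
apply/seteqP; split => // w [] /=; rewrite in_itv/= andbT => /lt_le_trans /[apply].
by rewrite lte_fin ltNge (ltW tc).
Qed.

(** Composition with this map shows that a predictable process evaluated at [tau] is measurable for
    the stopped sigma-algebra. Where [tau] is infinite, [fine] returns 0, and no ray contains a
    point at time 0. *)
Lemma measurable_stopped_pair :
  measurable_fun setT ((fun w => (fine (tau w), w)) : stopped_space -> predictable_space).
Proof.
apply: measurable_to_predictable => s A s0 FA.
rewrite (_ : _ @^-1` _ = A `&` [set w | s%:E < tau w < +oo]); last first.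
  have tau0 := tau_stop.1.
  apply/seteqP; split => w /=; rewrite in_itv/= andbT; have := tau0 w;
    case: (tau w) => [r| |] //=; rewrite ?lte_fin ?ltry ?andbT; first by move=> _ [].
  - by rewrite ltNge s0 => _ [].
  - by move=> _ [].
  - by move=> _ [_]; rewrite ltxx andbF.
rewrite measurable_stoppedE; split.
  apply: measurableI; first exact: F_measurable FA.
  rewrite (_ : mkset _ = [set w | s%:E < tau w] `&` [set w | tau w < +oo]); last first.
    by apply/seteqP; split => w /= /andP.
  apply: measurableI.
    by apply: F_measurable; exact: (stopping_gt s0 (lexx s)).
  rewrite -[X in measurable X]setTI.
  by apply: emeasurable_fun_infty_o => //; exact: stopping_measurable.
move=> t t0; have [st|ts] := leP s t; last first.
  rewrite (_ : _ `&` _ = set0); first by case: (F_sigma t).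
  apply/seteqP; split => // w [[_ /andP[+ _]] /=] => /lt_le_trans /[apply].
  by rewrite lte_fin ltNge (ltW ts).
have -> : A `&` [set w | s%:E < tau w < +oo] `&` [set w | tau w <= t%:E] =
    A `&` [set w | s%:E < tau w] `&` [set w | tau w <= t%:E]; last first.
  apply: filtrationI; last exact: stopping_le.
  by apply: filtrationI; [exact: (F_mono s0 st FA)|exact: stopping_gt].
apply/seteqP; split => w /= [[Aw]].
  by move=> /andP[-> _].
by move=> -> tw; rewrite (le_lt_trans tw (ltry _)).
Qed.

(** Once [tau] has passed, both its value and the occurrence of [A] are known, so this function is
    predictable. A rational q with tau <= q < r turns the condition into rays. The value -1 lies
    below all values of [tau] and marks the complement. *)
Lemma measurable_predictable_after A : Ftau A ->
  measurable_fun setT (fun x : predictable_space =>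
    if (x.2 \in A) && (tau x.2 < x.1%:E) then fine (tau x.2) else (-1)%R).
Proof.
move=> [mA FA]; apply: (measurability (@RGenCInfty.G R)); first exact: RGenCInfty.measurableE.
move=> _ [_ [c ->] <-]; rewrite setTI.
have [c1|c1] := leP c (-1)%R.
  rewrite (_ : _ @^-1` _ = setT)//; apply/seteqP; split => // -[r w] _ /=.
  rewrite in_itv/= andbT; case: ifP => // _; apply: (le_trans c1).
  by apply: (@le_trans _ _ 0%R); [lra|apply: fine_ge0; exact: (tau_stop.1 w)].
rewrite (_ : _ @^-1` _ = \bigcup_(q : rat)
   (if (0 <= (ratr q : R))%R && (c <= ratr q)%R then
      `]ratr q, +oo[ `*` ((A `&` [set w | tau w <= (ratr q)%:E]) `&`
        ~` [set w | tau w < c%:E])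
    else set0)).
  apply: bigcupT_measurable_rat => q; case: ifPn => [/andP[q0 cq]|_]; last exact: measurable0.
  apply: measurable_predictable_ray => //; apply: filtrationI; first exact: FA.
  by apply: filtrationC; exact: stopping_lt.
apply/seteqP; split => [[r w] /=|[r w] [q _]].
  case: ifPn => [/andP[/set_mem Aw tr]|_]; rewrite in_itv/= andbT; last first.
    by rewrite leNgt c1.
  have t0 := tau_stop.1 w; move: tr t0.
  case E : (tau w) => [t| |] //=; rewrite lte_fin lee_fin => tr t0 ct.
  have [q] := rat_in_itvoo tr; rewrite in_itv/= => /andP[tq qr]; exists q => //=.
  rewrite (le_trans t0 (ltW tq)) (le_trans ct (ltW tq))/= in_itv/= qr; split => //.
  by rewrite E; split; [split => //; rewrite lee_fin ltW|rewrite lte_fin ltNge ct].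
case: ifPn => // /andP[q0 cq] [/=]; rewrite !in_itv/= !andbT => qr [[Aw tq]] /negP.
rewrite -leNgt => ct; have t0 := tau_stop.1 w.
have tr : tau w < r%:E by apply: le_lt_trans tq _; rewrite lte_fin.
rewrite mem_set// tr /=; move: ct tr t0; case: (tau w) => [t| |] //=.
Qed.

End Filtrations.

(** * Measurability of state and duration for the natural filtration *)

Section NaturalFiltration.
Context {R : realType} {d : measure_display} {W : measurableType d}.
Context {dE : measure_display} {E : measurableType dE}.
Variables (Y : nat -> W -> E) (S : nat -> W -> \bar R).
Hypothesis mpp : is_mpp Y S.
Hypothesis E_countable : countable [set: E].
Hypothesis E_discrete : forall A : set E, measurable A.
Local Notation T := (event_time S).
Local Notation Z := (mpp_process Y S).
Local Notation U := (duration Y S).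
Local Notation F := (natural_filtration Z).

Lemma natural_filtration_sigma t : sigma_algebra setT (F t).
Proof. exact: smallest_sigma_algebra. Qed.

Lemma natural_filtration_mono s t : (0 <= s)%R -> (s <= t)%R -> F s `<=` F t.
Proof.
move=> s0 st; apply: sub_sigma_algebra2 => A [r [B [/andP[r0 rs] mB ->]]].
by exists r, B; split => //; rewrite r0 (le_trans rs st).
Qed.

Lemma natural_filtration_measurable t : F t `<=` measurable.
Proof.
apply: smallest_sub; first exact: sigma_algebra_measurable.
move=> A [r [B [_ mB ->]]]; rewrite -[X in measurable X]setTI.
exact: measurable_mpp_process.
Qed.

Lemma natural_filtration_preimage s t B : (0 <= s)%R -> (s <= t)%R ->
  F t (Z s @^-1` B).
Proof.
move=> s0 st; apply: sub_sigma_algebra; exists s, B; split => //.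
by rewrite s0 st.
Qed.

Local Notation Fsigma := natural_filtration_sigma.
Local Notation Fmono := natural_filtration_mono.
Local Notation Fmeas := natural_filtration_measurable.

(** By [last_visit_gt], the set where the value exceeds c >= 0 is a union of rays over the rationals
    above c. *)
Lemma measurable_last_visit i :
  measurable_fun setT (fun x : predictable_space F => last_visit Y S i x.1 x.2).
Proof.
apply: (measurability (@RGenOInfty.G R)); first exact: RGenOInfty.measurableE.
move=> _ [_ [c ->] <-]; rewrite setTI; have [c0|c0] := leP 0%R c; last first.
  rewrite (_ : _ @^-1` _ = setT)//; apply/seteqP; split => // -[r w] _ /=.
  by rewrite in_itv/= andbT; apply: lt_le_trans c0 _; exact: last_visit_ge0.
rewrite (_ : _ @^-1` _ = \bigcup_(q : rat)
   (if (c < ratr q)%R then `]ratr q, +oo[ `*` (Z (ratr q) @^-1` [set~ i])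
    else set0)).
  apply: bigcupT_measurable_rat => q; case: ifPn => [cq|_]; last exact: measurable0.
  have q0 : (0 <= (ratr q : R))%R by exact: le_trans c0 (ltW cq).
  by apply: measurable_predictable_ray => //; exact: natural_filtration_preimage.
apply/seteqP; split => [[r w] /=|[r w] [q _]].
  rewrite in_itv/= andbT => /(last_visit_gt mpp _ _ _ c0)[q /andP[cq qr] Zq].
  by exists q => //=; rewrite cq; split => //=; rewrite in_itv/= qr.
case: ifPn => // cq [/=]; rewrite !in_itv/= !andbT => qr Zq.
by apply/(last_visit_gt mpp _ _ _ c0); exists q => //; rewrite cq.
Qed.

Section AtStoppingTime.
Variable tau : W -> \bar R.
Hypothesis tau_stop : stopping_time F tau.
Local Notation stopped := (stopped_space F tau).

(** Where tau = u, the state is read off at [u]. Where tau < u, right-continuity puts it in [B]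
    exactly if, for some rational q in ]tau, u], the process is in [B] at all rational times of
    ]tau, q[ ; for a time x at or before tau nothing is required, except that at x = tau both
    formulations agree. *)
Lemma stopped_state_filtration B u : (0 <= u)%R ->
  F u ([set w | B (Z (fine (tau w)) w)] `&` [set w | tau w <= u%:E]).
Proof.
move=> u0.
have -> : [set w | B (Z (fine (tau w)) w)] `&` [set w | tau w <= u%:E] =
  (([set w | tau w <= u%:E] `&` ~` [set w | tau w < u%:E]) `&` Z u @^-1` B) `|`
  \bigcup_(q : rat) (if ((ratr q : R) <= u)%R then
     [set w | tau w < (ratr q)%:E] `&`
     \bigcap_(x : rat) (if (0 <= (ratr x : R))%R && (ratr x < (ratr q : R))%R then
        ~` [set w | tau w < (ratr x)%:E] `|` Z (ratr x) @^-1` B else setT) else set0).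
  apply/seteqP; split => w /=.
    move=> [Bw tu]; have t0 := tau_stop.1 w; move: Bw tu t0.
    case tE : (tau w) => [r| |] //= Bw; rewrite !lee_fin => ru r0.
    move: ru; rewrite le_eqVlt => /predU1P[ruE|ru].
      by left; rewrite -ruE eqxx; split => //; split => //; rewrite ltxx.
    right; have [e re Ze] := mpp_process_rcont mpp w r0.
    have [q] := @rat_in_itvoo R r (Num.min e u) ltac:(by rewrite lt_min re ru).
    rewrite in_itv/= lt_min => /andP[rq /andP[qe qu]].
    exists q => //; rewrite (ltW qu); split; first by rewrite /= tE lte_fin.
    move=> x _; case: ifPn => // /andP[x0 xq].
    have [rx|xr] := ltP r (ratr x); last first.
      by left; rewrite /= tE lte_fin; apply/negP; rewrite -leNgt.
    by right; rewrite /= Ze// (ltW rx) (lt_trans xq qe).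
  move=> [[[tu /negP ntu] Bw]|[q _]].
    have tE : tau w = u%:E by apply/eqP; rewrite eq_le tu leNgt ntu.
    by rewrite tE.
  case: ifPn => // qu [/= tq Zx]; have t0 := tau_stop.1 w.
  move: tq t0; case tE : (tau w) => [r| |] //=; rewrite lte_fin !lee_fin => rq r0.
  split; last by exact: le_trans (ltW rq) qu.
  have [e re Ze] := mpp_process_rcont mpp w r0.
  have [x] := @rat_in_itvoo R r (Num.min e (ratr q)) ltac:(by rewrite lt_min re rq).
  rewrite in_itv/= lt_min => /andP[rx /andP[xe xq]].
  have := Zx x I; rewrite xq (le_trans r0 (ltW rx))/= => -[|].
    by rewrite tE lte_fin rx.
  by rewrite Ze// (ltW rx).
apply: (filtrationU Fsigma).
  apply: (filtrationI Fsigma); last exact: natural_filtration_preimage.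
  apply: (filtrationI Fsigma); first exact: stopping_le.
  by apply: (filtrationC Fsigma); exact: (stopping_lt Fsigma Fmono).
apply: (filtration_bigcup_rat Fsigma) => q; case: ifPn => [qu|_]; last first.
  by case: (Fsigma u).
apply: (filtrationI Fsigma); first exact: (stopping_lt Fsigma Fmono).
apply: (filtration_bigcap_rat Fsigma) => x; case: ifPn => [/andP[x0 xq]|_]; last first.
  by case: (Fsigma u) => F0 FC _; rewrite -(setD0 setT); exact: FC.
have xu : ((ratr x : R) <= u)%R by exact: le_trans (ltW xq) qu.
apply: (filtrationU Fsigma); last exact: natural_filtration_preimage.
by apply: (filtrationC Fsigma); exact: (stopping_lt Fsigma Fmono).
Qed.

Lemma measurable_stopped_state :
  measurable_fun setT ((fun w => Z (fine (tau w)) w) : stopped -> E).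
Proof.
move=> _ B _; rewrite setTI (measurable_stoppedE Fsigma tau_stop).
split; last by move=> u u0; exact: stopped_state_filtration.
(* Where [tau] is infinite, [fine] returns 0 and the state is the one at time 0. *)
rewrite (_ : _ @^-1` B =
  (\bigcup_(n : nat) ([set w | B (Z (fine (tau w)) w)] `&` [set w | tau w <= n%:R%:E])) `|`
  ([set w | tau w = +oo] `&` Z 0%R @^-1` B)).
  apply: measurableU.
    apply: bigcupT_measurable => n; apply: (@Fmeas n%:R).
    exact: stopped_state_filtration.
  apply: measurableI.
    have := stopping_measurable Fsigma Fmono Fmeas tau_stop measurableT (emeasurable_set1 +oo).
    by rewrite setTI.
  exact: (Fmeas (natural_filtration_preimage B (lexx 0%R) (lexx 0%R))).
apply/seteqP; split => w /=.
  have t0 := tau_stop.1 w; move: t0; case tE : (tau w) => [r| |] //= r0 Bw; last by right.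
  left; have [n rn] : exists n : nat, (r <= n%:R)%R.
    by exists (Num.bound r); apply: ltW; apply: archi_boundP.
  by exists n => //=; rewrite tE lee_fin.
by move=> [[n _ []//]|[-> ]].
Qed.

(** The duration is the time minus [last_visit] of the current state. With the state frozen,
    [last_visit] is predictable and can be evaluated at [tau]. *)
Lemma measurable_stopped_duration :
  measurable_fun setT ((fun w => U (fine (tau w)) w) : stopped -> R).
Proof.
under eq_fun do rewrite durationE.
have mtau := measurable_stopped_tau Fsigma Fmono Fmeas tau_stop.
apply: measurable_funB; first exact: measurableT_comp.
apply: (@measurable_fun_countable_case _ _ _ stopped R E
  (fun w => Z (fine (tau w)) w) (fun i w => last_visit Y S i (fine (tau w)) w)) => //.
  exact: measurable_stopped_state.
move=> i; have := measurable_stopped_pair Fsigma Fmono Fmeas tau_stop.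
exact: (measurableT_comp (measurable_last_visit i)).
Qed.

Lemma stopping_time_shift (t : R) : (0 <= t)%R ->
  stopping_time F (fun w => tau w + t%:E).
Proof.
move=> t0; split=> [w|u u0].
  by apply: adde_ge0; [exact: tau_stop.1|rewrite lee_fin].
have [tu|ut] := leP t u.
  apply: (Fmono (s := (u - t)%R)); first by rewrite subr_ge0.
    by rewrite lerBlDr lerDl.
  rewrite (_ : mkset _ = [set w | tau w <= (u - t)%:E]).
    by apply: stopping_le => //; rewrite subr_ge0.
  by apply/seteqP; split => w /=; rewrite EFinB leeBrDr.
rewrite (_ : mkset _ = set0); first by case: (Fsigma u).
apply/seteqP; split => // w /=; apply/negP; rewrite -ltNge.
apply: (@lt_le_trans _ _ t%:E); first by rewrite lte_fin.
by rewrite leeDr//; exact: tau_stop.1.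
Qed.

End AtStoppingTime.

Lemma stopping_time_cst t : (0 <= t)%R -> stopping_time F (fun _ => t%:E).
Proof.
move=> t0; split => [w|u u0]; first by rewrite lee_fin.
have [tu|ut] := leP t%:E u%:E.
  rewrite (_ : mkset _ = setT); last by apply/seteqP; split.
  by case: (Fsigma u) => F0 FC _; rewrite -(setD0 setT); exact: FC.
rewrite (_ : mkset _ = set0); first by case: (Fsigma u).
by apply/seteqP; split => // w /=; rewrite leNgt ut.
Qed.

Lemma stopped_sigma_algebra_cst t : (0 <= t)%R ->
  stopped_sigma_algebra F (fun _ => t%:E) `<=` F t.
Proof.
move=> t0 A [_ /(_ t t0)]; rewrite (_ : mkset _ = setT) ?setIT//.
by apply/seteqP; split => // w _ /=.
Qed.

Lemma measurable_stopped_pair_state tau : stopping_time F tau ->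
  measurable_fun setT ((fun w => (Z (fine (tau w)) w, U (fine (tau w)) w))
     : stopped_space F tau -> (E * R)%type).
Proof.
move=> tau_stop; apply: measurable_fun_pair.
  exact: measurable_stopped_state.
exact: measurable_stopped_duration.
Qed.

(** A fixed time is a constant stopping time, so this is a case of measurability at a stopping
    time. *)
Lemma state_adapted : adapted F (fun t w => (Z t w, U t w)).
Proof.
move=> t t0 B mB; apply: (stopped_sigma_algebra_cst t0).
have := measurable_stopped_pair_state (stopping_time_cst t0) measurableT mB.
by rewrite setTI (measurable_stoppedE Fsigma (stopping_time_cst t0)).
Qed.

End NaturalFiltration.

(** * Induction on nonnegative functions and weighted images of measures *)

Section Induction.
Import finmap.finmap HBNNSimple.
Context {d : measure_display} {T : measurableType d} {R : realType}.

Lemma ge0_measurable_ind (Pr : (T -> \bar R) -> Prop) :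
  (forall A, measurable A -> Pr (fun x => (\1_A x)%:E)) ->
  (forall c f, (0 <= c)%R -> (forall x, 0 <= f x) -> measurable_fun setT f ->
     Pr f -> Pr (fun x => c%:E * f x)) ->
  (forall f g, (forall x, 0 <= f x) -> measurable_fun setT f ->
     (forall x, 0 <= g x) -> measurable_fun setT g ->
     Pr f -> Pr g -> Pr (fun x => f x + g x)) ->
  (forall f : nat -> T -> \bar R, (forall n x, 0 <= f n x) ->
     (forall n, measurable_fun setT (f n)) ->
     (forall x, {homo f ^~ x : n m / (n <= m)%N >-> n <= m}) ->
     (forall n, Pr (f n)) -> Pr (fun x => limn (f ^~ x))) ->
  forall f, (forall x, 0 <= f x) -> measurable_fun setT f -> Pr f.
Proof.
move=> Pind Pscale Padd Plim f f0 mf.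
pose f_ := nnsfun_approx measurableT mf.
rewrite (_ : f = fun x => limn (fun n => (f_ n x)%:E)); last first.
  apply/funext => x; apply/esym/cvg_lim => //.
  exact: cvg_nnsfun_approx.
apply: Plim.
- by move=> n x; rewrite lee_fin.
- by move=> n; exact/measurable_EFinP.
- by move=> x m n mn; rewrite lee_fin; exact/lefP/nd_nnsfun_approx.
move=> n; move: (f_ n) => h {f f0 mf f_ n}.
rewrite (_ : (fun x => (h x)%:E) = fun x =>
   \sum_(y <- fset_set (range h)) (y%:E * (\1_(h @^-1` [set y]) x)%:E)); last first.
  apply/funext => x; rewrite {1}(fimfunE h) -fsumEFin// fsbig_finite//.
suff H (s : seq R) : (forall y, y \in s -> (0 <= y)%R) ->
  Pr (fun x => \sum_(y <- s) (y%:E * (\1_(h @^-1` [set y]) x)%:E)).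
  by apply: H => y; rewrite in_fset_set// => /set_mem[x _ <-].
elim: s => [_|y s IH s0].
  under eq_fun do rewrite big_nil.
  by have := Pind set0 measurable0; under eq_fun do rewrite indic0.
have mi z : measurable_fun setT (fun x => (\1_(h @^-1` [set z]) x)%:E : \bar R).
  by apply/measurable_EFinP; exact: measurable_indic.
have y0 : (0 <= y)%R by apply: s0; rewrite mem_head.
have s0' z : z \in s -> (0 <= z)%R by move=> zs; apply: s0; rewrite inE zs orbT.
under eq_fun do rewrite big_cons.
apply: Padd.
- by move=> x; rewrite mule_ge0 ?lee_fin.
- by apply: emeasurable_funM; [exact: measurable_cst|exact: mi].
- move=> x; rewrite big_seq; apply: sume_ge0 => z zs.
  by apply: mule_ge0; rewrite lee_fin; [exact: s0'|].
- by apply: emeasurable_sum => z; apply: emeasurable_funM; [exact: measurable_cst|exact: mi].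
- apply: (Pscale _ _ y0 _ (mi y)); first by move=> x; rewrite lee_fin.
  exact: Pind.
- exact: IH.
Qed.

End Induction.

Section WeightedPushforward.
Context {d1 d2 : measure_display} {T1 : measurableType d1} {T2 : measurableType d2}.
Context {R : realType}.
Variables (mu : {measure set T1 -> \bar R}) (f : T1 -> R) (phi : T1 -> T2).

(** The image under [phi] of the measure with density [f]. Both the jumps and the jump rates become
    measures of this form on the predictable space. *)
Definition wpush (f0 : forall x, (0 <= f x)%R) (mf : measurable_fun setT f)
    (mphi : measurable_fun setT phi) (A : set T2) : \bar R :=
  \int[mu]_x ((f x)%:E * (\1_A (phi x))%:E).

Hypothesis f0 : forall x, (0 <= f x)%R.
Hypothesis mf : measurable_fun setT f.
Hypothesis mphi : measurable_fun setT phi.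
Local Notation nu := (wpush f0 mf mphi).

Let nu0 : nu set0 = 0.
Proof. by apply: integral0_eq => x _; rewrite indic0 mule0. Qed.

Let nu_ge0 A : 0 <= nu A.
Proof. by apply: integral_ge0 => x _; rewrite mule_ge0 ?lee_fin. Qed.

Let mfE : measurable_fun setT (fun x => (f x)%:E).
Proof. exact/measurable_EFinP. Qed.

Let mterm (A : set T2) : measurable A ->
  measurable_fun setT (fun x => (f x)%:E * (\1_A (phi x))%:E).
Proof.
move=> mA; apply: emeasurable_funM => //; apply/measurable_EFinP.
exact: (measurableT_comp (measurable_indic mA)).
Qed.

Let nu_additive : semi_sigma_additive nu.
Proof.
move=> F mFk tF mF.
rewrite [X in _ --> X](_ : _ = \sum_(k <oo) nu (F k)).
  by apply: is_cvg_nneseries => k _ _; exact: nu_ge0.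
rewrite /wpush -integral_nneseries//; last 2 first.
- by move=> k; exact: mterm.
- by move=> k x _; rewrite mule_ge0 ?lee_fin.
apply: eq_integral => x _.
have E A : (\1_A (phi x))%:E = \d_(phi x) A :> \bar R by rewrite diracE indicE.
under [RHS]eq_eseriesr do rewrite E.
by rewrite E measure_semi_bigcup// nneseriesZl.
Qed.

HB.instance Definition _ := isMeasure.Build _ _ _ nu nu0 nu_ge0 nu_additive.

Lemma integral_wpush (g : T2 -> \bar R) :
  (forall y, 0 <= g y) -> measurable_fun setT g ->
  \int[nu]_y g y = \int[mu]_x ((f x)%:E * g (phi x)).
Proof.
move=> g0 mg.
have mgphi (h : T2 -> \bar R) : measurable_fun setT h ->
    measurable_fun setT (fun x => (f x)%:E * h (phi x)).
  by move=> mh; apply: emeasurable_funM => //; exact: measurableT_comp.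
apply: (ge0_measurable_ind (Pr := fun g => \int[nu]_y g y =
  \int[mu]_x ((f x)%:E * g (phi x)))) => //.
- by move=> A mA; rewrite integral_indic// setIT.
- move=> c h c0 h0 mh IH; rewrite ge0_integralZl_EFin// IH -ge0_integralZl_EFin//.
  + by apply: eq_integral => x _; rewrite muleCA.
  + by move=> x _; rewrite mule_ge0 ?lee_fin.
  + exact: mgphi.
- move=> h k h0 mh k0 mk IHh IHk; rewrite ge0_integralD// IHh IHk.
  rewrite -ge0_integralD//.
  + by apply: eq_integral => x _; rewrite ge0_muleDr.
  + by move=> x _; rewrite mule_ge0 ?lee_fin.
  + exact: mgphi.
  + by move=> x _; rewrite mule_ge0 ?lee_fin.
  + exact: mgphi.
- move=> h h0 mh ndh IH; rewrite monotone_convergence//.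
  under eq_fun do rewrite IH.
  rewrite -monotone_convergence//.
  + apply: eq_integral => x _; rewrite limeMl//.
    by apply: ereal_nondecreasing_is_cvgn => m n; exact: ndh.
  + by move=> n; exact: mgphi.
  + by move=> n x _; rewrite mule_ge0 ?lee_fin.
  + by move=> x _ m n mn; rewrite lee_wpmul2l ?lee_fin//; exact: ndh.
Qed.

End WeightedPushforward.

(** Finite and infinite state spaces are treated alike: [e] may repeat states, and [c] selects one
    index for each. *)
Lemma countable_enumeration (E : choiceType) (i0 : E) : countable [set: E] ->
  exists (e : nat -> E) (c : E -> nat), forall i, e (c i) = i.
Proof.
move=> /countable_injP[f finj]; exists (fun k => xget i0 [set i | f i = k]), f => i.
by apply: xget_unique => // j fj; apply: finj; rewrite ?in_setT.
Qed.

(** * Jump rates of the process *)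

Section TruncatedRates.
Context {R : realType} {dE : measure_display} {E : measurableType dE}.
Variables (q : E -> E -> R * R -> R) (e : nat -> E) (c : E -> nat) (N : R).
Hypothesis ec : forall i, e (c i) = i.
Hypothesis q_rates : admissible_rates q.
Hypothesis N0 : (0 <= N)%R.

(* The state [j] is represented by the single index [k] with [c j = k]; the
   other indices carry no mass. *)
Definition trunc_rate (i : E) (k : nat) (x : R * R) : R :=
  if [&& c (e k) == k, e k != i, (0 <= x.1 <= N)%R & (0 <= x.2 <= N)%R]
  then q i (e k) x else 0%R.

Lemma trunc_rate_ge0 i k x : (0 <= trunc_rate i k x)%R.
Proof.
rewrite /trunc_rate; case: ifPn => // /and4P[_ /eqP ki /andP[x1 _] /andP[x2 _]].
by case: q_rates => _ q0 _ _; apply: q0 => // ik; exact: ki.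
Qed.

Lemma measurable_trunc_rate i k : measurable_fun setT (trunc_rate i k).
Proof.
case: q_rates => mq _ _ _; rewrite /trunc_rate.
case: eqP => _ /=; last exact: measurable_cst.
case: eqP => [_|ki] /=; first exact: measurable_cst.
apply: measurable_fun_if => //.
- by apply: measurable_and; apply: measurable_and; apply: measurable_fun_ler.
- rewrite setTI; apply: measurable_funS (mq i (e k) (nesym ki)).
    rewrite (_ : quadrant = [set x : R * R | (0 <= x.1)%R] `&` [set x | (0 <= x.2)%R]) //.
    apply: measurableI.
      rewrite [X in measurable X](_ : _ = fst @^-1` `[0%R, +oo[%classic).
        by rewrite -[X in measurable X]setTI; exact: measurable_fst.
      by apply/seteqP; split => x /=; rewrite in_itv/= andbT.
    rewrite [X in measurable X](_ : _ = snd @^-1` `[0%R, +oo[%classic).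
      by rewrite -[X in measurable X]setTI; exact: measurable_snd.
    by apply/seteqP; split => x /=; rewrite in_itv/= andbT.
  by move=> x /= /andP[/andP[x1 _] /andP[x2 _]].
Qed.

(** The bound is the supremum of the exit rates over the square [0, N]^2, finite because the square
    is compact. The indices with [c (e k) = k] correspond one to one to the states, so the series is
    the exit rate. *)
Lemma trunc_rate_bounded : exists B : R,
  forall i x, \sum_(k <oo) (trunc_rate i k x)%:E <= B%:E.
Proof.
case: q_rates => _ q0 qK _.
pose K := [set x : R * R | (0 <= x.1 <= N)%R /\ (0 <= x.2 <= N)%R].
pose M := ereal_sup [set ereal_sup [set exit_rate q i x | i in setT] | x in K].
have ex0 i x : K x -> 0 <= exit_rate q i x.
  move=> [/andP[x1 _] /andP[x2 _]]; apply: esum_ge0 => j /nesym ij.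
  by rewrite lee_fin q0.
have exM i x : K x -> exit_rate q i x <= M.
  move=> Kx; apply: (@le_trans _ _ (ereal_sup [set exit_rate q i x | i in setT])).
    by apply: ereal_sup_ubound; exists i.
  by apply: ereal_sup_ubound; exists x.
have MK : M < +oo.
  apply: qK.
    have -> : K = `[0%R, N]%classic `*` `[0%R, N]%classic.
      by apply/seteqP; split => x /=; rewrite !in_itv.
    by apply: compact_setX; exact: segment_compact.
  by move=> x [/andP[x1 _] /andP[x2 _]].
exists (fine M) => i x; have [Kx|nKx] := pselect (K x); last first.
  (* One point of the square suffices to see that the supremum is nonnegative, hence bounds the zero
     series outside. *)
  have K0 : K (0, 0)%R by split; rewrite /= lexx N0.
  rewrite eseries0; first by rewrite lee_fin fine_ge0// (le_trans (ex0 i _ K0) (exM i _ K0)).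
  move=> k _ _; rewrite /trunc_rate; case: ifPn => // /and4P[_ _ x1 x2].
  by case: nKx.
rewrite fineK; last by rewrite ge0_fin_numE// (le_trans (ex0 i x Kx) (exM i x Kx)).
apply: le_trans (exM i x Kx); rewrite /exit_rate.
pose P := [pred k | (c (e k) == k) && (e k != i)].
rewrite (_ : \sum_(k <oo) _ = \sum_(k <oo | P k) (q i (e k) x)%:E); last first.
  rewrite [RHS]eseries_mkcond; apply: eq_eseriesr => k _.
  rewrite /trunc_rate; case: Kx => -> ->; rewrite !andbT /=.
  by case: ifP.
rewrite nneseries_esum; last first.
  move=> k /andP[_ /eqP ki]; case: Kx => /andP[x1 _] /andP[x2 _].
  by rewrite lee_fin q0// => /esym.
rewrite (@reindex_esum _ _ _ [set k | P k] [set j | j <> i] e)//.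
split.
- by move=> k /= /andP[_ /eqP].
- move=> k l; rewrite !inE /= => /andP[/eqP ck _] /andP[/eqP cl _] ekl.
  by rewrite -ck -cl ekl.
- by move=> j /= ji; exists (c j) => //=; rewrite ec eqxx; apply/eqP.
Qed.

End TruncatedRates.

(** * Left limits of state and duration *)

Section LeftState.
Context {R : realType} {d : measure_display} {W : measurableType d}.
Context {dE : measure_display} {E : measurableType dE}.
Variables (Y : nat -> W -> E) (S : nat -> W -> \bar R).
Hypothesis mpp : is_mpp Y S.
Hypothesis E_countable : countable [set: E].
Hypothesis E_discrete : forall A : set E, measurable A.
Local Notation T := (event_time S).
Local Notation Z := (mpp_process Y S).
Local Notation U := (duration Y S).
Local Notation F := (natural_filtration Z).
Local Notation lv := (last_visit Y S).

Lemma last_visit_lt_state j t r w : (lv j t w < r)%R -> (r < t)%R -> Z r w = j.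
Proof.
move=> lr rt; apply: contrapT => Zr; move: lr; apply/negP; rewrite -leNgt.
have [r0|r0] := leP 0%R r; last by apply: le_trans (ltW r0) _; exact: last_visit_ge0.
apply: ub_le_sup; first by exists t => x [/andP[_ /ltW]].
by rewrite /= r0 rt.
Qed.

Lemma last_visit_lt_inj i j t w : (lv i t w < t)%R -> (lv j t w < t)%R -> i = j.
Proof.
move=> lit ljt; have m : (Num.max (lv i t w) (lv j t w) < t)%R by rewrite gt_max lit.
have [x] := rat_in_itvoo m; rewrite in_itv/= gt_max => /andP[/andP[xi xj] xt].
by rewrite -(last_visit_lt_state xi xt) (last_visit_lt_state xj xt).
Qed.

Lemma last_visit_lt_eq j t r w : (lv j t w < r)%R -> (r < t)%R ->
  lv j r w = lv j t w.
Proof.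
move=> lr rt; congr (sup _); apply/seteqP; split => s /= [/andP[s0 sr] Zs].
  by rewrite s0 (lt_trans sr rt).
rewrite s0/=; split => //; rewrite ltNge; apply/negP => rs.
by apply: Zs; apply: (last_visit_lt_state _ sr); exact: lt_le_trans lr rs.
Qed.

Lemma mpp_leftE j t w : (lv j t w < t)%R -> mpp_left Y S t w = j.
Proof.
move=> ljt; have nj : \forall s \near t^'-, Z s w = j.
  near=> s; apply: (@last_visit_lt_state j t); near: s.
    exact: nbhs_left_gt.
  exact: nbhs_left_lt.
apply: xget_unique => // y ny.
have [s [e1 e2]] := @filter_ex R (at_left t) _ _ (filterI ny nj).
by rewrite -e1 e2.
Unshelve. all: by end_near.
Qed.

Lemma duration_leftE j t w : (lv j t w < t)%R ->
  duration_left Y S t w = (t - lv j t w)%R.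
Proof.
move=> ljt; apply: cvg_lim => //.
apply: (@cvg_trans _ ((fun s : R => s - lv j t w)%R @ t^'-)).
  apply: near_eq_cvg; near=> s.
  have ls : (lv j t w < s)%R by near: s; exact: nbhs_left_gt.
  have st : (s < t)%R by near: s; exact: nbhs_left_lt.
  by rewrite durationE (last_visit_lt_state ls st) (last_visit_lt_eq ls st).
apply: cvgB; last exact: cvg_cst.
by apply: cvg_at_left_filter; exact: cvg_id.
Unshelve. all: by end_near.
Qed.

(* Only an explosion time has no left limit. *)
Lemma last_visit_lt_cofinite w :
  exists s0 : R, forall s, (0 < s)%R -> s <> s0 -> exists j, (lv j s w < s)%R.
Proof.
case: mpp => _ _ YS _ _.
(* A time without left limit comes after all events, since on each ]T_n, T_(n+1)] the left limit is
   [Y n]. *)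
have bad_after s n : (0 < s)%R -> (forall j, ~ (lv j s w < s)%R) -> T n w <= s%:E.
  move=> s0 nj; elim: n => [|n IH]; first by rewrite (event_time0 mpp) lee_fin ltW.
  have Tlt m : T m w < s%:E -> T m.+1 w < s%:E.
    move=> Tm; rewrite ltNge; apply/negP => sT; apply: (nj (Y m w)).
    rewrite (last_visit_eq mpp); last by rewrite (ltW Tm).
    by rewrite -lte_fin fineK// ge0_fin_numE ?(event_time_ge0 mpp)// (lt_trans Tm (ltry _)).
  move: IH; rewrite le_eqVlt => /predU1P[Tn|Tn]; last exact: ltW (Tlt n Tn).
  case: n Tn => [|n] Tn; first by move: Tn s0; rewrite (event_time0 mpp) => -[<-]; rewrite ltxx.
  exfalso; have Tfin : T n w < +oo.
    by apply: le_lt_trans (event_time_leS mpp n w) _; rewrite Tn ltry.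
  have Tns : T n w < s%:E by rewrite -Tn; exact: (event_time_ltS mpp).
  apply: (nj (Y n w)); rewrite (last_visit_eq mpp); last by rewrite (ltW Tns) Tn lexx.
  by rewrite -lte_fin fineK// ge0_fin_numE ?(event_time_ge0 mpp).
have [[s0 [s00 nj0]]|nex] := pselect (exists s0, (0 < s0)%R /\ forall j, ~ (lv j s0 w < s0)%R); last first.
  exists 0%R => s s_gt0 _; apply: contrapT => nj; apply: nex; exists s; split => // j ljs.
  by apply: nj; exists j.
exists s0 => s s_gt0 ss0; apply: contrapT => nj.
have nj' j : ~ (lv j s w < s)%R by move=> ljs; apply: nj; exists j.
(* After one such time the process rests at [Y 0], which is then the left limit at any later time;
   so there is at most one. *)
have main a b : (0 < a)%R -> (forall j, ~ (lv j a w < a)%R) -> (a < b)%R ->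
    (lv (Y 0%N w) b w < b)%R.
  move=> a0 nja ab; apply: le_lt_trans ab; rewrite leNgt; apply/negP.
  move=> /(last_visit_gt mpp _ _ _ (ltW a0))[x /andP[ax xb]]; apply.
  apply: mpp_process_beyond => n; apply: le_trans (bad_after a n a0 nja) _.
  by rewrite lee_fin ltW.
have [lt|lt|/esym//] := ltgtP s0 s.
  exact: (nj' (Y 0%N w) (main s0 s s00 nj0 lt)).
exact: (nj0 (Y 0%N w) (main s s0 s_gt0 nj' lt)).
Qed.

Variable i0 : E.

Definition left_state (x : R * W) : E :=
  xget i0 [set j | lv j x.1 x.2 < x.1]%R.

(** Evaluates [h] at the left limits of state and duration, and returns [v0] where there are none.
    It is defined through [last_visit] rather than through limits, which gives its predictability
    directly. *)
Definition at_left_state {V : Type} (h : E -> R * R -> V) (v0 : V) (x : R * W) : V :=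
  let j := left_state x in
  if (lv j x.1 x.2 < x.1)%R then h j (x.1, x.1 - lv j x.1 x.2)%R else v0.

Lemma at_left_stateE V (h : E -> R * R -> V) v0 j t w : (lv j t w < t)%R ->
  at_left_state h v0 (t, w) = h j (t, t - lv j t w)%R.
Proof.
move=> ljt; rewrite /at_left_state.
have -> : left_state (t, w) = j.
  by apply: xget_unique => // i /= lit; exact: last_visit_lt_inj lit ljt.
by rewrite /= ljt.
Qed.

(** Lets the cut-off time, which is measurable on the predictable space, replace [t]. *)
Lemma last_visit_pos j t w : (lv j t w < t)%R = (lv j t w < Num.max 0 t)%R.
Proof.
have [t0//|t0] := leP 0%R t; rewrite [RHS]ltNge last_visit_ge0/=.
by apply/negP => /lt_trans/(_ t0); rewrite ltNge last_visit_ge0.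
Qed.

Let mtime := measurable_predictable_time (natural_filtration_sigma Y S).
Let mlv := measurable_last_visit mpp E_discrete.

Lemma measurable_last_visit_lt j : measurable_fun setT
  (fun x : predictable_space F => lv j x.1 x.2 < x.1)%R.
Proof.
under eq_fun do rewrite last_visit_pos.
by apply: measurable_fun_ltr; [exact: mlv|exact: mtime].
Qed.

Lemma measurable_left_state : measurable_fun setT
  (left_state : predictable_space F -> E).
Proof.
move=> _ B _; rewrite setTI.
pose D j := [set x : predictable_space F | (lv j x.1 x.2 < x.1)%R].
have mD j : measurable (D j).
  have mtrue : measurable [set true] by [].
  by have := measurable_last_visit_lt j measurableT mtrue; rewrite setTI.
have -> : left_state @^-1` B = (\bigcup_j (if `[< B j >] then D j else set0)) `|`
   (if `[< B i0 >] then ~` (\bigcup_j D j) else set0).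
  apply/seteqP; split => [x|x].
    rewrite /left_state /preimage/=.
    case: xgetP => [j _ ljx Bj|nj Bi0]; first by left; exists j => //; rewrite asboolT.
    by right; rewrite asboolT//= => -[j _ ljx]; exact: nj ljx.
  move=> [[j _]|]; case: asboolP => //= Bj.
    move=> ljx; rewrite /preimage/=; have -> // : left_state x = j.
    by apply: xget_unique => // i /= lix; exact: last_visit_lt_inj lix ljx.
  move=> nj; rewrite /preimage/=; have -> // : left_state x = i0.
  by apply: xgetPN => j ljx; apply: nj; exists j.
apply: measurableU.
  by apply: countable_bigcupT_measurable => // j; case: ifP => // _; exact: measurable0.
case: ifP => // _; apply: measurableC.
exact: countable_bigcupT_measurable.
Qed.

Lemma measurable_at_left_state d' (V : measurableType d') (h : E -> R * R -> V) v0 :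
  (forall j, measurable_fun setT (h j)) ->
  measurable_fun setT (at_left_state h v0 : predictable_space F -> V).
Proof.
move=> mh; apply: (@measurable_fun_countable_case _ _ _ (predictable_space F) V E left_state
  (fun j x => if (lv j x.1 x.2 < x.1)%R then h j (x.1, x.1 - lv j x.1 x.2)%R else v0)) => //.
  exact: measurable_left_state.
move=> j.
rewrite (_ : (fun x => _) = fun x => if (lv j x.1 x.2 < x.1)%R then
   h j (Num.max 0 x.1, Num.max 0 x.1 - lv j x.1 x.2)%R else v0); last first.
  apply/funext => x; case: ifPn => // ljx; rewrite max_r//.
  by apply: le_trans (ltW ljx); exact: last_visit_ge0.
apply: measurable_fun_ifT => //; first exact: measurable_last_visit_lt.
apply: (measurableT_comp (mh j)); apply: measurable_fun_pair; first exact: mtime.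
by apply: measurable_funB; [exact: mtime|exact: mlv].
Qed.

End LeftState.

(** * Predictable version of the intensity *)

Section JumpRate.
Context {R : realType} {d : measure_display} {W : measurableType d}.
Context {dE : measure_display} {E : measurableType dE}.
Variables (Y : nat -> W -> E) (S : nat -> W -> \bar R).
Hypothesis mpp : is_mpp Y S.
Hypothesis E_countable : countable [set: E].
Hypothesis E_discrete : forall A : set E, measurable A.
Variables (q : E -> E -> R * R -> R) (i0 : E) (e : nat -> E) (c : E -> nat) (N : R).
Hypothesis ec : forall i, e (c i) = i.
Hypothesis q_rates : admissible_rates q.
Hypothesis N0 : (0 <= N)%R.
Local Notation T := (event_time S).
Local Notation Z := (mpp_process Y S).
Local Notation F := (natural_filtration Z).
Local Notation lv := (last_visit Y S).
Local Notation mu := (@lebesgue_measure R).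
Local Notation qN := (trunc_rate q e c N).

Definition jump_rate (k : nat) : R * W -> R :=
  at_left_state Y S i0 (fun j => qN j k) 0%R.

Lemma jump_rate_ge0 k x : (0 <= jump_rate k x)%R.
Proof.
by rewrite /jump_rate /at_left_state; case: ifP => // _; exact: trunc_rate_ge0.
Qed.

Lemma measurable_jump_rate k :
  measurable_fun setT (jump_rate k : predictable_space F -> R).
Proof.
by apply: measurable_at_left_state => // j; exact: measurable_trunc_rate.
Qed.

Lemma measurable_predictable_prod d' (V : measurableType d')
    (f : predictable_space F -> V) :
  measurable_fun setT f -> measurable_fun setT (f : R * W -> V).
Proof.
move=> mf; apply: (measurableT_comp mf).
apply: measurable_prod_to_predictable.
exact: natural_filtration_measurable.
Qed.

Lemma measurable_jump_rate_prod k : measurable_fun setT (jump_rate k).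
Proof. exact: measurable_predictable_prod (measurable_jump_rate k). Qed.

Lemma jump_rate_bounded (B : R) :
  (forall i x, \sum_(k <oo) (qN i k x)%:E <= B%:E) -> (0 <= B)%R ->
  forall x, \sum_(k <oo) (jump_rate k x)%:E <= B%:E.
Proof.
move=> qB B0 x; rewrite /jump_rate /at_left_state /=.
case: (lv (left_state Y S i0 x) x.1 x.2 < x.1)%R => //.
by rewrite eseries0 ?lee_fin.
Qed.

Lemma intensity_jump_rate k j t w : c (e k) = k -> (0 <= t <= N)%R ->
  (lv j t w < t)%R -> intensity Y S q (e k) t w = jump_rate k (t, w).
Proof.
move=> ck /andP[t0 tN] ljt.
rewrite /intensity (mpp_leftE ljt) (duration_leftE ljt) /jump_rate.
rewrite (at_left_stateE i0 _ _ ljt) /trunc_rate /= ck eqxx /= eq_sym.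
case: eqP => //= _; rewrite t0 tN subr_ge0 (ltW ljt) /=.
by rewrite (le_trans _ tN)// lerBlDr lerDl last_visit_ge0.
Qed.

(** The intensity and [jump_rate] agree on [0, t] except possibly at 0 and at an explosion time, a
    Lebesgue null set. *)
Lemma integrated_intensityE k t w : c (e k) = k -> (0 <= t <= N)%R ->
  integrated_intensity Y S q (e k) t w =
  \int[mu]_(s in `]0%R, t]) (jump_rate k (s, w))%:E.
Proof.
move=> ck /andP[t0 tN]; rewrite /integrated_intensity.
have mj : measurable_fun setT (fun s => (jump_rate k (s, w))%:E).
  apply/measurable_EFinP.
  exact: (measurable_fun_pair1 w (measurable_jump_rate_prod k)).
rewrite integral_itv_obnd_cbnd; last exact: measurable_funTS.
have [s0 Hs0] := last_visit_lt_cofinite mpp w.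
(* [g] coincides with the intensity on [0, t] and is visibly measurable: it is [jump_rate] altered
   at two points. *)
pose g s := if s == 0%R then (intensity Y S q (e k) s w)%:E else
            if s == s0 then (intensity Y S q (e k) s w)%:E else (jump_rate k (s, w))%:E.
transitivity (\int[mu]_(s in `[0%R, t]) g s).
  apply: eq_integral => s; rewrite inE/= in_itv/= => /andP[s_ge0 st].
  rewrite /g; case: eqP => // s_neq0; case: eqP => // ss0.
  have s_gt0 : (0 < s)%R by rewrite lt_neqAle s_ge0 andbT eq_sym; apply/eqP.
  have [j ljs] := Hs0 s s_gt0 ss0.
  by rewrite (intensity_jump_rate ck _ ljs)// s_ge0 (le_trans st tN).
have mg : measurable_fun setT g.
  rewrite (_ : g = fun s => if s == 0%R then (intensity Y S q (e k) 0%R w)%:E else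
            if s == s0 then (intensity Y S q (e k) s0 w)%:E else (jump_rate k (s, w))%:E).
    apply: measurable_fun_ifT => //; first exact: measurable_fun_eqr.
    by apply: measurable_fun_ifT => //; exact: measurable_fun_eqr.
  by apply/funext => s; rewrite /g; case: eqP => [->//|_]; case: eqP => [->|].
apply: ae_eq_integral => //; [exact: measurable_funTS|exact: measurable_funTS|].
exists ([set 0%R] `|` [set s0]); split.
- by apply: measurableU.
- by rewrite measureU0//; exact: lebesgue_measure_set1.
- move=> s /= ns; apply: contrapT => /not_orP[/eqP s_neq0 /eqP ss0]; apply: ns => _.
  by rewrite /g (negbTE s_neq0) (negbTE ss0).
Qed.

Lemma counting_processE i t w : counting_process Y S i t w =
  \sum_(n <oo) ([&& (0 < n)%N, (T n w <= t%:E)%E & Y n w == i])%:R%:E.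
Proof.
rewrite /counting_process counting_dirac; apply: eq_eseriesr => n _.
rewrite diracE; congr ((nat_of_bool _)%:R%:E).
apply/idP/idP; first by move=> /set_mem[-> -> ->]; rewrite eqxx.
by move=> /and3P[n0 Tn /eqP Yn]; apply/mem_set.
Qed.

Lemma counting_process_ge0 i t w : 0 <= counting_process Y S i t w.
Proof. exact: measure_ge0. Qed.

Lemma measurable_state_eq d' (V : measurableType d') (f : V -> E) i :
  measurable_fun setT f -> measurable_fun setT (fun x => f x == i).
Proof.
by move=> mf; apply: (measurableT_comp (f := fun y : E => y == i)).
Qed.

Lemma measurable_counting i (theta : W -> R) : measurable_fun setT theta ->
  measurable_fun setT (fun w => counting_process Y S i (theta w) w).
Proof.
move=> mtheta; under eq_fun do rewrite counting_processE.
apply: ge0_emeasurable_sum => [n w _ _|n _]; first by rewrite lee_fin.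
apply/measurable_EFinP.
apply: (measurableT_comp (f := fun b : bool => b%:R : R)) => //.
apply: measurable_and => //; apply: measurable_and.
  by apply: measurable_fun_lee; [exact: (measurable_event_time mpp)|exact/measurable_EFinP].
by case: mpp => mY _ _ _ _; exact: measurable_state_eq.
Qed.

Lemma counting_process_le i s t w : (s <= t)%R ->
  counting_process Y S i s w <= counting_process Y S i t w.
Proof.
move=> st; rewrite !counting_processE; apply: lee_nneseries => [n _ _|n _].
  by rewrite lee_fin.
rewrite lee_fin ler_nat; case: (0 < n)%N => //=.
have st' : s%:E <= t%:E by rewrite lee_fin.
case: (boolP (T n w <= s%:E)) => //= Ts.
by rewrite (le_trans Ts st').
Qed.

End JumpRate.

(** * Compensator formula *)

Section Localization.
Context {R : realType} {d : measure_display} {W : measurableType d}.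
Variable P : probability W R.

Lemma fin_num_rearrange (a b x y : \bar R) : a \is a fin_num -> b \is a fin_num ->
  x \is a fin_num -> y \is a fin_num -> a - x = b - y -> b + x = a + y.
Proof.
by move: a b x y => [a| |] [b| |] [x| |] [y| |] // _ _ _ _ [] H; congr EFin; lra.
Qed.

Lemma fine_mine_itv (r : R) (x : \bar R) : (0 <= r)%R -> 0 <= x ->
  (0 <= fine (Order.min r%:E x) <= r)%R.
Proof.
move=> r0 x0; have m0 : 0 <= Order.min r%:E x by rewrite le_min lee_fin r0.
rewrite fine_ge0//= -lee_fin fineK ?ge_min ?lexx//.
by rewrite ge0_fin_numE// gt_min ltry.
Qed.

(** The times min(r, tau_n) increase and almost surely equal [r] from some n on. Monotonicity of [G]
    then allows monotone convergence, whether or not the limit is finite. *)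
Lemma cvg_integral_localized (G : R -> W -> \bar R) (tau : nat -> W -> \bar R)
    (A : set W) (r : R) : (0 <= r)%R ->
  (forall s w, 0 <= G s w) ->
  (forall w s t, (0 <= s)%R -> (s <= t)%R -> (t <= r)%R -> G s w <= G t w) ->
  (forall theta : W -> R, measurable_fun setT theta ->
     (forall w, (0 <= theta w <= r)%R) -> measurable_fun setT (fun w => G (theta w) w)) ->
  (forall n, measurable_fun setT (tau n)) ->
  (forall n w, 0 <= tau n w) ->
  (forall n w, tau n w <= tau n.+1 w) ->
  {ae P, forall w, tau n w @[n --> \oo] --> +oo} ->
  measurable A ->
  \int[P]_(w in A) G (fine (Order.min r%:E (tau n w))) w @[n --> \oo] -->
  \int[P]_(w in A) G r w.
Proof.
move=> r0 G0 Gnd mG mtau tau0 tauS taulim mA.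
pose theta n w := fine (Order.min r%:E (tau n w)).
have theta_itv n w : (0 <= theta n w <= r)%R by exact: fine_mine_itv.
have mtheta n : measurable_fun setT (theta n).
  apply: measurableT_comp => //; exact: measurable_mine.
have theta_nd w m n : (m <= n)%N -> (theta m w <= theta n w)%R.
  move=> mn; have mn' : tau m w <= tau n w.
    by rewrite -(subnK mn) addnC; elim: (n - m)%N => [|k IH];
      rewrite ?addn0// addnS (le_trans IH).
  apply: fine_le; rewrite ?ge0_fin_numE ?le_min ?gt_min ?ltry ?lee_fin ?r0 ?tau0//.
  by rewrite !ge_min lexx mn' orbT.
have mGn n : measurable_fun setT (fun w => G (theta n w) w) by exact: mG.
have Gn_nd w : {homo (fun n => G (theta n w) w) : m n / (m <= n)%N >-> m <= n}.
  move=> m n mn; apply: Gnd; [|exact: theta_nd|].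
    by case/andP: (theta_itv m w).
  by case/andP: (theta_itv n w).
have -> : \int[P]_(w in A) G r w = \int[P]_(w in A) limn (fun n => G (theta n w) w).
  apply: ge0_ae_eq_integral => //.
  - by apply: measurable_funTS; apply: (mG (cst r)) => // w; rewrite r0 lexx.
  - apply: measurable_funTS; apply: (emeasurable_fun_cvg (fun n w => G (theta n w) w)) => // w _.
    exact: ereal_nondecreasing_is_cvgn.
  - move=> w _; apply: lime_ge; first exact: ereal_nondecreasing_is_cvgn.
    by near=> n.
  - case: taulim => B [mB PB sB]; exists B; split => // w /= nw; apply: sB => /= tw.
    apply: nw => _; apply/esym/cvg_lim => //.
    apply: cvg_near_cst; move/cvgeyPgt : tw => /(_ r).
    apply: filterS => n rn; congr (G _ w).
    by rewrite /theta min_l// ltW.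
apply: (@cvg_monotone_convergence _ _ _ P A mA (fun n w => G (theta n w) w)).
- by move=> n; apply: measurable_funTS; exact: mGn.
- by move=> n w _.
- by move=> w _; exact: Gn_nd.
Unshelve. all: by end_near.
Qed.

End Localization.

Section CompensatorIdentity.
Context {R : realType} {d : measure_display} {W : measurableType d}.
Context {dE : measure_display} {E : measurableType dE}.
Variables (P : probability W R) (Y : nat -> W -> E) (S : nat -> W -> \bar R).
Hypothesis mpp : is_mpp Y S.
Hypothesis E_countable : countable [set: E].
Hypothesis E_discrete : forall A : set E, measurable A.
Variables (q : E -> E -> R * R -> R) (i0 : E) (e : nat -> E) (c : E -> nat) (N : R).
Hypothesis ec : forall i, e (c i) = i.
Hypothesis q_rates : admissible_rates q.
Hypothesis N0 : (0 <= N)%R.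
Local Notation T := (event_time S).
Local Notation Z := (mpp_process Y S).
Local Notation F := (natural_filtration Z).
Local Notation mu := (@lebesgue_measure R).
Local Notation qN := (trunc_rate q e c N).
Local Notation jr := (jump_rate Y S q i0 e c N).
Variable (B : R).
Hypothesis B0 : (0 <= B)%R.
Hypothesis qB : forall i x, \sum_(k <oo) (qN i k x)%:E <= B%:E.
Variable k : nat.
Hypothesis ck : c (e k) = k.
Hypothesis comp : is_compensator P F (counting_process Y S (e k))
  (integrated_intensity Y S q (e k)).
Local Notation cnt := (counting_process Y S (e k)).
Local Notation cumul s t w := (\int[mu]_(r in `]s, t]) (jr k (r, w))%:E).

Let jr0 x : (0 <= jr k x)%R.
Proof. exact: jump_rate_ge0. Qed.

Let mjr : measurable_fun setT (jr k).
Proof. exact: measurable_jump_rate_prod. Qed.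

Lemma jump_rate_le x : (jr k x <= B)%R.
Proof.
rewrite -lee_fin; apply: le_trans (jump_rate_bounded Y S i0 qB B0 x).
rewrite (nneseriesD1 (n := k))//; last by move=> l _; rewrite lee_fin jump_rate_ge0.
rewrite leeDl//; apply: nneseries_ge0 => l _ _; by rewrite lee_fin jump_rate_ge0.
Qed.

Let mjr1 w : measurable_fun setT (fun r => (jr k (r, w))%:E).
Proof. by apply/measurable_EFinP; exact: (measurable_fun_pair1 w mjr). Qed.

Lemma cumul_ge0 s t w : 0 <= cumul s t w.
Proof. by apply: integral_ge0 => r _; rewrite lee_fin. Qed.

Lemma cumul_le s t w : (s <= t)%R -> cumul s t w <= (B * (t - s))%:E.
Proof.
move=> st; apply: (@le_trans _ _ (\int[mu]_(r in `]s, t]) (cst B%:E r))).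
  apply: ge0_le_integral => //.
  - by move=> r _; rewrite lee_fin.
  - exact: (measurable_funTS (mjr1 w)).
  - by move=> r _; rewrite lee_fin jump_rate_le.
rewrite integral_cst//= lebesgue_measure_itv/= lte_fin.
case: ltP => [_|ts]; first by rewrite -EFinB -EFinM.
by rewrite mule0 lee_fin mulr_ge0// subr_ge0.
Qed.

Lemma cumul_fin s t w : (s <= t)%R -> cumul s t w \is a fin_num.
Proof.
by move=> st; rewrite ge0_fin_numE ?cumul_ge0//; apply: le_lt_trans (cumul_le w st) (ltry _).
Qed.

Lemma measurable_cumul (a b : W -> R) : measurable_fun setT a ->
  measurable_fun setT b -> measurable_fun setT (fun w => cumul (a w) (b w) w).
Proof.
move=> ma mb; apply: (measurable_integral_itv (h := fun z => (jr k (z.2, z.1))%:E)) => //.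
apply/measurable_EFinP; apply: (measurableT_comp mjr).
exact: measurable_swap.
by move=> z; rewrite lee_fin.
Qed.

Lemma cumul_split a b t w : (a <= b)%R -> (b <= t)%R ->
  cumul a t w = cumul a b w + cumul b t w.
Proof.
move=> ab bt; apply: ge0_integral_itv_split => //; first exact: (measurable_funTS (mjr1 w)).
by move=> r _ _; rewrite lee_fin.
Qed.

(** Stopped at tau_n, the integrated rate is bounded and hence integrable, and so is the count,
    being the martingale plus the integrated rate. The martingale equation on [A] can thus be split
    and rearranged into sums. In this additive form it survives the passage to the limit, where the
    counts are not yet known to be integrable. *)
Lemma compensator_identity s t A : (0 <= s)%R -> (s <= t)%R -> (t <= N)%R -> F s A ->
  \int[P]_(w in A) cnt t w + \int[P]_(w in A) cumul 0%R s w =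
  \int[P]_(w in A) cnt s w + \int[P]_(w in A) cumul 0%R t w.
Proof.
move=> s0 st tN FA; have t0 := le_trans s0 st; have sN := le_trans st tN.
have Fsigma := natural_filtration_sigma Y S.
have Fmono := natural_filtration_mono (Y := Y) (S := S).
have Fmeas := natural_filtration_measurable mpp E_discrete.
have mA : measurable A by exact: Fmeas FA.
have intE r w : (0 <= r)%R -> (r <= N)%R ->
    integrated_intensity Y S q (e k) r w = cumul 0%R r w.
  by move=> r0 rN; apply: integrated_intensityE => //; rewrite r0 rN.
case: comp => _ _ _ _ [tau [tau_stop tauS taulim mart]].
have mtau n : measurable_fun setT (tau n) by exact: stopping_measurable (tau_stop n).
have tau0 n w : 0 <= tau n w by case: (tau_stop n).
pose th r n w := fine (Order.min r%:E (tau n w)).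
have mth r n : measurable_fun setT (th r n).
  by apply: measurableT_comp => //; exact: measurable_mine.
have thr r n w : (0 <= r)%R -> (0 <= th r n w <= r)%R by move=> r0; exact: fine_mine_itv.
pose Nn r n w := cnt (th r n w) w.
pose Ln r n w := cumul 0%R (th r n w) w.
have mLn r n : measurable_fun setT (Ln r n) by exact: measurable_cumul.
have mNn r n : measurable_fun setT (Nn r n) by exact: measurable_counting.
have Lfin r n w : (0 <= r)%R -> Ln r n w \is a fin_num.
  by move=> r0; apply: cumul_fin; case/andP: (thr r n w r0).
have iLn r n : (0 <= r)%R -> P.-integrable setT (Ln r n).
  move=> r0; apply: (@le_integrable _ _ _ _ _ measurableT _ (cst (B * r)%:E)) => //.
    move=> w _ /=; rewrite !gee0_abs ?cumul_ge0 ?lee_fin ?mulr_ge0//.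
    case/andP: (thr r n w r0) => th0 thr'.
    apply: le_trans (cumul_le w th0) _; rewrite lee_fin subr0.
    by apply: le_trans (ler_norm _); rewrite ler_wpM2l.
  exact: finite_measure_integrable_cst.
have iMn r n : (0 <= r)%R -> (r <= N)%R -> P.-integrable setT (fun w => Nn r n w - Ln r n w).
  move=> r0 rN; case: (mart n) => _ /(_ r r0) + _.
  apply: eq_integrable => // w _; rewrite /stopped_process /Nn /Ln -/(th r n w).
  case/andP: (thr r n w r0) => th0 thr'.
  by rewrite intE// (le_trans thr' rN).
have iNn r n : (0 <= r)%R -> (r <= N)%R -> P.-integrable setT (Nn r n).
  move=> r0 rN; have := integrableD measurableT (iMn r n r0 rN) (iLn r n r0).
  by apply: eq_integrable => // w _; rewrite /= subeK// Lfin.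
have key n : \int[P]_(w in A) Nn t n w + \int[P]_(w in A) Ln s n w =
             \int[P]_(w in A) Nn s n w + \int[P]_(w in A) Ln t n w.
  have iA (f : W -> \bar R) : P.-integrable setT f -> P.-integrable A f.
    by move=> fi; apply: (integrableS measurableT).
  have fin (f : W -> \bar R) : P.-integrable setT f -> \int[P]_(w in A) f w \is a fin_num.
    by move=> fi; apply: integrable_fin_num => //; exact: iA.
  have martA : \int[P]_(x in A) stopped_process (fun t w => cnt t w -
        integrated_intensity Y S q (e k) t w) (tau n) s x =
      \int[P]_(x in A) stopped_process (fun t w => cnt t w -
        integrated_intensity Y S q (e k) t w) (tau n) t x.
    by case: (mart n) => _ _ /(_ s t s0 st)[_ _ /(_ A FA)].
  have ME r : (0 <= r)%R -> (r <= N)%R ->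
    \int[P]_(x in A) stopped_process (fun t w => cnt t w -
        integrated_intensity Y S q (e k) t w) (tau n) r x =
    \int[P]_(x in A) Nn r n x - \int[P]_(x in A) Ln r n x.
    move=> r0 rN.
    transitivity (\int[P]_(x in A) (Nn r n \- Ln r n) x); last first.
      exact: (integralB mA (iA _ (iNn r n r0 rN)) (iA _ (iLn r n r0))).
    apply: eq_integral => w _; case/andP: (thr r n w r0) => th0 thr'.
    have -> : Ln r n w = integrated_intensity Y S q (e k) (th r n w) w.
      exact: esym (intE _ w th0 (le_trans thr' rN)).
    by [].
  have eqM := etrans (esym (ME s s0 sN)) (etrans martA (ME t t0 tN)).
  exact: fin_num_rearrange (fin _ (iNn s n s0 sN)) (fin _ (iNn t n t0 tN))
    (fin _ (iLn s n s0)) (fin _ (iLn t n t0)) eqM.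
have cN r : (0 <= r)%R -> \int[P]_(w in A) Nn r n w @[n --> \oo] --> \int[P]_(w in A) cnt r w.
  move=> r0; apply: (@cvg_integral_localized _ _ _ P cnt) => //.
  - by move=> w x y _ xy _; exact: counting_process_le.
  - by move=> theta mtheta _; exact: measurable_counting.
have cL r : (0 <= r)%R -> \int[P]_(w in A) Ln r n w @[n --> \oo] --> \int[P]_(w in A) cumul 0%R r w.
  move=> r0; apply: (@cvg_integral_localized _ _ _ P (fun x w => cumul 0%R x w)) => //.
  - by move=> x w; exact: cumul_ge0.
  - by move=> w x y x0 xy _; rewrite (cumul_split w x0 xy) leeDl// cumul_ge0.
  - by move=> theta mtheta _; exact: measurable_cumul.
have c0 r : 0 <= \int[P]_(w in A) cnt r w.
  by apply: integral_ge0 => w _; exact: counting_process_ge0.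
have l0 r : 0 <= \int[P]_(w in A) cumul 0%R r w.
  by apply: integral_ge0 => w _; exact: cumul_ge0.
have h1 := cvgeD (ge0_adde_def (c0 t) (l0 s)) (cN t t0) (cL s s0).
have h2 := cvgeD (ge0_adde_def (c0 s) (l0 t)) (cN s s0) (cL t t0).
have e1 := cvg_lim (@ereal_hausdorff R) (h1 eventually_filter).
have e2 := cvg_lim (@ereal_hausdorff R) (h2 eventually_filter).
apply: (etrans (esym (e1 eventually_filter))); apply: (etrans _ (e2 eventually_filter)).
apply: congr_lim; apply/funext => n; exact: key.
Qed.

End CompensatorIdentity.

Lemma fin_num_cancel (R : realType) (a b x y : \bar R) : a \is a fin_num ->
  b \is a fin_num -> a + y + b = a + (b + x) -> y = x.
Proof.
by move: a b x y => [a| |] [b| |] [x| |] [y| |] //= _ _ [] H; congr EFin; lra.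
Qed.

Section PredictableIdentity.
Context {R : realType} {d : measure_display} {W : measurableType d}.
Context {dE : measure_display} {E : measurableType dE}.
Variables (P : probability W R) (Y : nat -> W -> E) (S : nat -> W -> \bar R).
Hypothesis mpp : is_mpp Y S.
Hypothesis E_countable : countable [set: E].
Hypothesis E_discrete : forall A : set E, measurable A.
Variables (q : E -> E -> R * R -> R) (i0 : E) (e : nat -> E) (c : E -> nat) (N : R).
Hypothesis q_rates : admissible_rates q.
Hypothesis N0 : (0 <= N)%R.
Local Notation T := (event_time S).
Local Notation Z := (mpp_process Y S).
Local Notation F := (natural_filtration Z).
Local Notation mu := (@lebesgue_measure R).
Local Notation qN := (trunc_rate q e c N).
Local Notation jr := (jump_rate Y S q i0 e c N).
Variable (B : R).
Hypothesis B0 : (0 <= B)%R.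
Hypothesis qB : forall i x, \sum_(k <oo) (qN i k x)%:E <= B%:E.
Hypothesis comp : forall i, is_compensator P F (counting_process Y S i)
  (integrated_intensity Y S q i).
Local Notation cumul k s t w := (\int[mu]_(r in `]s, t]) (jr k (r, w))%:E).

Let Fsigma := natural_filtration_sigma Y S.
Let Fmeas := natural_filtration_measurable mpp E_discrete.

Lemma counting_process0 i w : counting_process Y S i 0%R w = 0.
Proof.
rewrite counting_processE eseries0// => -[|n] _ _ //=.
by rewrite leNgt (event_time_gt0 mpp).
Qed.

(** Makes the expected count finite, since the integrated rate is at most B N; cancellations become
    possible from here on. *)
Lemma expected_count k : c (e k) = k ->
  \int[P]_w counting_process Y S (e k) N w = \int[P]_w cumul k 0%R N w.
Proof.
move=> ck.
have FT : F 0%R setT by case: (Fsigma 0%R) => F0 FC _; rewrite -(setD0 setT); exact: FC.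
have := compensator_identity mpp E_countable E_discrete i0 q_rates B0 qB ck (comp (e k))
  (lexx 0%R) N0 (lexx N) FT.
suff aux (x y z t : \bar R) : y = 0 -> z = 0 -> x + y = z + t -> x = t.
  apply: aux; apply: integral0_eq => w _; last exact: counting_process0.
  by rewrite set_itvoc0 integral_set0.
by move=> -> ->; rewrite adde0 add0e.
Qed.

Definition jump_weight k n (w : W) : R :=
  ([&& (0 < n)%N, (T n w <= N%:E)%E & Y n w == e k])%:R.

Lemma measurable_jump_weight k n : measurable_fun setT (jump_weight k n).
Proof.
apply: (measurableT_comp (f := fun b : bool => b%:R : R)) => //.
apply: measurable_and => //; apply: measurable_and.
  apply: measurable_fun_lee => //; exact: (measurable_event_time mpp).
by case: mpp => mY _ _ _ _; exact: measurable_state_eq.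
Qed.

Let iota n (w : W) : predictable_space F := (fine (T n w), w).

Lemma measurable_jump_point n : measurable_fun setT (iota n).
Proof.
apply: measurable_to_predictable => s A s0 FA.
rewrite (_ : _ @^-1` _ = (fine \o T n) @^-1` `]s, +oo[ `&` A) //.
apply: measurableI; last exact: Fmeas FA.
rewrite -[X in measurable X]setTI.
apply: (measurableT_comp (@fine_measurable R setT measurableT) (measurable_event_time mpp n)) => //.
Qed.

(** The compensator identity between [s] and [N], after the terms up to [s] are cancelled; they are
    finite by [expected_count]. The sum counts the events with mark [e k] in ]s, N]. *)
Lemma jump_increment k s A : c (e k) = k -> (0 <= s)%R -> (s <= N)%R -> F s A ->
  \int[P]_(w in A) (\sum_(n <oo) (jump_weight k n w * (s < fine (T n w))%R%:R)%:E) =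
  \int[P]_(w in A) cumul k s N w.
Proof.
move=> ck s0 sN FA; have mA : measurable A by exact: Fmeas FA.
have D0 w n : 0 <= (jump_weight k n w * (s < fine (T n w))%R%:R)%:E.
  by rewrite lee_fin mulr_ge0.
have mD : measurable_fun setT
    (fun w => \sum_(n <oo) (jump_weight k n w * (s < fine (T n w))%R%:R)%:E).
  apply: ge0_emeasurable_sum => // n _; apply/measurable_EFinP.
  apply: measurable_funM; first exact: measurable_jump_weight.
  apply: (measurableT_comp (f := fun b : bool => b%:R : R)) => //.
  apply: measurable_fun_ltr => //.
  exact: (measurableT_comp (@fine_measurable R setT measurableT) (measurable_event_time mpp n)).
have cnt0 t w : 0 <= counting_process Y S (e k) t w.
  exact: counting_process_ge0.
have mcnt t : measurable_fun setT (counting_process Y S (e k) t).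
  exact: (measurable_counting mpp E_discrete (e k) (measurable_cst t)).
have mcum a b : measurable_fun setT (fun w => cumul k a b w).
  exact: (measurable_cumul mpp E_countable E_discrete i0 e c N q_rates k (measurable_cst a) (measurable_cst b)).
have cum0 a b w : 0 <= cumul k a b w by exact: cumul_ge0.
have cntE w : counting_process Y S (e k) N w = counting_process Y S (e k) s w +
    \sum_(n <oo) (jump_weight k n w * (s < fine (T n w))%R%:R)%:E.
  rewrite !counting_processE -nneseriesD//.
  apply: eq_eseriesr => n _; rewrite -EFinD; congr EFin.
  rewrite /jump_weight; case: (0 < n)%N => /=; last by rewrite mul0r addr0.
  case: (Y n w == e k); rewrite ?andbT ?andbF ?mul0r ?addr0//.
  have := event_time_ge0 mpp n w; case: (T n w) => [r| |] //= _.
    rewrite !lee_fin; case: (leP r N) => rN.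
      by rewrite mul1r; case: leP => _; rewrite ?addr0 ?add0r.
    by rewrite ?mulr0n mul0r addr0 leNgt (le_lt_trans sN rN).
  by rewrite mul0r addr0.
have := compensator_identity mpp E_countable E_discrete i0 q_rates B0 qB ck (comp (e k))
  s0 sN (lexx N) FA.
have -> : \int[P]_(w in A) counting_process Y S (e k) N w =
   \int[P]_(w in A) counting_process Y S (e k) s w +
   \int[P]_(w in A) (\sum_(n <oo) (jump_weight k n w * (s < fine (T n w))%R%:R)%:E).
  rewrite -ge0_integralD//; [|exact: measurable_funTS|
    by move=> w _; exact: nneseries_ge0|exact: measurable_funTS].
  by apply: eq_integral => w _; exact: cntE.
have -> : \int[P]_(w in A) cumul k 0%R N w =
   \int[P]_(w in A) cumul k 0%R s w + \int[P]_(w in A) cumul k s N w.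
  rewrite -ge0_integralD//; [|exact: measurable_funTS|exact: measurable_funTS].
  by apply: eq_integral => w _; exact: cumul_split.
have sub (f : W -> \bar R) : (forall w, 0 <= f w) -> measurable_fun setT f ->
    \int[P]_w f w < +oo -> \int[P]_(w in A) f w \is a fin_num.
  move=> f0 mf flt; rewrite ge0_fin_numE; last exact: integral_ge0.
  by apply: le_lt_trans flt; apply: ge0_subset_integral.
have cumfin : \int[P]_w cumul k 0%R N w < +oo.
  apply: (@le_lt_trans _ _ (\int[P]_w (cst (B * (N - 0))%:E w))).
    by apply: ge0_le_integral => // w _; exact: cumul_le.
  rewrite integral_cst//; apply: (@le_lt_trans _ _ ((B * (N - 0))%:E * 1)); last by rewrite mule1 ltry.
  by apply: lee_wpmul2l; [rewrite lee_fin mulr_ge0// subr0|exact: probability_le1].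
have fcum : \int[P]_(w in A) cumul k 0%R s w \is a fin_num.
  rewrite ge0_fin_numE; last exact: integral_ge0.
  apply: le_lt_trans cumfin.
  apply: (@le_trans _ _ (\int[P]_w cumul k 0%R s w)); first exact: ge0_subset_integral.
  apply: ge0_le_integral => // w _.
  by rewrite (cumul_split mpp E_countable E_discrete i0 e c N q_rates k w s0 sN) leeDl.
have fcnt : \int[P]_(w in A) counting_process Y S (e k) s w \is a fin_num.
  rewrite ge0_fin_numE; last exact: integral_ge0.
  apply: (@le_lt_trans _ _ (\int[P]_w counting_process Y S (e k) N w)); last first.
    exact: eq_ind_r (fun x => x < +oo) cumfin _ (expected_count ck).
  apply: (@le_trans _ _ (\int[P]_w counting_process Y S (e k) s w)).
    exact: ge0_subset_integral.
  by apply: ge0_le_integral => // w _; exact: counting_process_le.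
exact: fin_num_cancel.
Qed.

Let jr_window k (x : R * W) : R :=
  if (0 < x.1 <= N)%R then jr k x else 0%R.

Let jr_window_ge0 k x : (0 <= jr_window k x)%R.
Proof. by rewrite /jr_window; case: ifP => // _; exact: jump_rate_ge0. Qed.

Let measurable_jr_window k : measurable_fun setT (jr_window k).
Proof.
apply: measurable_fun_ifT => //; last exact: measurable_jump_rate_prod.
by apply: measurable_and; [apply: measurable_fun_ltr|apply: measurable_fun_ler].
Qed.

Let jump_weight_ge0 k n w : (0 <= jump_weight k n w)%R.
Proof. by rewrite /jump_weight. Qed.

Let id_pred := measurable_prod_to_predictable Fmeas.

Let jump_measure k n : {measure set (predictable_space F) -> \bar R} :=
  wpush P (jump_weight_ge0 k n) (measurable_jump_weight k n) (measurable_jump_point n).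

Let rate_measure k : {measure set (predictable_space F) -> \bar R} :=
  wpush (mu \x P) (jr_window_ge0 k) (measurable_jr_window k) id_pred.

Let integral_rate k (H : predictable_space F -> \bar R) :
  (forall x, 0 <= H x) -> measurable_fun setT H ->
  \int[mu \x P]_x ((jr_window k x)%:E * H x) =
  \int[P]_w \int[mu]_(r in `]0%R, N]) ((jr k (r, w))%:E * H (r, w)).
Proof.
move=> H0 mH; pose f x := (jr_window k x)%:E * H x.
have mf : measurable_fun setT f.
  apply: emeasurable_funM; last exact: measurable_predictable_prod.
  by apply/measurable_EFinP.
have f0 x : 0 <= f x by rewrite mule_ge0 ?lee_fin.
rewrite (@fubini_tonelli1 _ _ _ _ R mu P f mf f0).
apply: (etrans (@fubini_tonelli _ _ _ _ R mu P f mf f0)); apply: eq_integral => w _.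
rewrite [RHS]integral_mkcond; apply: eq_integral => r _.
rewrite patchE mem_setE in_itv/= /f /jr_window /=; case: ifP => // _.
by rewrite mul0e.
Qed.

(** Both sides integrate [H] against measures on the predictable space: [nu1] charges the jumps and
    [nu2] has the jump rate as density. Their total mass is at most B N and they agree on rays,
    hence they are equal. *)
Lemma predictable_identity k (H : predictable_space F -> \bar R) : c (e k) = k ->
  (forall x, 0 <= H x) -> measurable_fun setT H ->
  \sum_(n <oo) \int[P]_w ((jump_weight k n w)%:E * H (fine (T n w), w)) =
  \int[P]_w \int[mu]_(r in `]0%R, N]) ((jr k (r, w))%:E * H (r, w)).
Proof.
move=> ck H0 mH; rewrite -integral_rate//.
pose nu1 := mseries (jump_measure k) 0; pose nu2 := rate_measure k.
transitivity (\int[nu1]_x H x).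
  rewrite /nu1 ge0_integral_measure_series//; apply: eq_eseriesr => n _.
  by rewrite integral_wpush.
transitivity (\int[nu2]_x H x); last first.
  by rewrite /nu2 /rate_measure integral_wpush.
have mray s A : (0 <= s)%R -> F s A -> @measurable _ (predictable_space F) (`]s, +oo[ `*` A).
  exact: measurable_predictable_ray.
have rayE s A r w : (\1_(`]s, +oo[ `*` A) (r, w) : R) = ((s < r)%R%:R * \1_A w)%R.
  rewrite !indicE -natrM mulnb; congr ((nat_of_bool _)%:R).
  apply/idP/idP => [/set_mem[/=]|/andP[sr /set_mem Aw]].
    by rewrite in_itv/= andbT => -> Aw; rewrite mem_set.
  by apply/mem_set; split => //=; rewrite in_itv/= sr.
(* Beyond the horizon neither measure has mass. *)
have rayN s A : (N < s)%R -> nu1 (`]s, +oo[ `*` A) = nu2 (`]s, +oo[ `*` A).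
  move=> Ns; transitivity (0 : \bar R).
    apply: eseries0 => n _ _; apply: integral0_eq => w _.
    rewrite -EFinM rayE /jump_weight; case: (0 < n)%N => /=; last by rewrite mul0r.
    case TN : (T n w <= N%:E) => /=; last by rewrite mul0r.
    rewrite [(s < _)%R](_ : _ = false) ?mul0r ?mulr0//.
    apply/negbTE; rewrite -leNgt; apply: le_trans (ltW Ns).
    by move: TN (event_time_ge0 mpp n w); case: (T n w) => [r| |] //=; rewrite lee_fin.
  apply/esym; apply: integral0_eq => -[r w] _; rewrite -EFinM rayE /jr_window /=.
  case: ifPn => [/andP[_ rN]|_]; last by rewrite mul0r.
  by rewrite ltNge (le_trans rN (ltW Ns)) /= mul0r mulr0.
have nu2_ray s A : (0 <= s)%R -> (s <= N)%R -> F s A ->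
    nu2 (`]s, +oo[ `*` A) = \int[P]_(w in A) cumul k s N w.
  move=> s0 sN FA; have mA : measurable A by exact: Fmeas FA.
  apply: (etrans (@integral_rate k (fun x => (\1_(`]s, +oo[ `*` A) x)%:E) _ _)).
  - by move=> x; rewrite lee_fin.
  - by apply/measurable_EFinP; apply: measurable_indic; exact: mray.
  rewrite [RHS]integral_mkcond; apply: eq_integral => w _; rewrite patchE.
  case: ifPn => [Aw|nAw]; last first.
    apply: integral0_eq => r _; rewrite rayE indicE (negbTE nAw) mulr0.
    by rewrite mule0.
  transitivity (\int[mu]_(r in `]0%R, N]) (((fun r => (jr k (r, w))%:E) \_ `]s, N]) r)).
    apply: eq_integral => r; rewrite inE/= in_itv/= => /andP[r0 rN].
    rewrite rayE indicE Aw mulr1 patchE mem_setE in_itv/= rN andbT.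
    by case: ifP => _; rewrite ?mule1 ?mule0.
  rewrite -integral_mkcondr; congr (integral _ _ _).
  rewrite setIidr// => r /=; rewrite !in_itv/= => /andP[sr ->].
  by rewrite (le_lt_trans s0 sr).
have nu1_ray s A : (0 <= s)%R -> (s <= N)%R -> F s A ->
    nu1 (`]s, +oo[ `*` A) = \int[P]_(w in A) cumul k s N w.
  move=> s0 sN FA; have mA : measurable A by exact: Fmeas FA.
  rewrite -jump_increment//.
  rewrite [RHS]integral_mkcond.
  transitivity (\int[P]_w \sum_(n <oo) ((jump_weight k n w)%:E *
      (\1_(`]s, +oo[ `*` A) (fine (T n w), w))%:E)).
    rewrite integral_nneseries//.
      move=> n; apply: emeasurable_funM.
        by apply/measurable_EFinP; exact: measurable_jump_weight.
      apply/measurable_EFinP.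
      exact: (measurableT_comp (measurable_indic (mray _ _ s0 FA)) (measurable_jump_point n)).
    by move=> n w _; rewrite mule_ge0 ?lee_fin.
  apply: eq_integral => w _; rewrite patchE.
  case: ifPn => [Aw|nAw]; last first.
    by rewrite eseries0// => n _ _; rewrite -EFinM rayE indicE (negbTE nAw) !mulr0.
  by apply: eq_eseriesr => n _; rewrite -EFinM rayE indicE Aw mulr1.
have FT : F 0%R setT by case: (Fsigma 0%R) => F0 FC _; rewrite -(setD0 setT); exact: FC.
(* [setT] reduces to the ray from 0: event 0 has weight 0, later events occur after time 0, and the
   rate is restricted to positive times. *)
have nu1T : nu1 setT = nu1 (`]0%R, +oo[ `*` setT).
  apply: eq_eseriesr => n _; apply: eq_integral => w _.
  rewrite -!EFinM; congr EFin; rewrite rayE !indicE !in_setT !mulr1 /jump_weight.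
  case: n => [|n]; first by rewrite !mul0r.
  have := event_time_gt0 mpp n w; case: (T n.+1 w) => [r| |] //=.
    by rewrite lte_fin => ->; rewrite mulr1.
  by rewrite !mul0r.
have nu2T : nu2 setT = nu2 (`]0%R, +oo[ `*` setT).
  apply: eq_integral => -[r w] _.
  rewrite -!EFinM; congr EFin; rewrite rayE !indicE !in_setT !mulr1 /jr_window/=.
  by case: (ltP 0%R r) => //= _; rewrite ?mul0r ?mulr1.
have nu_gen A : predictable_rays F A -> nu1 A = nu2 A.
  move=> [->|[s [A' [s0 FA ->]]]].
    exact: etrans nu1T (etrans (etrans (nu1_ray _ _ (lexx 0%R) N0 FT)
      (esym (nu2_ray _ _ (lexx 0%R) N0 FT))) (esym nu2T)).
  have [sN|Ns] := leP s N; last exact: rayN.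
  exact: etrans (nu1_ray _ _ s0 sN FA) (esym (nu2_ray _ _ s0 sN FA)).
have nu1_fin : nu1 setT < +oo.
  apply: eq_ind_r (fun x => x < +oo) _ _ (etrans nu1T (nu1_ray _ _ (lexx 0%R) N0 FT)).
  apply: (@le_lt_trans _ _ (\int[P]_w (cst (B * (N - 0))%:E w))).
    apply: ge0_le_integral => //.
    - by move=> w _; exact: cumul_ge0.
    - exact: (measurable_cumul mpp E_countable E_discrete i0 e c N q_rates k (measurable_cst _) (measurable_cst _)).
    - by move=> w _; exact: cumul_le.
  rewrite integral_cst//; apply: (@le_lt_trans _ _ ((B * (N - 0))%:E * 1)); last by rewrite mule1 ltry.
  by apply: lee_wpmul2l; [rewrite lee_fin mulr_ge0// subr0|exact: probability_le1].
have rays_setI := predictable_rays_setI Fsigma (natural_filtration_mono (Y := Y) (S := S)).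
have raysT (i : nat) : predictable_rays F setT by left.
have cover : \bigcup_(i : nat) setT = [set: predictable_space F].
  by rewrite bigcup_const//; exists 0%N.
apply: eq_measure_integral => A mA _.
exact: (@measure_unique _ _ (predictable_space F) (predictable_rays F) (fun _ => setT)
  erefl rays_setI raysT cover nu1 nu2 nu_gen (fun _ => nu1_fin) A mA).
Qed.

End PredictableIdentity.

(** * Summation over marks and non-explosion *)

Section MarkedIdentity.
Context {R : realType} {d : measure_display} {W : measurableType d}.
Context {dE : measure_display} {E : measurableType dE}.
Variables (P : probability W R) (Y : nat -> W -> E) (S : nat -> W -> \bar R).
Hypothesis mpp : is_mpp Y S.
Hypothesis E_countable : countable [set: E].
Hypothesis E_discrete : forall A : set E, measurable A.
Variables (q : E -> E -> R * R -> R) (i0 : E) (e : nat -> E) (c : E -> nat) (N : R).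
Hypothesis ec : forall i, e (c i) = i.
Hypothesis q_rates : admissible_rates q.
Hypothesis N0 : (0 <= N)%R.
Local Notation T := (event_time S).
Local Notation Z := (mpp_process Y S).
Local Notation F := (natural_filtration Z).
Local Notation mu := (@lebesgue_measure R).
Local Notation qN := (trunc_rate q e c N).
Local Notation jr := (jump_rate Y S q i0 e c N).
Variable (B : R).
Hypothesis B0 : (0 <= B)%R.
Hypothesis qB : forall i x, \sum_(k <oo) (qN i k x)%:E <= B%:E.
Hypothesis comp : forall i, is_compensator P F (counting_process Y S i)
  (integrated_intensity Y S q i).

Definition event_ind n (w : W) : R := ([&& (0 < n)%N & (T n w <= N%:E)%E])%:R.

Lemma measurable_event_ind n : measurable_fun setT (event_ind n).
Proof.
apply: (measurableT_comp (f := fun b : bool => b%:R : R)) => //.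
apply: measurable_and => //; apply: measurable_fun_lee => //.
exact: (measurable_event_time mpp).
Qed.

(** For each counted event exactly one index, [c (Y n w)], has weight 1, so summing over [k] counts
    no event twice even if [e] repeats states. *)
Let mark_weight k n w : R := (event_ind n w * (k == c (Y n w))%:R)%R.

Let mark_weightE k n w : c (e k) = k -> mark_weight k n w = jump_weight Y S e N k n w.
Proof.
move=> ck; rewrite /mark_weight /event_ind /jump_weight -natrM mulnb andbA.
congr ((nat_of_bool (_ && _))%:R); apply/eqP/eqP => [->|->//]; first by rewrite ec.
Qed.

Let mark_weight_invalid k n w : c (e k) <> k -> mark_weight k n w = 0%R.
Proof.
move=> nck; rewrite /mark_weight; case: eqP => [kc|]; last by rewrite mulr0.
by case: nck; rewrite kc ec.
Qed.

Let mark_weight_ge0 k n w : (0 <= mark_weight k n w)%R.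
Proof. by rewrite /mark_weight /event_ind mulr_ge0. Qed.

Let measurable_mark_weight k n : measurable_fun setT (mark_weight k n).
Proof.
apply: measurable_funM; first exact: measurable_event_ind.
apply: (measurableT_comp (f := fun y => (k == c y)%:R : R)); last by case: mpp.
by move=> _ D mD; exact: E_discrete.
Qed.

Lemma jump_rate_invalid k x : c (e k) <> k -> jr k x = 0%R.
Proof.
move=> /eqP/negbTE nck; rewrite /jump_rate /at_left_state; case: ifP => // _.
by rewrite /trunc_rate nck.
Qed.

Lemma mark_identity k (H : predictable_space F -> \bar R) :
  (forall x, 0 <= H x) -> measurable_fun setT H ->
  \sum_(n <oo) \int[P]_w ((mark_weight k n w)%:E * H (fine (T n w), w)) =
  \int[P]_w \int[mu]_(r in `]0%R, N]) ((jr k (r, w))%:E * H (r, w)).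
Proof.
move=> H0 mH; have [ck|nck] := pselect (c (e k) = k).
  apply: etrans (predictable_identity mpp E_countable E_discrete i0 q_rates N0 B0 qB comp ck H0 mH).
  apply: eq_eseriesr => n _; apply: eq_integral => w _; congr (_%:E * _).
  exact: mark_weightE.
transitivity (0 : \bar R).
  apply: eseries0 => n _ _; apply: integral0_eq => w _.
  by rewrite mark_weight_invalid// mul0e.
apply/esym; apply: integral0_eq => w _; apply: integral0_eq => r _.
by rewrite jump_rate_invalid// mul0e.
Qed.

(** Summed over all indices [k]; the ones not of the form [c i] contribute 0 to both sides. *)
Lemma marked_identity (H : E -> predictable_space F -> \bar R) :
  (forall j x, 0 <= H j x) -> (forall j, measurable_fun setT (H j)) ->
  \int[P]_w \sum_(n <oo) ((event_ind n w)%:E * H (Y n w) (fine (T n w), w)) =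
  \int[P]_w \int[mu]_(r in `]0%R, N])
     \sum_(k <oo) ((jr k (r, w))%:E * H (e k) (r, w)).
Proof.
move=> H0 mH.
have t0 k n w : 0 <= (mark_weight k n w)%:E * H (e k) (fine (T n w), w).
  by rewrite mule_ge0 ?lee_fin.
have mt k n : measurable_fun setT
    (fun w => (mark_weight k n w)%:E * H (e k) (fine (T n w), w)).
  apply: emeasurable_funM; first by apply/measurable_EFinP.
  exact: (measurableT_comp (mH (e k)) (measurable_jump_point mpp E_discrete n)).
have j0 k x : 0 <= (jr k x)%:E * H (e k) x.
  by rewrite mule_ge0 ?lee_fin ?jump_rate_ge0.
have mj k : measurable_fun setT (fun x : R * W => (jr k x)%:E * H (e k) x).
  apply: emeasurable_funM; last exact: measurable_predictable_prod.
  by apply/measurable_EFinP; exact: measurable_jump_rate_prod.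
have mjw k w : measurable_fun setT (fun r => (jr k (r, w))%:E * H (e k) (r, w)).
  exact: (measurable_fun_pair1 w (mj k)).
transitivity (\int[P]_w \sum_(n <oo) \sum_(k <oo)
    ((mark_weight k n w)%:E * H (e k) (fine (T n w), w))).
  apply: eq_integral => w _; apply: eq_eseriesr => n _.
  rewrite (nneseriesD1 (n := c (Y n w)))//.
  rewrite eseries0 ?adde0; last first.
    by move=> k _ /= kc; rewrite /mark_weight (negbTE kc) mulr0 mul0e.
  by rewrite /mark_weight eqxx mulr1 ec.
transitivity (\sum_(n <oo) \sum_(k <oo)
    \int[P]_w ((mark_weight k n w)%:E * H (e k) (fine (T n w), w))).
  rewrite integral_nneseries//; last 2 first.
  - by move=> n; apply: ge0_emeasurable_sum.
  - by move=> n w _; apply: nneseries_ge0.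
  by apply: eq_eseriesr => n _; rewrite integral_nneseries.
rewrite nneseries_interchange; last by move=> *; exact: integral_ge0.
transitivity (\sum_(k <oo) \int[P]_w \int[mu]_(r in `]0%R, N]) ((jr k (r, w))%:E * H (e k) (r, w))).
  by apply: eq_eseriesr => k _; exact: mark_identity.
rewrite -integral_nneseries//; last 2 first.
- move=> k; apply: (measurable_integral_itv (a := cst 0%R) (b := cst N)
    (h := fun z : W * R => (jr k (z.2, z.1))%:E * H (e k) (z.2, z.1))) => //.
  exact: (measurableT_comp (mj k) (@measurable_swap _ _ _ _)).
- by move=> k w _; exact: integral_ge0.
apply: eq_integral => w _; rewrite integral_nneseries// => k.
exact: (measurable_funTS (mjw k w)).
Qed.

Lemma expected_events : \int[P]_w \sum_(n <oo) (event_ind n w)%:E <= (B * N)%:E.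
Proof.
have -> : \int[P]_w \sum_(n <oo) (event_ind n w)%:E =
  \int[P]_w \int[mu]_(r in `]0%R, N]) \sum_(k <oo) ((jr k (r, w))%:E * 1).
  rewrite -(marked_identity (H := fun _ _ => 1))//.
  by apply: eq_integral => w _; apply: eq_eseriesr => n _; rewrite mule1.
have mjr k : measurable_fun setT (fun x : R * W => (jr k x)%:E * 1).
  apply: emeasurable_funM => //.
  by apply/measurable_EFinP; exact: measurable_jump_rate_prod.
have msum : measurable_fun setT (fun x : R * W => \sum_(k <oo) ((jr k x)%:E * 1)).
  by apply: ge0_emeasurable_sum => // k x _ _; rewrite mule_ge0 ?lee_fin ?jump_rate_ge0.
have sum0 x : 0 <= \sum_(k <oo) ((jr k x)%:E * 1).
  by apply: nneseries_ge0 => k _ _; rewrite mule_ge0 ?lee_fin ?jump_rate_ge0.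
apply: (@le_trans _ _ (\int[P]_w (cst (B * N)%:E w))).
  apply: ge0_le_integral => //.
  - by move=> w _; exact: integral_ge0.
  - apply: (measurable_integral_itv (a := cst 0%R) (b := cst N)
      (h := fun z : W * R => \sum_(k <oo) ((jr k (z.2, z.1))%:E * 1))) => //.
    exact: (measurableT_comp msum (@measurable_swap _ _ _ _)).
  move=> w _; apply: (@le_trans _ _ (\int[mu]_(r in `]0%R, N]) (cst B%:E r))).
    apply: ge0_le_integral => //.
    - by apply: measurable_funTS; exact: (measurable_fun_pair1 w msum).
    - move=> r _; apply: le_trans (jump_rate_bounded Y S i0 qB B0 (r, w)).
      by rewrite le_eqVlt; apply/orP; left; apply/eqP; apply: eq_eseriesr => k _; rewrite mule1.
  rewrite integral_cst//= lebesgue_measure_itv/= lte_fin.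
  case: ltP => [_|_]; first by rewrite -EFinB subr0 -EFinM.
  by rewrite mule0 lee_fin mulr_ge0.
rewrite integral_cst//; apply: (@le_trans _ _ ((B * N)%:E * 1)); last by rewrite mule1.
by apply: lee_wpmul2l; [rewrite lee_fin mulr_ge0|exact: probability_le1].
Qed.

Lemma no_explosion : {ae P, forall w, exists n, N%:E < T n w}.
Proof.
have msum : measurable_fun setT (fun w => \sum_(n <oo) (event_ind n w)%:E).
  apply: ge0_emeasurable_sum => [n w _ _|n _]; first by rewrite lee_fin /event_ind.
  by apply/measurable_EFinP; exact: measurable_event_ind.
have : P.-integrable setT (fun w => \sum_(n <oo) (event_ind n w)%:E).
  apply/integrableP; split => //; apply: le_lt_trans (ltry (B * N)).
  apply: le_trans expected_events; rewrite le_eqVlt; apply/orP; left; apply/eqP.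
  apply: eq_integral => w _; rewrite gee0_abs//.
  by apply: nneseries_ge0 => n _ _; rewrite lee_fin /event_ind.
move/(integrable_ae measurableT); apply: filterS => w /(_ I) fin.
apply: contrapT => nex.
have Tn n : T n w <= N%:E by rewrite leNgt; apply/negP => Nn; apply: nex; exists n.
have lb m : m%:R%:E <= \sum_(n <oo) (event_ind n w)%:E.
  have ge0 i : (0 <= i)%N -> xpredT i -> 0 <= (event_ind i w)%:E.
    by rewrite lee_fin /event_ind.
  (* Event 0 is not counted, so m + 1 terms are needed to reach m. *)
  apply: le_trans (nneseries_lim_ge m.+1 ge0).
  rewrite big_nat_recl// sumEFin -EFinD lee_fin /event_ind /= add0r.
  under eq_bigr do rewrite Tn /=.
  by rewrite big_mkord sumr_const card_ord.
have := lb (Num.bound (fine (\sum_(n <oo) (event_ind n w)%:E))).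
rewrite -[leRHS](fineK fin) lee_fin leNgt archi_boundP//.
by apply: fine_ge0; apply: nneseries_ge0 => n _ _; rewrite lee_fin /event_ind.
Qed.

End MarkedIdentity.

(** * Telescoping along a path *)

Section Telescoping.
Context {R : realType}.
Local Notation mu := (@lebesgue_measure R).
Variables (Tn : nat -> \bar R) (alpha : nat -> R -> \bar R) (q1 q2 : R -> \bar R).
Variables a v : R.
Hypothesis Tn_ge0 : forall n, 0 <= Tn n.
Hypothesis Tn_le : forall m n, (m <= n)%N -> Tn m <= Tn n.
Hypothesis q10 : forall r, 0 <= q1 r.
Hypothesis q20 : forall r, 0 <= q2 r.
Hypothesis mq1 : measurable_fun setT q1.
Hypothesis mq2 : measurable_fun setT q2.
Hypothesis flow : forall n s b, Tn n <= s%:E -> (s <= b)%R -> b%:E <= Tn n.+1 ->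
  (b <= v)%R ->
  alpha n s + \int[mu]_(r in `]s, b]) q2 r = alpha n b + \int[mu]_(r in `]s, b]) q1 r.
Variable n0 : nat.
Hypothesis n0a : Tn n0 <= a%:E < Tn n0.+1.

Let jumps_in (h : nat -> R -> \bar R) n : \bar R :=
  \sum_(m < n) (a%:E < Tn m.+1)%E%:R%:E * h m (fine (Tn m.+1)).

Let rearrange (x' y s1 s2 i1 i2 j1 j2 z z' : \bar R) :
  z + s2 + i1 = y + s1 + i2 -> z' + j2 = x' + j1 ->
  x' + (s2 + z) + (i1 + j1) = y + (s1 + z') + (i2 + j2).
Proof.
move=> h1 h2; transitivity ((x' + j1) + (z + s2 + i1)).
  by rewrite (AC (1*2*2)%AC ((1*5)*(3*2*4))%AC).
by rewrite -h2 h1 (AC (2*3)%AC (3*(4*1)*(5*2))%AC).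
Qed.

(** Induction on the number [j] of events after [n0]: [flow] is applied between events, and at the
    event T_(m+1) the value [alpha m] just before is exchanged for [alpha m.+1]. The indicator of a
    < T_(m+1) removes the events up to [a]. *)
Lemma telescope_flow j b : let n := (n0 + j)%N in
  Tn n <= b%:E -> (a <= b)%R -> b%:E <= Tn n.+1 -> (b <= v)%R ->
  alpha n b + jumps_in alpha n + \int[mu]_(r in `]a, b]) q1 r =
  alpha n0 a + jumps_in (fun m => alpha m.+1) n + \int[mu]_(r in `]a, b]) q2 r.
Proof.
case/andP: n0a => n0a1 n0a2 /=.
elim: j b => [|j IH] b; rewrite ?addn0 ?addnS.
  move=> Tb ab bT bv.
  have z h : jumps_in h n0 = 0.
    apply: big1 => -[m mn] _ /=.
    by rewrite ltNge (le_trans (Tn_le mn) n0a1) /= mul0e.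
  suff aux (x y k l : \bar R) : y + l = x + k -> x + 0 + k = y + 0 + l.
    by rewrite !z; apply: aux; apply: flow.
  by rewrite !adde0.
set n := (n0 + j)%N => Tb ab bT bv.
have Tfin : Tn n.+1 \is a fin_num.
  by rewrite ge0_fin_numE//; apply: le_lt_trans Tb (ltry _).
have aT : a%:E < Tn n.+1 by apply: lt_le_trans n0a2 (Tn_le _); rewrite ltnS leq_addr.
pose T' := fine (Tn n.+1).
have TE : T'%:E = Tn n.+1 by rewrite fineK.
have aT' : (a <= T')%R by rewrite -lee_fin TE ltW.
have Tb' : (T' <= b)%R by rewrite -lee_fin TE.
have h1 : alpha n T' + jumps_in alpha n + \int[mu]_(r in `]a, T']) q1 r =
    alpha n0 a + jumps_in (fun m => alpha m.+1) n + \int[mu]_(r in `]a, T']) q2 r.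
  by apply: IH; rewrite ?TE ?Tn_le//; exact: le_trans bv.
have h2 : alpha n.+1 T' + \int[mu]_(r in `]T', b]) q2 r =
    alpha n.+1 b + \int[mu]_(r in `]T', b]) q1 r.
  by apply: flow; rewrite ?TE.
have := rearrange h1 h2.
rewrite -(ge0_integral_itv_split aT' Tb'); [|exact: measurable_funTS|by []].
rewrite -(ge0_integral_itv_split aT' Tb'); [|exact: measurable_funTS|by []].
by rewrite /jumps_in !big_ord_recr /= aT !mul1e.
Qed.

End Telescoping.

(** * The value function along a path *)

Section PathIdentity.
Context {R : realType} {d : measure_display} {W : measurableType d}.
Context {dE : measure_display} {E : measurableType dE}.
Variables (Y : nat -> W -> E) (S : nat -> W -> \bar R).
Hypothesis mpp : is_mpp Y S.
Hypothesis E_countable : countable [set: E].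
Hypothesis E_discrete : forall A : set E, measurable A.
Variables (q : E -> E -> R * R -> R) (i0 : E) (e : nat -> E) (c : E -> nat) (N : R).
Hypothesis ec : forall i, e (c i) = i.
Hypothesis q_rates : admissible_rates q.
Hypothesis N0 : (0 <= N)%R.
Local Notation T := (event_time S).
Local Notation Z := (mpp_process Y S).
Local Notation U := (duration Y S).
Local Notation F := (natural_filtration Z).
Local Notation mu := (@lebesgue_measure R).
Local Notation qN := (trunc_rate q e c N).
Local Notation jr := (jump_rate Y S q i0 e c N).
Variable (B : R).
Hypothesis qB : forall i x, \sum_(k <oo) (qN i k x)%:E <= B%:E.
Variable f : E -> R -> \bar R.
Hypothesis f0 : forall j u, 0 <= f j u.
Hypothesis f1 : forall j u, f j u <= 1.
Hypothesis mf : forall j, measurable_fun setT (f j).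
Local Notation g := (uni_val qN e B f).

Let qN0 := trunc_rate_ge0 e c N q_rates.
Let mqN := measurable_trunc_rate e c N q_rates.

Let g0 j x : 0 <= g j x.
Proof. exact: uni_val_ge0. Qed.

Let mg j : measurable_fun setT (g j).
Proof. exact: measurable_uni_val. Qed.

(** State, time and duration just before the given time. The time is carried along because the bare
    time coordinate is not measurable on the predictable space. *)
Definition left_point : R * W -> E * (R * R) :=
  at_left_state Y S i0 (fun j y => (j, y)) (i0, (0, 0)%R).

Lemma left_pointE n r w : T n w < r%:E <= T n.+1 w ->
  left_point (r, w) = (Y n w, (r, r - fine (T n w)))%R.
Proof.
move=> /andP[Tr rT]; have lvE : last_visit Y S (Y n w) r w = fine (T n w).
  by apply: last_visit_eq => //; rewrite ltW.
have Tfin : T n w \is a fin_num.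
  by rewrite ge0_fin_numE ?(event_time_ge0 mpp)//; apply: lt_trans Tr (ltry _).
have ljr : (last_visit Y S (Y n w) r w < r)%R.
  by rewrite lvE -lte_fin fineK.
by rewrite /left_point (at_left_stateE i0 _ _ ljr) lvE.
Qed.

Lemma jump_rateE k n r w : T n w < r%:E <= T n.+1 w ->
  jr k (r, w) = qN (Y n w) k (r, r - fine (T n w))%R.
Proof.
move=> /andP[Tr rT]; have lvE : last_visit Y S (Y n w) r w = fine (T n w).
  by apply: last_visit_eq => //; rewrite ltW.
have Tfin : T n w \is a fin_num.
  by rewrite ge0_fin_numE ?(event_time_ge0 mpp)//; apply: lt_trans Tr (ltry _).
have ljr : (last_visit Y S (Y n w) r w < r)%R.
  by rewrite lvE -lte_fin fineK.
by rewrite /jump_rate (at_left_stateE i0 _ _ ljr) lvE.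
Qed.

Lemma measurable_left_point :
  measurable_fun setT (left_point : predictable_space F -> (E * (R * R))%type).
Proof.
apply: measurable_at_left_state => // j.
by apply: measurable_fun_pair.
Qed.

(** Value right after a jump into [j] at time [r]; [stay_value] is the value right before. Their
    difference is the jump of g along the path. *)
Definition jump_value v (j : E) (r : R) : \bar R := g j (v, r, 0%R).
Definition stay_value v (x : R * W) : \bar R :=
  let l := left_point x in g l.1 (v, l.2.1, l.2.2).

Lemma measurable_jump_value_of d' (V : measurableType d') (v r : V -> R) j :
  measurable_fun setT v -> measurable_fun setT r ->
  measurable_fun setT (fun x => jump_value (v x) j (r x)).
Proof.
move=> mv mr; apply: (measurableT_comp (mg j)); apply: measurable_fun_pair => //.
exact: measurable_fun_pair.
Qed.

Lemma measurable_stay_value_of d' (V : measurableType d') (v : V -> R)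
    (l : V -> (E * (R * R))%type) :
  measurable_fun setT v -> measurable_fun setT l ->
  measurable_fun setT (fun x => g (l x).1 (v x, (l x).2.1, (l x).2.2)).
Proof.
move=> mv ml; apply: (@measurable_fun_countable_case _ _ _ V (\bar R) E (fun x => (l x).1)
   (fun j x => g j (v x, (l x).2.1, (l x).2.2))) => //.
  exact: measurableT_comp.
move=> j; apply: (measurableT_comp (mg j)).
have ml2 : measurable_fun setT (fun x => (l x).2) by exact: measurableT_comp.
apply: measurable_fun_pair; last exact: measurableT_comp.
apply: measurable_fun_pair => //; exact: measurableT_comp.
Qed.

Section OnePath.
Variables (w : W) (a v : R).
Hypothesis a0 : (0 <= a)%R.
Hypothesis av : (a <= v)%R.
Hypothesis vN : (v <= N)%R.
Hypothesis noexp : exists n, N%:E < T n w.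

Let q1 r : \bar R := \sum_(k <oo) ((jr k (r, w))%:E * jump_value v (e k) r).
Let q2 r : \bar R := \sum_(k <oo) ((jr k (r, w))%:E * stay_value v (r, w)).
Let alpha n s : \bar R := g (Y n w) (v, s, s - fine (T n w))%R.

Let mjrw k : measurable_fun setT (fun r => (jr k (r, w))%:E).
Proof.
apply/measurable_EFinP; apply: (measurable_fun_pair1 w).
exact: measurable_jump_rate_prod.
Qed.

Let t10 k r : 0 <= (jr k (r, w))%:E * jump_value v (e k) r.
Proof. by apply: mule_ge0; rewrite ?lee_fin ?jump_rate_ge0// /jump_value. Qed.

Let t20 k r : 0 <= (jr k (r, w))%:E * stay_value v (r, w).
Proof. by apply: mule_ge0; rewrite ?lee_fin ?jump_rate_ge0// /stay_value. Qed.

Let mq1 : measurable_fun setT q1.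
Proof.
apply: ge0_emeasurable_sum => // k _; apply: emeasurable_funM => //.
exact: measurable_jump_value_of.
Qed.

Let mq2 : measurable_fun setT q2.
Proof.
apply: ge0_emeasurable_sum => // k _; apply: emeasurable_funM => //.
apply: (@measurable_stay_value_of _ _ (cst v) (fun r => left_point (r, w))) => //.
apply: (measurable_fun_pair1 w).
exact: measurable_predictable_prod measurable_left_point.
Qed.

Let flow n s b : T n w <= s%:E -> (s <= b)%R -> b%:E <= T n.+1 w -> (b <= v)%R ->
  alpha n s + \int[mu]_(r in `]s, b]) q2 r = alpha n b + \int[mu]_(r in `]s, b]) q1 r.
Proof.
move=> Ts sb bT bv.
have Tfin : T n w \is a fin_num.
  by rewrite ge0_fin_numE ?(event_time_ge0 mpp)//; apply: le_lt_trans Ts (ltry _).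
have shift r : (s - fine (T n w) + (r - s) = r - fine (T n w))%R by ring.
have in_n r : (s < r)%R -> (r <= b)%R -> T n w < r%:E <= T n.+1 w.
  move=> sr rb; apply/andP; split; first by apply: le_lt_trans Ts _; rewrite lte_fin.
  by apply: le_trans bT; rewrite lee_fin.
have H := uni_val_flow e qN0 mqN qB (Y n w) (s - fine (T n w))%R f0 f1 mf sb bv.
rewrite shift in H.
apply: etrans (etrans _ H) _.
- suff -> : \int[mu]_(r in `]s, b]) q2 r = \int[mu]_(r in `]s, b])
     ((exit qN (Y n w) (r, s - fine (T n w) + (r - s))%R)%:E *
       g (Y n w) (v, r, s - fine (T n w) + (r - s))%R) by [].
  apply: eq_integral => r; rewrite inE/= in_itv/= => /andP[sr rb].
  have rn := in_n r sr rb.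
  rewrite /q2 shift /stay_value (left_pointE rn) /=.
  have gfin : g (Y n w) (v, r, r - fine (T n w))%R \is a fin_num.
    rewrite ge0_fin_numE//; apply: le_lt_trans (ltry 1).
    by apply: uni_val_le1 => //; exact: le_trans bv.
  rewrite -(fineK gfin) muleC (exitE qN0 qB).
  under eq_eseriesr do rewrite (jump_rateE _ rn) muleC.
  by rewrite nneseriesZl// => k _; rewrite lee_fin.
- suff -> : \int[mu]_(r in `]s, b]) q1 r = \int[mu]_(r in `]s, b])
    \sum_(k <oo) ((qN (Y n w) k (r, s - fine (T n w) + (r - s))%R)%:E *
       g (e k) (v, r, 0%R)) by [].
  apply: eq_integral => r; rewrite inE/= in_itv/= => /andP[sr rb].
  apply: eq_eseriesr => k _; rewrite shift.
  by rewrite (jump_rateE k (in_n r sr rb)).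
Qed.

Let window r := (a < r <= v)%R.

(** Only the events 1, ..., n1 can lie in ]a, v]; the shift from n to m.+1 drops event 0. *)
Let event_sum n1 (h : nat -> R -> \bar R) : (forall n r, 0 <= h n r) ->
  T n1 w <= v%:E < T n1.+1 w ->
  \sum_(n <oo) ((event_ind S N n w)%:E *
     (if window (fine (T n w)) then h n (fine (T n w)) else 0)) =
  \sum_(m < n1) ((a%:E < T m.+1 w)%E%:R%:E * h m.+1 (fine (T m.+1 w))).
Proof.
move=> h0 /andP[Tv vT].
rewrite (nneseries_split 0 n1.+1); last first.
  by move=> k _; apply: mule_ge0; [rewrite lee_fin /event_ind|case: ifP].
rewrite add0n [X in _ + X]eseries0 ?adde0; last first.
  move=> k nk _; rewrite /event_ind; case: andP => [[_ TN]|_]; last by rewrite mul0e.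
  have Tfin : T k w \is a fin_num.
    by rewrite ge0_fin_numE ?(event_time_ge0 mpp)//; apply: le_lt_trans TN (ltry _).
  rewrite /window -[(_ <= v)%R]lee_fin fineK// leNgt.
  by rewrite (lt_le_trans vT (event_time_le mpp _ nk)) andbF mule0.
rewrite big_nat_recl// /event_ind /= mul0e add0e big_mkord.
apply: eq_bigr => -[m mn] _ /=.
have Tmv : T m.+1 w <= v%:E by apply: le_trans Tv; exact: (event_time_le mpp).
have Tfin : T m.+1 w \is a fin_num.
  by rewrite ge0_fin_numE ?(event_time_ge0 mpp)//; apply: le_lt_trans Tmv (ltry _).
rewrite (le_trans Tmv) ?lee_fin// mul1e /window -lte_fin -[(_ <= v)%R]lee_fin fineK//.
by rewrite Tmv andbT; case: (_ < _); rewrite ?mul1e ?mul0e.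
Qed.

Let window_integral (t h : nat -> R -> \bar R) :
  \int[mu]_(r in `]0%R, N]) \sum_(k <oo) (t k r * (if window r then h k r else 0)) =
  \int[mu]_(r in `]a, v]) \sum_(k <oo) (t k r * h k r).
Proof.
rewrite [LHS]integral_mkcond [RHS]integral_mkcond.
apply: eq_integral => r _; rewrite /patch !mem_setE/= !in_itv/= /window.
case: ifPn => [/andP[r0 rN]|r0N].
  case: ifP => // _; apply: eseries0 => k _ _; exact: mule0.
case: ifPn => // /andP[ar rv]; case/negP: r0N.
by rewrite (le_lt_trans a0 ar) (le_trans rv vN).
Qed.

Let path_rearrange (x y s1 s2 i1 i2 z z' t1 t2 k1 k2 : \bar R) :
  x + s1 + i1 = y + s2 + i2 -> x = z -> y = z' -> s1 = t1 -> s2 = t2 ->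
  i1 = k1 -> i2 = k2 -> z + t1 + k1 = z' + t2 + k2.
Proof. by move=> + <- <- <- <- <- <-. Qed.

(** Telescoping with [alpha n] the value in state [Y n]; at time [v] the value is the payoff.
    Without explosion before [N], both [a] and [v] lie between two events. The sums and integrals
    over ]a, v] are written over ]0, N] with a window, the form in which the compensator formula
    applies. *)
Lemma path_identity :
  f (Z v w) (U v w) +
  \sum_(n <oo) ((event_ind S N n w)%:E *
    (if (a < fine (T n w) <= v)%R then stay_value v (fine (T n w), w) else 0)) +
  \int[mu]_(r in `]0%R, N]) \sum_(k <oo)
    ((jr k (r, w))%:E * (if (a < r <= v)%R then jump_value v (e k) r else 0)) =
  g (Z a w) (v, a, U a w) +
  \sum_(n <oo) ((event_ind S N n w)%:E *
    (if (a < fine (T n w) <= v)%R then jump_value v (Y n w) (fine (T n w)) else 0)) +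
  \int[mu]_(r in `]0%R, N]) \sum_(k <oo)
    ((jr k (r, w))%:E * (if (a < r <= v)%R then stay_value v (r, w) else 0)).
Proof.
have v0 : (0 <= v)%R by exact: le_trans av.
have [M NM] := noexp.
have loc t : (0 <= t)%R -> (t <= N)%R -> exists n, T n w <= t%:E < T n.+1 w.
  move=> t0 tN; have [//|beyond] := event_interval_or mpp w t0.
  have := lt_le_trans NM (beyond M); rewrite lte_fin ltNge.
  by rewrite tN.
have [n0 n0a] := loc a a0 (le_trans av vN).
have [n1 n1v] := loc v v0 vN.
have n01 : (n0 <= n1)%N.
  rewrite leqNgt; apply/negP => n10.
  case/andP: n0a => n0a _; case/andP: n1v => _ vn1.
  have := lt_le_trans vn1 (le_trans (event_time_le mpp w n10) n0a).
  by rewrite lte_fin ltNge av.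
have Ustate n t : (0 <= t)%R -> T n w <= t%:E < T n.+1 w ->
    Z t w = Y n w /\ U t w = (t - fine (T n w))%R.
  move=> t0 nt; have Zt : Z t w = Y n w by exact: (mpp_processE mpp).
  split=> //; rewrite durationE Zt (last_visit_eq mpp)//.
  by case/andP: nt => -> /ltW.
have [j n1E] : exists j, (n0 + j)%N = n1 by exists (n1 - n0)%N; rewrite subnKC.
subst n1.
have stay0 (n : nat) r : 0 <= stay_value v (r, w) by exact: g0.
have jump0 n r : 0 <= jump_value v (Y n w) r by exact: g0.
have [Za Ua] := Ustate _ _ a0 n0a.
have [Zv Uv] := Ustate _ _ v0 n1v.
case/andP: (n1v) => n1v1 n1v2.
have tel := @telescope_flow R (fun n => T n w) alpha q1 q2 a v
  ((event_time_ge0 mpp) ^~ w) (fun m n => @event_time_le _ _ _ _ _ _ _ mpp m n w)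
  (fun r => nneseries_ge0 (fun k _ _ => t10 k r))
  (fun r => nneseries_ge0 (fun k _ _ => t20 k r)) mq1 mq2 flow n0 n0a j v.
apply: (path_rearrange (tel n1v1 av (ltW n1v2) (lexx v))); clear tel.
- by rewrite /alpha Zv Uv uni_val_terminal.
- by rewrite /alpha Za Ua.
- refine (esym (etrans (event_sum stay0 n1v) _)).
  apply: eq_bigr => -[m mn] _ /=; case: (boolP (a%:E < T m.+1 w)) => am; last by rewrite !mul0e.
  have Tmv : T m.+1 w <= v%:E by apply: le_trans n1v1; exact: (event_time_le mpp).
  have Tfin : T m.+1 w \is a fin_num.
    by rewrite ge0_fin_numE ?(event_time_ge0 mpp)//; apply: le_lt_trans Tmv (ltry _).
  have Tm : T m w < (fine (T m.+1 w))%:E <= T m.+1 w.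
    rewrite fineK// lexx andbT; apply: (event_time_ltS mpp).
    by apply: le_lt_trans (event_time_leS mpp m w) _; rewrite -ge0_fin_numE ?(event_time_ge0 mpp).
  by rewrite /stay_value (left_pointE Tm).
- refine (esym (etrans (event_sum jump0 n1v) _)).
  apply: eq_bigr => -[m mn] _ /=; case: (boolP (a%:E < T m.+1 w)) => am; last by rewrite !mul0e.
  by rewrite /alpha /jump_value subrr.
- exact/esym/(window_integral (fun k r => (jr k (r, w))%:E) (fun k r => jump_value v (e k) r)).
- exact/esym/(window_integral (fun k r => (jr k (r, w))%:E) (fun k r => stay_value v (r, w))).
Qed.


End OnePath.
End PathIdentity.

(** * Strong Markov property *)

Section IntegralCancellation.
Context {R : realType} {d : measure_display} {W : measurableType d}.
Variable P : {measure set W -> \bar R}.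

(** After [i1] and [i2] are exchanged for [s1] and [s2] under the integral, both sides contain the
    same two finite terms. *)
Lemma integral_cancel (x y s1 s2 i1 i2 : W -> \bar R) (M : R) :
  (forall w, 0 <= x w) -> (forall w, 0 <= y w) ->
  (forall w, 0 <= s1 w) -> (forall w, 0 <= s2 w) ->
  (forall w, 0 <= i1 w) -> (forall w, 0 <= i2 w) ->
  measurable_fun setT x -> measurable_fun setT y ->
  measurable_fun setT s1 -> measurable_fun setT s2 ->
  measurable_fun setT i1 -> measurable_fun setT i2 ->
  \int[P]_w s1 w = \int[P]_w i1 w -> \int[P]_w s2 w = \int[P]_w i2 w ->
  \int[P]_w s1 w <= M%:E -> \int[P]_w s2 w <= M%:E ->
  {ae P, forall w, x w + s2 w + i1 w = y w + s1 w + i2 w} ->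
  \int[P]_w x w = \int[P]_w y w.
Proof.
move=> x0 y0 s10 s20 i10 i20 mx my ms1 ms2 mi1 mi2 e1 e2 f1 f2 id.
have add3 (a b c : W -> \bar R) : (forall w, 0 <= a w) -> (forall w, 0 <= b w) ->
    (forall w, 0 <= c w) -> measurable_fun setT a -> measurable_fun setT b ->
    measurable_fun setT c ->
    \int[P]_w (a w + b w + c w) = \int[P]_w a w + \int[P]_w b w + \int[P]_w c w.
  move=> a0 b0 c0 ma mb mc; rewrite ge0_integralD//; last 2 first.
  - by move=> w _; rewrite adde_ge0.
  - exact: emeasurable_funD.
  by rewrite ge0_integralD.
have : \int[P]_w (x w + s2 w + i1 w) = \int[P]_w (y w + s1 w + i2 w).
  apply: ge0_ae_eq_integral => //.
  - by do 2 apply: emeasurable_funD => //.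
  - by do 2 apply: emeasurable_funD => //.
  - by move=> w _; rewrite !adde_ge0.
  - by move=> w _; rewrite !adde_ge0.
  - by apply: filterS id => w H _.
rewrite add3// add3// -e1 -e2.
have fin (s : W -> \bar R) : (forall w, 0 <= s w) -> \int[P]_w s w <= M%:E ->
    \int[P]_w s w \is a fin_num.
  move=> s0 sM; rewrite ge0_fin_numE; last by apply: integral_ge0 => w _; exact: s0.
  exact: le_lt_trans sM (ltry _).
have aux (a b c c' : \bar R) : b \is a fin_num -> c \is a fin_num ->
    a + b + c = c' + c + b -> a = c'.
  move=> bf cf H; apply: (fin_num_cancel bf cf).
  by rewrite (addeC b a) H addeC (addeC c').
exact: (aux _ _ _ _ (fin _ s20 f2) (fin _ s10 f1)).
Qed.

End IntegralCancellation.

(** * Mean payoff after a stopping time, below a fixed horizon *)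

Section StoppedIdentity.
Context {R : realType} {d : measure_display} {W : measurableType d}.
Context {dE : measure_display} {E : measurableType dE}.
Variables (P : probability W R) (Y : nat -> W -> E) (S : nat -> W -> \bar R).
Hypothesis mpp : is_mpp Y S.
Hypothesis E_countable : countable [set: E].
Hypothesis E_discrete : forall A : set E, measurable A.
Variables (q : E -> E -> R * R -> R) (i0 : E) (e : nat -> E) (c : E -> nat) (N : R).
Hypothesis ec : forall i, e (c i) = i.
Hypothesis q_rates : admissible_rates q.
Hypothesis N0 : (0 <= N)%R.
Local Notation T := (event_time S).
Local Notation Z := (mpp_process Y S).
Local Notation U := (duration Y S).
Local Notation F := (natural_filtration Z).
Local Notation mu := (@lebesgue_measure R).
Local Notation qN := (trunc_rate q e c N).
Local Notation jr := (jump_rate Y S q i0 e c N).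
Variable (B : R).
Hypothesis B0 : (0 <= B)%R.
Hypothesis qB : forall i x, \sum_(k <oo) (qN i k x)%:E <= B%:E.
Hypothesis comp : forall i, is_compensator P F (counting_process Y S i)
  (integrated_intensity Y S q i).
Variable f : E -> R -> \bar R.
Hypothesis f0 : forall j u, 0 <= f j u.
Hypothesis f1 : forall j u, f j u <= 1.
Hypothesis mf : forall j, measurable_fun setT (f j).
Local Notation g := (uni_val qN e B f).
Variables (tau : W -> \bar R) (t : R) (A : set W).
Hypothesis tau_stop : stopping_time F tau.
Hypothesis t0 : (0 <= t)%R.
Hypothesis FA : stopped_sigma_algebra F tau A.
Hypothesis AN : forall w, A w -> tau w + t%:E <= N%:E.

Let qN0 := trunc_rate_ge0 e c N q_rates.
Let mqN := measurable_trunc_rate e c N q_rates.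
Let Fsigma := natural_filtration_sigma Y S.
Let Fmono := @natural_filtration_mono _ _ _ _ _ Y S.
Let Fmeas := natural_filtration_measurable mpp E_discrete.

Let g0 j x : 0 <= g j x.
Proof. exact: uni_val_ge0. Qed.

(** Equals [tau] where [A] has occurred and [tau] has passed, and -1 elsewhere; nonnegativity
    therefore tests for the predictable set to the right of [tau] on [A]. *)
Let start (x : predictable_space F) : R :=
  if (x.2 \in A) && (tau x.2 < x.1%:E) then fine (tau x.2) else (-1)%R.
Let clock (x : predictable_space F) : R := Num.max 0%R x.1.
Let window x := (0 <= start x)%R && (clock x <= start x + t)%R.

(** The terminal time tau + t is random, but expressed through [start] it is predictable on the
    window ]tau, tau + t], so that g with this terminal time is an admissible integrand. *)
Let jump_gain (j : E) x : \bar R :=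
  if window x then jump_value q e c N B f (start x + t) j (clock x) else 0.
Let stay_gain x : \bar R :=
  if window x then stay_value Y S q i0 e c N B f (start x + t) x else 0.

Let measurable_window : measurable_fun setT window.
Proof.
have ms : measurable_fun setT start by exact: measurable_predictable_after.
have mc : measurable_fun setT clock by exact: measurable_predictable_time.
apply: measurable_and; first exact: measurable_fun_ler.
by apply: measurable_fun_ler => //; exact: measurable_funD.
Qed.

Let mg j : measurable_fun setT (g j).
Proof. exact: measurable_uni_val. Qed.

Let measurable_jump_gain j : measurable_fun setT (jump_gain j).
Proof.
have ms : measurable_fun setT start by exact: measurable_predictable_after.
have mc : measurable_fun setT clock by exact: measurable_predictable_time.
apply: measurable_fun_ifT => //.
by apply: measurable_jump_value_of => //; exact: measurable_funD.
Qed.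

Let measurable_stay_gain : measurable_fun setT stay_gain.
Proof.
have ms : measurable_fun setT start by exact: measurable_predictable_after.
apply: measurable_fun_ifT => //.
apply: measurable_stay_value_of => //; first exact: measurable_funD.
exact: measurable_left_point.
Qed.

Let jump_gain_ge0 j x : 0 <= jump_gain j x.
Proof. by rewrite /jump_gain; case: ifP => // _; exact: g0. Qed.

Let stay_gain_ge0 x : 0 <= stay_gain x.
Proof. by rewrite /stay_gain; case: ifP => // _; exact: g0. Qed.

Let window_clock x : window x ->
  [/\ x.2 \in A, clock x = x.1, start x = fine (tau x.2) & (clock x <= start x + t)%R].
Proof.
rewrite /window /start; case: ifPn => [/andP[xA tx] /andP[_ w]|_].
  split => //; rewrite /clock max_r// -lee_fin ltW//.
  exact: le_lt_trans (tau_stop.1 _) tx.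
by move=> /andP[]; rewrite ler0N1.
Qed.

Let left_point_time x : (left_point Y S i0 x).2.1 = x.1 \/ (left_point Y S i0 x).2.1 = 0%R.
Proof. by rewrite /left_point /at_left_state; case: ifP; [left|right]. Qed.

Let jump_gain_le1 j x : jump_gain j x <= 1.
Proof.
rewrite /jump_gain; case: ifPn => // /window_clock[_ _ _ w].
exact: uni_val_le1.
Qed.

Let stay_gain_le1 x : stay_gain x <= 1.
Proof.
rewrite /stay_gain; case: ifPn => // /window_clock[_ cx _ w].
apply: uni_val_le1 => //; case: (left_point_time x) => ->; first by rewrite -cx.
by apply: le_trans w; rewrite /clock le_max lexx.
Qed.

Let tau_fin w : A w -> tau w \is a fin_num.
Proof.
move=> Aw; rewrite ge0_fin_numE; last exact: tau_stop.1.
apply: le_lt_trans (ltry N); apply: le_trans (AN Aw).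
by rewrite leeDl// lee_fin.
Qed.

Let tau_ge0 w : (0 <= fine (tau w))%R.
Proof. exact/fine_ge0/tau_stop.1. Qed.

Let windowE r w : (0 <= r)%R ->
  window (r, w) = (w \in A) && (fine (tau w) < r <= fine (tau w) + t)%R.
Proof.
move=> r0; rewrite /window /start /clock /= max_r//.
case: (boolP (w \in A)) => [/set_mem Aw|]; last by rewrite ler0N1.
have -> : (tau w < r%:E) = (fine (tau w) < r)%R by rewrite -lte_fin fineK// tau_fin.
by case: (boolP (fine (tau w) < r)%R) => _ /=; rewrite ?tau_ge0 ?ler0N1.
Qed.

Let jump_gainE j r w : A w -> (0 <= r)%R -> jump_gain j (r, w) =
  if (fine (tau w) < r <= fine (tau w) + t)%R
  then jump_value q e c N B f (fine (tau w) + t) j r else 0.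
Proof.
move=> Aw r0; have wE := windowE w r0; rewrite mem_set//= in wE.
rewrite /jump_gain wE; case: ifPn => // h.
have win : window (r, w) by rewrite wE.
by have [_ -> -> _] := window_clock win.
Qed.

Let stay_gainE r w : A w -> (0 <= r)%R -> stay_gain (r, w) =
  if (fine (tau w) < r <= fine (tau w) + t)%R
  then stay_value Y S q i0 e c N B f (fine (tau w) + t) (r, w) else 0.
Proof.
move=> Aw r0; have wE := windowE w r0; rewrite mem_set//= in wE.
rewrite /stay_gain wE; case: ifPn => // h.
have win : window (r, w) by rewrite wE.
by have [_ _ -> _] := window_clock win.
Qed.

Let gain_out j r w : ~ A w -> (0 <= r)%R -> jump_gain j (r, w) = 0 /\ stay_gain (r, w) = 0.
Proof.
move=> nA r0; have wA : (w \in A) = false by apply/negbTE/negP => /set_mem.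
by rewrite /jump_gain /stay_gain windowE// wA.
Qed.

Let event_sum (H : E -> predictable_space F -> \bar R) w :=
  \sum_(n <oo) ((event_ind S N n w)%:E * H (Y n w) (fine (T n w), w)).
Let rate_integral (H : E -> predictable_space F -> \bar R) w :=
  \int[mu]_(r in `]0%R, N]) \sum_(k <oo) ((jr k (r, w))%:E * H (e k) (r, w)).

Let event_sum_ge0 H w : (forall j x, 0 <= H j x) -> 0 <= event_sum H w.
Proof.
move=> H0; apply: nneseries_ge0 => n _ _; apply: mule_ge0 => //.
by rewrite lee_fin /event_ind.
Qed.

Let rate_integral_ge0 H w : (forall j x, 0 <= H j x) -> 0 <= rate_integral H w.
Proof.
move=> H0; apply: integral_ge0 => r _; apply: nneseries_ge0 => k _ _.
by apply: mule_ge0 => //; rewrite lee_fin jump_rate_ge0.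
Qed.

Let measurable_event_sum H : (forall j x, 0 <= H j x) ->
  (forall j, measurable_fun setT (H j)) -> measurable_fun setT (event_sum H).
Proof.
move=> H0 mH; apply: ge0_emeasurable_sum => [n w _ _|n _].
  by apply: mule_ge0 => //; rewrite lee_fin /event_ind.
apply: emeasurable_funM; first by apply/measurable_EFinP; exact: (measurable_event_ind mpp).
apply: (@measurable_fun_countable_case _ _ _ W (\bar R) E (Y n)
  (fun j w => H j (fine (T n w), w))) => //; first by case: mpp.
by move=> j; exact: (measurableT_comp (mH j) (measurable_jump_point mpp E_discrete n)).
Qed.

Let measurable_rate_integral H : (forall j x, 0 <= H j x) ->
  (forall j, measurable_fun setT (H j)) -> measurable_fun setT (rate_integral H).
Proof.
move=> H0 mH; apply: (measurable_integral_itv (a := cst 0%R) (b := cst N)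
      (h := fun z : W * R => \sum_(k <oo) ((jr k (z.2, z.1))%:E * H (e k) (z.2, z.1)))) => //.
  apply: ge0_emeasurable_sum => [k z _ _|k _].
    by apply: mule_ge0 => //; rewrite lee_fin jump_rate_ge0.
  apply: (measurableT_comp (f := fun x : R * W => (jr k x)%:E * H (e k) x)
     (g := fun z : W * R => (z.2, z.1))); last exact: measurable_swap.
  apply: emeasurable_funM; last exact: measurable_predictable_prod.
  by apply/measurable_EFinP; exact: measurable_jump_rate_prod.
move=> z; apply: nneseries_ge0 => k _ _.
by apply: mule_ge0 => //; rewrite lee_fin jump_rate_ge0.
Qed.

Let integral_event_sum H : (forall j x, 0 <= H j x) -> (forall j x, H j x <= 1) ->
  (forall j, measurable_fun setT (H j)) -> \int[P]_w event_sum H w <= (B * N)%:E.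
Proof.
move=> H0 H1 mH.
apply: le_trans (expected_events mpp E_countable E_discrete i0 ec q_rates N0 B0 qB comp).
apply: ge0_le_integral => //.
- by move=> w _; exact: event_sum_ge0.
- exact: measurable_event_sum.
- apply: ge0_emeasurable_sum => [n w _ _|n _]; first by rewrite lee_fin /event_ind.
  by apply/measurable_EFinP; exact: (measurable_event_ind mpp).
move=> w _; apply: lee_nneseries => n _.
  by rewrite mule_ge0// lee_fin /event_ind.
by rewrite -[leRHS]mule1; apply: lee_wpmul2l => //; rewrite lee_fin /event_ind.
Qed.

Let measurable_from_stopped sigma d' (V : measurableType d') (X : W -> V) :
  stopping_time F sigma ->
  measurable_fun setT (X : stopped_space F sigma -> V) -> measurable_fun setT X.
Proof.
move=> sigma_stop mX _ D mD; have := mX measurableT D mD.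
by rewrite (measurable_stoppedE Fsigma sigma_stop) => -[].
Qed.

Let measurable_state_at sigma : stopping_time F sigma ->
  measurable_fun setT (fun w => Z (fine (sigma w)) w).
Proof.
move=> sigma_stop; apply: (measurable_from_stopped sigma_stop).
exact: (measurable_stopped_state mpp E_discrete sigma_stop).
Qed.

Let measurable_duration_at sigma : stopping_time F sigma ->
  measurable_fun setT (fun w => U (fine (sigma w)) w).
Proof.
move=> sigma_stop; apply: (measurable_from_stopped sigma_stop).
exact: (measurable_stopped_duration mpp E_countable E_discrete sigma_stop).
Qed.

Let measurable_uni_val_at (v r u : W -> R) (z : W -> E) : measurable_fun setT v ->
  measurable_fun setT r -> measurable_fun setT u -> measurable_fun setT z ->
  measurable_fun setT (fun w => g (z w) (v w, r w, u w)).
Proof.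
move=> mv mr mu' mz; apply: (@measurable_fun_countable_case _ _ _ W (\bar R) E z
  (fun j w => g j (v w, r w, u w))) => // j.
apply: (measurableT_comp (mg j)); apply: measurable_fun_pair => //.
exact: measurable_fun_pair.
Qed.

(** [path_identity] with a = tau and v = tau + t on [A]; off [A] all terms vanish. The event sums
    and rate integrals have equal means, at most B N because g <= 1, and cancel. *)
Lemma stopped_identity :
  \int[P]_(w in A) f (Z (fine (tau w + t%:E)) w) (U (fine (tau w + t%:E)) w) =
  \int[P]_(w in A) g (Z (fine (tau w)) w)
    (fine (tau w) + t, fine (tau w), U (fine (tau w)) w)%R.
Proof.
have shift_stop := stopping_time_shift tau_stop t0.
have mtau : measurable_fun setT tau by exact: (stopping_measurable Fsigma Fmono Fmeas).
have mA : measurable A by case: FA.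
rewrite [LHS]integral_mkcond [RHS]integral_mkcond.
apply: (@integral_cancel _ _ _ P _ _ (event_sum jump_gain) (event_sum (fun _ => stay_gain))
  (rate_integral jump_gain) (rate_integral (fun _ => stay_gain)) (B * N)).
- by move=> w; rewrite /patch; case: ifP.
- by move=> w; rewrite /patch; case: ifP.
- by move=> w; exact: event_sum_ge0.
- by move=> w; exact: event_sum_ge0.
- by move=> w; exact: rate_integral_ge0.
- by move=> w; exact: rate_integral_ge0.
- apply/(measurable_restrictT _ mA)/measurable_funTS.
  apply: (@measurable_fun_countable_case _ _ _ W (\bar R) E
    (fun w => Z (fine (tau w + t%:E)) w) (fun j w => f j (U (fine (tau w + t%:E)) w))) => //.
    exact: (measurable_state_at shift_stop).
  move=> j; apply: (measurableT_comp (mf j)).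
  exact: (measurable_duration_at shift_stop).
- apply/(measurable_restrictT _ mA)/measurable_funTS.
  have mft : measurable_fun setT (fine \o tau) by exact: measurableT_comp.
  apply: measurable_uni_val_at => //.
  + exact: measurable_funD.
  + exact: (measurable_duration_at tau_stop).
  + exact: (measurable_state_at tau_stop).
- exact: measurable_event_sum.
- by apply: measurable_event_sum.
- exact: measurable_rate_integral.
- by apply: measurable_rate_integral.
- exact: (marked_identity mpp E_countable E_discrete i0 ec q_rates N0 B0 qB comp).
- exact: (marked_identity mpp E_countable E_discrete i0 ec q_rates N0 B0 qB comp).
- exact: integral_event_sum.
- by apply: integral_event_sum.
have := no_explosion mpp E_countable E_discrete i0 ec q_rates N0 B0 qB comp.
apply: filterS => w noexp.
have T0 n : (0 <= fine (T n w))%R by exact/fine_ge0/(event_time_ge0 mpp).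
rewrite /patch; case: ifPn => [/set_mem Aw|nA].
  have tw := tau_fin Aw.
  have vN : (fine (tau w) + t <= N)%R by rewrite -lee_fin EFinD fineK//; exact: AN.
  have av : (fine (tau w) <= fine (tau w) + t)%R by rewrite lerDl.
  have vE : fine (tau w + t%:E) = (fine (tau w) + t)%R by rewrite fineD.
  rewrite vE.
  have subst_terms (x y s1 s2 i1 i2 u1 u2 k1 k2 : \bar R) :
      x + s1 + i1 = y + s2 + i2 -> s1 = u1 -> s2 = u2 -> i1 = k1 -> i2 = k2 ->
      x + u1 + k1 = y + u2 + k2 by move=> + <- <- <- <-.
  apply: subst_terms (path_identity mpp E_countable E_discrete i0 q_rates qB f0 f1 mf
    (tau_ge0 w) av vN noexp) _ _ _ _.
  - by apply: eq_eseriesr => n _; rewrite stay_gainE.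
  - by apply: eq_eseriesr => n _; rewrite jump_gainE.
  - apply: eq_integral => r; rewrite inE/= in_itv/= => /andP[r0 _].
    by apply: eq_eseriesr => k _; rewrite jump_gainE// ltW.
  - apply: eq_integral => r; rewrite inE/= in_itv/= => /andP[r0 _].
    by apply: eq_eseriesr => k _; rewrite stay_gainE// ltW.
have Aw : ~ A w by move=> /mem_set; apply/negP.
have event0 H : (forall j r, (0 <= r)%R -> H j (r, w) = 0) -> event_sum H w = 0.
  by move=> H0; apply: eseries0 => n _ _; rewrite H0 ?mule0.
have rate0 H : (forall j r, (0 <= r)%R -> H j (r, w) = 0) -> rate_integral H w = 0.
  move=> H0; apply: integral0_eq => r; rewrite /= in_itv/= => /andP[r0 _].
  by apply: eseries0 => k _ _; rewrite H0 ?mule0// ltW.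
by rewrite !event0 ?rate0// => j r r0; case: (gain_out j Aw r0).
Qed.



End StoppedIdentity.

Lemma measurable_truncn (R : realType) :
  measurable_fun setT (Num.truncn : R -> nat).
Proof.
move=> _ D _; rewrite setTI.
rewrite (_ : _ @^-1` _ = \bigcup_(n in D) [set x : R | Num.truncn x = n]); last first.
  by apply/seteqP; split => [x Dx|x [n + /= xn]]; [exists (Num.truncn x)|rewrite /preimage /= xn].
apply: bigcup_measurable => n _.
have below m : measurable [set x : R | (Num.truncn x <= m)%N].
  rewrite (_ : mkset _ = `]-oo, m.+1%:R[%classic) //.
  by apply/seteqP; split => x /=; rewrite in_itv/= truncn_le_nat.
case: n => [|m].
  rewrite (_ : mkset _ = [set x : R | (Num.truncn x <= 0)%N]) //.
  by apply/seteqP; split => x /=; rewrite leqn0 => /eqP.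
rewrite (_ : mkset _ = [set x : R | (Num.truncn x <= m.+1)%N] `\` [set x | (Num.truncn x <= m)%N]).
  exact: measurableD.
apply/seteqP; split => x /=; first by move=> ->; rewrite ltnn.
by case=> xm /negP; rewrite -ltnNge => mx; apply/eqP; rewrite eqn_leq xm.
Qed.

(** * The version of the conditional probability *)

Section StrongMarkovVersion.
Context {R : realType} {d : measure_display} {W : measurableType d}.
Context {dE : measure_display} {E : measurableType dE}.
Variables (P : probability W R) (Y : nat -> W -> E) (S : nat -> W -> \bar R).
Hypothesis mpp : is_mpp Y S.
Hypothesis E_countable : countable [set: E].
Hypothesis E_discrete : forall A : set E, measurable A.
Variables (q : E -> E -> R * R -> R) (i0 : E) (e : nat -> E) (c : E -> nat).
Hypothesis ec : forall i, e (c i) = i.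
Hypothesis q_rates : admissible_rates q.
Local Notation Z := (mpp_process Y S).
Local Notation U := (duration Y S).
Local Notation F := (natural_filtration Z).
Local Notation qm m := (trunc_rate q e c m.+1%:R).
Variable (B : nat -> R).
Hypothesis qB : forall m i x, \sum_(k <oo) (qm m i k x)%:E <= (B m)%:E.
Hypothesis comp : forall i, is_compensator P F (counting_process Y S i)
  (integrated_intensity Y S q i).
Variables (tau : W -> \bar R) (t : R) (C : set (E * R)).
Hypothesis tau_stop : stopping_time F tau.
Hypothesis t0 : (0 <= t)%R.
Hypothesis mC : measurable C.

Let Fsigma := natural_filtration_sigma Y S.
Let Fmono := @natural_filtration_mono _ _ _ _ _ Y S.
Let Fmeas := natural_filtration_measurable mpp E_discrete.
Local Notation Ftau := (stopped_sigma_algebra F tau).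

Let qm0 m := trunc_rate_ge0 e c m.+1%:R q_rates.
Let mqm m := measurable_trunc_rate e c m.+1%:R q_rates.
Let C0 := ind_val_ge0 C.
Let C1 := ind_val_le1 C.
Let mC' j := measurable_ind_val j mC.

Let tau_ge0 w : (0 <= fine (tau w))%R.
Proof. exact/fine_ge0/tau_stop.1. Qed.

(** The value 0 stands for an infinite [tau], and m.+1 for m <= tau + t < m.+1, so that m.+1 is a
    horizon not exceeded by tau + t. *)
Let level w : nat :=
  if tau w < +oo then (Num.truncn (fine (tau w) + t)).+1 else 0%N.

Let level_val n w : \bar R :=
  if n is m.+1 then uni_val (qm m) e (B m) (ind_val C) (Z (fine (tau w)) w)
    (fine (tau w) + t, fine (tau w), U (fine (tau w)) w)%R
  else 0.

Definition strong_markov_version w : \bar R := level_val (level w) w.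

Let measurable_level : measurable_fun setT (level : stopped_space F tau -> nat).
Proof.
have mtau := measurable_stopped_tau Fsigma Fmono Fmeas tau_stop.
apply: measurable_fun_ifT; first exact: measurable_fun_lte.
  apply: (measurableT_comp (f := fun x : R => (Num.truncn x).+1)).
    by apply: (measurableT_comp (f := succn)) => //; exact: measurable_truncn.
  by apply: measurable_funD => //; exact: measurableT_comp.
exact: measurable_cst.
Qed.

Let measurable_level_val n : measurable_fun setT (level_val n : stopped_space F tau -> \bar R).
Proof.
case: n => [|m]; first exact: measurable_cst.
have mtau := measurable_stopped_tau Fsigma Fmono Fmeas tau_stop.
have mft : measurable_fun setT (fine \o tau : stopped_space F tau -> R) by exact: measurableT_comp.
have mZ := measurable_stopped_state mpp E_discrete tau_stop.
have mU := measurable_stopped_duration mpp E_countable E_discrete tau_stop.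
apply: (@measurable_fun_countable_case _ _ _ (stopped_space F tau) (\bar R) E
  (fun w => Z (fine (tau w)) w) (fun j w => uni_val (qm m) e (B m) (ind_val C) j
    (fine (tau w) + t, fine (tau w), U (fine (tau w)) w)%R)) => // j.
apply: (measurableT_comp (f := uni_val (qm m) e (B m) (ind_val C) j)).
  exact: measurable_uni_val.
apply: measurable_fun_pair => //; apply: measurable_fun_pair => //.
exact: measurable_funD.
Qed.

Let measurable_version_stopped :
  measurable_fun setT (strong_markov_version : stopped_space F tau -> \bar R).
Proof.
apply: (@measurable_fun_countable_case _ _ _ (stopped_space F tau) (\bar R) nat level level_val) => //.
exact: countableP.
Qed.

Let version_ge0 w : 0 <= strong_markov_version w.
Proof.
by rewrite /strong_markov_version /level_val; case: level => // m; exact: uni_val_ge0.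
Qed.

Let version_le1 w : strong_markov_version w <= 1.
Proof.
rewrite /strong_markov_version /level_val; case: level => // m.
by apply: uni_val_le1 => //; rewrite lerDl.
Qed.

Let hit : set W := [set w | tau w < +oo /\ C (Z (fine (tau w) + t) w, U (fine (tau w) + t) w)].

Let fine_shift w : tau w < +oo -> fine (tau w + t%:E) = (fine (tau w) + t)%R.
Proof.
by move=> tw; rewrite fineD// ge0_fin_numE//; exact: tau_stop.1.
Qed.

Let measurable_hit : measurable hit.
Proof.
have shift_stop := stopping_time_shift tau_stop t0.
have mX := measurable_stopped_pair_state mpp E_countable E_discrete shift_stop.
have [mXC _] : stopped_sigma_algebra F (fun w => tau w + t%:E)
    [set w | C (Z (fine (tau w + t%:E)) w, U (fine (tau w + t%:E)) w)].
  rewrite -(measurable_stoppedE Fsigma shift_stop).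
  by have := mX measurableT C mC; rewrite setTI.
have mtau := stopping_measurable Fsigma Fmono Fmeas tau_stop.
have mlt : measurable [set w | tau w < +oo].
  rewrite -[X in measurable X]setTI.
  exact: emeasurable_fun_infty_o.
rewrite (_ : hit = [set w | tau w < +oo] `&`
   [set w | C (Z (fine (tau w + t%:E)) w, U (fine (tau w + t%:E)) w)]); first exact: measurableI.
by apply/seteqP; split => w [/= tw]; rewrite fine_shift.
Qed.

(** [level] is measurable for the stopped sigma-algebra, so an event of it can be cut into its
    levels. On level 0 both integrands vanish; on level m.+1 [stopped_identity] applies with horizon
    m.+1. *)
Lemma strong_markov_version_cond :
  is_cond_expectation P Ftau (fun w => (\1_hit w)%:E) strong_markov_version.
Proof.
have mV : measurable_wrt Ftau strong_markov_version.
  move=> D mD; rewrite -(measurable_stoppedE Fsigma tau_stop).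
  by have := measurable_version_stopped measurableT mD; rewrite setTI.
have mVW : measurable_fun setT strong_markov_version.
  by move=> _ D mD; rewrite setTI; case: (mV D mD).
have mX : measurable_fun setT (fun w => (\1_hit w)%:E : \bar R).
  by apply/measurable_EFinP; exact: measurable_indic.
split=> //.
  apply/integrableP; split => //; apply: le_lt_trans (ltry 1).
  apply: (@le_trans _ _ (\int[P]_w cst 1 w)).
    apply: ge0_le_integral => //; first exact: measurableT_comp.
    by move=> w _; rewrite gee0_abs.
  by rewrite integral_cst// mul1e; exact: probability_le1.
move=> A FA; have mA : measurable A by case: FA.
pose piece n := A `&` [set w | level w = n].
have Fpiece n : Ftau (piece n).
  rewrite -(measurable_stoppedE Fsigma tau_stop); apply: measurableI.
    by rewrite (measurable_stoppedE Fsigma tau_stop).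
  have mn : measurable [set n] by [].
  by have := measurable_level measurableT mn; rewrite setTI.
have mpiece n : measurable (piece n) by case: (Fpiece n).
have -> : A = \bigcup_n piece n.
  by apply/seteqP; split => [w Aw|w [n _ []]//]; exists (level w).
have tpiece : trivIset setT piece.
  by apply/trivIsetP => m n _ _ mn; apply/seteqP; split => // w [[_ /= wm] [_ /= wn]]; rewrite -wm -wn eqxx in mn.
rewrite !ge0_integral_bigcup//; last 2 first.
- exact: measurable_funTS.
- exact: measurable_funTS.
apply: eq_eseriesr => -[|m] _.
  apply: eq_integral => w; rewrite inE => -[_ /=].
  rewrite /strong_markov_version /level; case: ifPn => // tw _ /=.
  have nhit : ~ hit w by move=> [tw' _]; rewrite tw' in tw.
  by rewrite indicE memNset.
have finite w : piece m.+1 w -> tau w < +oo /\ (Num.truncn (fine (tau w) + t) = m)%R.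
  by case=> _ /=; rewrite /level; case: ifP => // tw [].
have AN w : piece m.+1 w -> tau w + t%:E <= (m.+1%:R)%:E.
  move=> /finite[tw <-]; have tf : tau w \is a fin_num by rewrite ge0_fin_numE// tau_stop.1.
  rewrite -(fineK tf) -EFinD lee_fin ltW//; exact: truncnS_gt.
have B0 : (0 <= B m)%R by exact: (B_ge0 (@qm0 m) (@qB m) i0).
have := stopped_identity mpp E_countable E_discrete i0 ec q_rates (ler0n _ m.+1) B0 (@qB m)
  comp C0 C1 mC' tau_stop t0 (Fpiece m.+1) AN.
move=> id; apply: etrans (etrans (esym id) _).
  apply: eq_integral => w; rewrite inE => -[_ /=].
  by rewrite /strong_markov_version => ->.
apply: eq_integral => w; rewrite inE => /finite[tw _].
rewrite fine_shift// /ind_val diracE indicE; congr ((nat_of_bool _)%:R%:E).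
by apply/idP/idP => /set_mem; [move=> Cw; apply/mem_set|case=> _ Cw; apply/mem_set].
Qed.


End StrongMarkovVersion.

Local Close Scope ereal_scope.

Theorem theorem2p3 (R : realType) (d : measure_display) (W : measurableType d)
  (P : probability W R)
  (dE : measure_display) (E : measurableType dE)
  (E_countable : countable [set: E])
  (E_discrete : forall A : set E, measurable A)
  (q : E -> E -> R * R -> R) (q_rates : admissible_rates q)
  (Y : nat -> W -> E) (S : nat -> W -> \bar R)
  (Z_semi_markov : is_semi_markov Y S P q) :
  strong_markov P (natural_filtration (mpp_process Y S))
    [set x : E * R | 0 <= x.2]
    (fun t w => (mpp_process Y S t w, duration Y S t w)).
Proof.
case: Z_semi_markov => mpp comp.
(* [W] is pointed, which provides a default state. *)
pose i0 := Y 0%N point.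
have [e [c ec]] := countable_enumeration i0 E_countable.
have /choice[B qB] (m : nat) :=
  trunc_rate_bounded ec q_rates (ler0n R m.+1).
pose level (s t : R) : nat := Num.truncn (Num.max s t).
have qm0 m := trunc_rate_ge0 e c m.+1%:R q_rates.
have mqm m := measurable_trunc_rate e c m.+1%:R q_rates.
have /choice[p pE] (st : R * R) :=
  uni_ker_exists e (@qm0 (level st.1 st.2)) (@mqm _) (@qB _) E_countable E_discrete st.1 st.2.
split.
- exact: state_adapted.
- by move=> t w t0; exact: duration_ge0.
exists (fun s t => p (s, t)); split=> [s t x s0 st x0|tau tau_stop t t0 C mC CD].
  (* Nonnegative durations are stable under ageing and resets, so the kernel gives them full
     mass. *)
  rewrite pE; apply: (@uni_trans_mass _ _ _ _ e _ (@qm0 _) (@qB _) s t x _ [set u | 0 <= u]%R) => //=.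
  - rewrite (_ : mkset _ = setT `*` `[0%R, +oo[); first exact: measurableX.
    by apply/seteqP; split => -[j u] /=; rewrite in_itv/= andbT => //; case.
  - by move=> u u' /= u0 uu'; exact: le_trans uu'.
exists (strong_markov_version Y S q e c B tau t C); split.
  exact: strong_markov_version_cond.
(* The equality holds for every outcome with finite [tau]: as tau <= tau + t, the kernel and the
   version use the same horizon truncn(tau + t) + 1. *)
apply: aeW => w tw; rewrite pE /uni_trans asboolT//=.
rewrite /strong_markov_version tw /=.
by rewrite /level/= max_r// lerDl.
Qed.
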